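(* For $i=1,2$ let $Y^{(i)}$ be a subordinate diffusion on the common state space $I$ with characteristics triplet $(\theta_i(x),\gamma_i,\hat\omega_i(\lambda))$, $\theta_i(x)=(\mu_i(x),\sigma_i^2(x))$, built from a diffusion satisfying Assumption 1 (see context) and an independent Lévy subordinator with Laplace exponent $\phi_i$, and let $p_i^\phi(t,x,y)$ be the transition probability density of $Y^{(i)}$. Denote by $\lambda_n$ the $n$-th eigenvalue of the generator of the diffusion with characteristic $\theta_1(x)$. (1) If $p_1^\phi(t,x,y)$ and $p_2^\phi(t,x,y)$ are identical, then there exists a constant $c>0$ such that $$\theta_1(x)=\tfrac1c\,\theta_2(x)\ \ (x\in I),\qquad \gamma_1=c\gamma_2,\qquad \hat\omega_1(-\lambda_n)=c\,\hat\omega_2(-c\lambda_n)\ \text{ for all } n\ge1. \qquad ( * )$$ (2) Conversely, suppose that $( * )$ holds for some constant $c>0$. Suppose in addition that, for each of the two processes (with $\lambda_n,\varphi_n,\gamma,\phi$ denoting its diffusion eigenvalues, normalized eigenfunctions, subordinator drift and Laplace exponent), $\sum_{n=0}^\infty e^{\lambda_n t}<\infty$ for all $t>0$, and that either $\gamma>0$, or $\gamma=0$ and $\varphi_n(x)$ is bounded on any compact set of $x$ for all $n$ and $\sum_{n=0}^\infty e^{-\phi(-\lambda_n)t}<\infty$ for all $t>0$. Then $p_1^\phi(t,x,y)$ and $p_2^\phi(t,x,y)$ are identical.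
   Context: Let $I$ be an interval with endpoints $-\infty\le l<r\le\infty$ and let $X$ be a time-homogeneous diffusion on $I$ with drift $\mu(x)$, diffusion coefficient $\sigma(x)$ and infinitesimal generator $\mathcal G f=\mu f'+\tfrac12\sigma^2 f''$, defined on a dense subset of $L^2(I,q)=\{f:\int_l^r f^2(x)q(x)dx<\infty\}$. Assumption 1: (1) $X$ is ergodic with stationary density $q(x)=m(x)/\int_l^r m(y)dy$, where $m(x)=\sigma^{-2}(x)\exp\left[\int^x \frac{2\mu(y)}{\sigma^2(y)}dy\right]$; (2) the spectrum of $\mathcal G$ is purely discrete; (3) $\mu$ and $\sigma$ are twice continuously differentiable and $\sigma>0$ on any interval $[a,b]\subset I$. Under Assumption 1, an endpoint belonging to $I$ is a reflecting boundary, and an endpoint not in $I$ is inaccessible. The eigenvalues of $\mathcal G$ are simple, $0=\lambda_0>\lambda_1>\lambda_2>\cdots$, with eigenfunctions $\varphi_n$ ($\mathcal G\varphi_n=\lambda_n\varphi_n$, $\varphi_0\equiv1$) forming an orthonormal basis of $L^2(I,q)$. A Lévy subordinator $T$ is a nonnegative Lévy process (here not identically zero), independent of $X$, with $E[e^{-\lambda T_t}]=e^{-\phi(\lambda)t}$, $\phi(\lambda)=\gamma\lambda+\int_{(0,\infty)}(1-e^{-\lambda s})\nu(ds)$ for $\lambda\ge0$ ($\phi$ is the Laplace exponent), where $\gamma\ge0$ is the drift and $\nu$ is the Lévy measure, $\int_{(0,\infty)}(s\wedge1)\nu(ds)<\infty$. The subordinate diffusion is $Y_t=X_{T_t}$.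 Set $\theta(x)=(\mu(x),\sigma^2(x))$, $\omega(s)=\nu(s,\infty)$, and $\hat\omega(\lambda)=\int_0^\infty e^{-\lambda s}\omega(s)ds$ for $\lambda>0$. The triplet $(\theta(x),\gamma,\hat\omega(\lambda))$ is called the characteristics triplet of $Y$. ''Identical'' means equal for all $t>0$ and all $x,y$. *)

(* Defs.v *)
From HB Require Import structures.
From mathcomp Require Import all_boot all_order all_algebra.
From mathcomp Require Import all_classical all_reals all_analysis.
From mathcomp Require Import measurable_realfun.

Set Implicit Arguments.
Unset Strict Implicit.
Unset Printing Implicit Defensive.

Import Order.TTheory GRing.Theory Num.Theory.
Import numFieldNormedType.Exports.

Local Open Scope classical_set_scope.
Local Open Scope ring_scope.

Section state_space.
Context {R : realType}.
Implicit Types (l r : \bar R) (I : set R) (f g mu sigma q : R -> R).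

Notation leb := (@lebesgue_measure R).

Definition interior_pt l r (x : R) : Prop := (l < x%:E)%E /\ (x%:E < r)%E.

(* Each endpoint may or may not belong to [I]. *)
Definition interval_with_endpoints l r I : Prop :=
  [/\ (l < r)%E,
      (forall x, interior_pt l r x -> I x) &
      (forall x, I x -> (l <= x%:E)%E /\ (x%:E <= r)%E)].

(* Twice continuously differentiable on [I]; at an endpoint belonging to [I],
   this means that f, f', f'' extend continuously to the endpoint. *)
Definition C2_on l r I f : Prop := exists f1 f2 : R -> R,
  [/\ {within I, continuous f}, {within I, continuous f1},
      {within I, continuous f2} &
      forall x, interior_pt l r x ->
        is_derive x (1 : R) f (f1 x) /\ is_derive x (1 : R) f1 (f2 x)].

Definition oriented_integral f (a b : R) : R :=
  if a <= b then \int[leb]_(y in `[a, b]) f y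
  else - \int[leb]_(y in `[b, a]) f y.

(* The lower limit of the integral is an arbitrary but fixed point of [I]; it
   only affects the multiplicative constant, which cancels in
   [stationary_density]. *)
Definition speed_density I mu sigma (x : R) : R :=
  (sigma x ^+ 2)^-1 *
  expR (oriented_integral (fun y => 2 * mu y / sigma y ^+ 2) (xget 0 I) x).

Definition stationary_density I mu sigma (x : R) : R :=
  speed_density I mu sigma x / \int[leb]_(y in I) speed_density I mu sigma y.

Definition L2norm_sq I q f : \bar R :=
  (\int[leb]_(x in I) (f x ^+ 2 * q x)%:E)%E.

Definition L2 I q f : Prop := measurable_fun I f /\ (L2norm_sq I q f < +oo)%E.

Definition L2dot I q f g : R := \int[leb]_(x in I) (f x * g x * q x).

Definition tends_to_0_left l r f : Prop :=
  forall e, 0 < e -> exists2 a, interior_pt l r a &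
    forall x, (l < x%:E)%E -> x < a -> `|f x| < e.

Definition tends_to_0_right l r f : Prop :=
  forall e, 0 < e -> exists2 a, interior_pt l r a &
    forall x, a < x -> (x%:E < r)%E -> `|f x| < e.

(* [f] is C^1 with f' locally absolutely continuous (f2 is the a.e. second
   derivative), mu f' + sigma^2 f'' / 2 = g a.e., and the derivative of [f] with
   respect to the scale measure, f'/s = sigma^2 m f' (here with q, which is
   proportional to m), vanishes at both endpoints.  This is the Neumann
   condition f' = 0 at a reflecting endpoint, and the usual condition
   lim f'/s = 0 at an inaccessible one. *)
Definition diffusion_operator l r I mu sigma f g : Prop :=
  let q := stationary_density I mu sigma in
  exists f1 f2 : R -> R,
  [/\ (forall x, interior_pt l r x -> is_derive x (1 : R) f (f1 x)),
      (forall x y, interior_pt l r x -> interior_pt l r y -> x <= y ->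
         leb.-integrable `[x, y] (EFin \o f2) /\
         f1 y - f1 x = \int[leb]_(z in `[x, y]) f2 z),
      {ae leb, forall x, I x ->
         g x = mu x * f1 x + 2^-1 * sigma x ^+ 2 * f2 x},
      tends_to_0_left l r (fun x => sigma x ^+ 2 * q x * f1 x) &
      tends_to_0_right l r (fun x => sigma x ^+ 2 * q x * f1 x)].

End state_space.

(* An operator on L^2(I,q) is represented by its graph [G : f -> g -> Prop] on
   representatives of classes modulo a.e. equality on [I]. *)
Section spectrum.
Context {R : realType}.
Variables (I : set R) (q : R -> R) (G : (R -> R) -> (R -> R) -> Prop).

Notation leb := (@lebesgue_measure R).
Implicit Types (lam : R) (f g h : R -> R).

Definition resolvent_pt lam : Prop :=
  (exists2 C : R, 0 < C & forall f g, G f g ->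
     (L2norm_sq I q f <= C%:E * L2norm_sq I q (fun x => (g x - lam * f x)%R))%E) /\
  (forall h, L2 I q h -> exists f g, G f g /\
     {ae leb, forall x, I x -> g x - lam * f x = h x}).

(* Real points suffice: the generator of a one-dimensional diffusion is
   self-adjoint in L^2(I,q). *)
Definition in_spectrum lam : Prop := ~ resolvent_pt lam.

Definition eigenfunction lam f : Prop := G f (fun x => lam * f x).

Definition finite_multiplicity_eigenvalue lam : Prop :=
  (exists2 f, eigenfunction lam f & (L2norm_sq I q f != 0)%E) /\
  (exists (N : nat) (e : 'I_N -> R -> R),
     forall f, eigenfunction lam f -> exists c : 'I_N -> R,
       {ae leb, forall x, I x -> f x = \sum_(k < N) c k * e k x}).

Definition purely_discrete_spectrum : Prop :=
  forall lam, in_spectrum lam ->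
    finite_multiplicity_eigenvalue lam /\
    exists2 e : R, 0 < e &
      forall lam', in_spectrum lam' -> `|lam' - lam| < e -> lam' = lam.

(* [phi n] denotes the continuous representative of the n-th eigenfunction. *)
Record eigensystem (lam : nat -> R) (phi : nat -> R -> R) : Prop := {
  eigenvalue0 : lam 0%N = 0;
  eigenvalue_decr : forall n, lam n.+1 < lam n;
  eigenfunction0 : forall x, I x -> phi 0%N x = 1;
  eigenfunction_cont : forall n, {within I, continuous (phi n)};
  eigenfunctionP : forall n, eigenfunction (lam n) (phi n);
  eigen_orthonormal : forall m n, L2dot I q (phi m) (phi n) = (m == n)%:R;
  eigen_basis : forall f, L2 I q f ->
    (fun N : nat => L2norm_sq I q
       (fun x => f x - \sum_(n < N) L2dot I q f (phi n) * phi n x))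
      @ \oo --> 0%E }.

End spectrum.

Section processes.
Context {R : realType} {d : measure_display} {O : measurableType d}.
Implicit Types (P : probability O R) (Px : R -> probability O R).
Implicit Types (X T : R -> O -> R) (I : set R).

Notation leb := (@lebesgue_measure R).

(* Processes are indexed by [R]; only the times t >= 0 are meaningful. *)
Definition cylinder X (n : nat) (t : nat -> R) (A : nat -> set R) : set O :=
  \bigcap_(i < n) (X (t i) @^-1` A i).

Definition independent_processes P X T : Prop :=
  forall (m n : nat) (s t : nat -> R) (A B : nat -> set R),
    (forall i, 0 <= s i) -> (forall i, 0 <= t i) ->
    (forall i, measurable (A i)) -> (forall i, measurable (B i)) ->
    (P (cylinder X m s A `&` cylinder T n t B) =
     P (cylinder X m s A) * P (cylinder T n t B))%E.

(* [Px x] is the law under which the process starts at [x]. *)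
Record markov_process I Px X : Prop := {
  markov_state : forall (t : R) w, 0 <= t -> I (X t w);
  markov_meas : forall t : R, 0 <= t -> measurable_fun setT (X t);
  markov_continuous_paths : forall w,
    {within `[0, +oo[, continuous (fun t => X t w)};
  markov_start : forall x, I x -> Px x [set w | X 0 w = x] = 1%E;
  markov_kernel : forall (t : R) (A : set R), 0 <= t -> measurable A ->
    measurable_fun I (fun x => Px x (X t @^-1` A));
  markov_property : forall (x s u : R) n (t : nat -> R) (A : nat -> set R) (B : set R),
    I x -> 0 <= s -> 0 <= u -> (forall i, 0 <= t i <= s) ->
    (forall i, measurable (A i)) -> measurable B ->
    Px x (cylinder X n t A `&` X (s + u) @^-1` B) =
    (\int[Px x]_(w in cylinder X n t A) Px (X s w) (X u @^-1` B))%E }.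

Definition semigroup Px X (t : R) (f : R -> R) (x : R) : R :=
  \int[Px x]_w f (X t w).

(* The infinitesimal generator of the semigroup of [X] acting on L^2(I,q). *)
Definition L2_generator I (q : R -> R) Px X (f g : R -> R) : Prop :=
  [/\ L2 I q f, L2 I q g &
      (fun h : R => L2norm_sq I q
         (fun x => (semigroup Px X h f x - f x) / h - g x)) @ 0^'+ --> 0%E].

(* [X] is a diffusion on [I] with drift [mu] and diffusion coefficient [sigma],
   the endpoints in [I] being reflecting and those not in [I] inaccessible. *)
Definition diffusion (l r : \bar R) I (mu sigma : R -> R) Px X : Prop :=
  let q := stationary_density I mu sigma in
  markov_process I Px X /\
  forall f g, L2 I q f -> L2 I q g ->
    (L2_generator I q Px X f g <->
     exists2 f0, {ae leb, forall x, I x -> f0 x = f x} &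
       diffusion_operator l r I mu sigma f0 g).

Definition ergodic I (q : R -> R) Px X : Prop :=
  (forall (t : R) (A : set R), 0 <= t -> measurable A -> A `<=` I ->
     (\int[leb]_(x in I) (Px x (X t @^-1` A) * (q x)%:E) =
      \int[leb]_(x in A) (q x)%:E)%E) /\
  (forall A : set R, measurable A -> A `<=` I ->
     (forall t : R, 0 < t ->
        {ae leb, forall x, I x -> Px x (X t @^-1` A) = (\1_A x)%:E}) ->
     (\int[leb]_(x in A) (q x)%:E = 0)%E \/
     (\int[leb]_(x in A) (q x)%:E = 1)%E).

Record Assumption1 (l r : \bar R) I (mu sigma : R -> R) Px X : Prop := {
  speed_finite :
    (\int[leb]_(x in I) (speed_density I mu sigma x)%:E < +oo)%E;
  A1_ergodic : ergodic I (stationary_density I mu sigma) Px X;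
  A1_spectrum : let q := stationary_density I mu sigma in
    purely_discrete_spectrum I q (L2_generator I q Px X);
  A1_drift : C2_on l r I mu;
  A1_diffusion : C2_on l r I sigma;
  A1_nondegenerate : forall x, I x -> 0 < sigma x }.

(* Only the restriction of the Levy measure [nu] to ]0, +oo[ is used. *)
Definition laplace_exponent (gamma : R) (nu : {measure set R -> \bar R})
    (lam : R) : R :=
  gamma * lam + \int[nu]_(s in `]0, +oo[) (1 - expR (- lam * s)).

Definition levy_tail (nu : {measure set R -> \bar R}) (s : R) : \bar R :=
  nu `]s, +oo[%classic.

(* omega-hat *)
Definition levy_tail_transform (nu : {measure set R -> \bar R})
    (lam : R) : \bar R :=
  (\int[leb]_(s in `]0%R, +oo[) ((expR (- lam * s))%:E * levy_tail nu s))%E.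

Record levy_process P T : Prop := {
  levy_meas : forall t : R, 0 <= t -> measurable_fun setT (T t);
  levy_start : P [set w | T 0 w = 0] = 1%E;
  levy_right_continuous : forall (t : R) w, 0 <= t -> T s w @[s --> t^'+] --> T t w;
  levy_left_limits : forall (t : R) w, 0 < t -> cvg (T s w @[s --> t^'-]);
  levy_stationary : forall (s t : R) (A : set R), 0 <= s -> 0 <= t -> measurable A ->
    P [set w | A (T (s + t) w - T s w)] = P [set w | A (T t w)];
  levy_independent : forall n (t : nat -> R) (A : nat -> set R),
    0 <= t 0%N -> (forall i, t i <= t i.+1) -> (forall i, measurable (A i)) ->
    P (\bigcap_(i < n) [set w | A i (T (t i.+1) w - T (t i) w)%R]) =
    (\prod_(i < n) P [set w | A i (T (t i.+1) w - T (t i) w)%R])%E }.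

Record levy_subordinator P T (gamma : R) (nu : {measure set R -> \bar R})
    : Prop := {
  subordinator_levy : levy_process P T;
  subordinator_ge0 : forall (t : R) w, 0 <= t -> 0 <= T t w;
  subordinator_nonzero : ~ (forall t : R, 0 <= t -> P [set w | T t w = 0] = 1%E);
  subordinator_drift : 0 <= gamma;
  subordinator_levy_measure :
    (\int[nu]_(s in `]0%R, +oo[) (Num.min s 1)%:E < +oo)%E;
  subordinator_laplace : forall t lam : R, 0 <= t -> 0 <= lam ->
    (\int[P]_w (expR (- lam * T t w))%:E)%E =
    (expR (- laplace_exponent gamma nu lam * t))%:E }.

End processes.

(* [sd_diffusion] and [sd_subordinator] are the processes X and T. *)
Record subordinate_data (R : realType) (d : measure_display)
    (O : measurableType d) := SubordinateData {
  sd_mu : R -> R;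
  sd_sigma : R -> R;
  sd_gamma : R;
  sd_nu : {measure set R -> \bar R};
  sd_prob : R -> probability O R;
  sd_diffusion : R -> O -> R;
  sd_subordinator : R -> O -> R }.

Section subordinate_diffusion.
Context {R : realType} {d : measure_display} {O : measurableType d}.
Implicit Types (Y : subordinate_data R O) (p : R -> R -> R -> \bar R).

Notation leb := (@lebesgue_measure R).

Definition sd_process Y (t : R) (w : O) : R :=
  sd_diffusion Y (sd_subordinator Y t w) w.

Definition sd_theta Y (x : R) : R * R := (sd_mu Y x, sd_sigma Y x ^+ 2).

Definition sd_phi Y : R -> R := laplace_exponent (sd_gamma Y) (sd_nu Y).

Definition sd_omega_hat Y : R -> \bar R := levy_tail_transform (sd_nu Y).

Definition sd_q (I : set R) Y : R -> R :=
  stationary_density I (sd_mu Y) (sd_sigma Y).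

Record subordinate_diffusion (l r : \bar R) (I : set R) Y : Prop := {
  sd_is_diffusion :
    diffusion l r I (sd_mu Y) (sd_sigma Y) (sd_prob Y) (sd_diffusion Y);
  sd_assumption1 :
    Assumption1 l r I (sd_mu Y) (sd_sigma Y) (sd_prob Y) (sd_diffusion Y);
  sd_is_subordinator : forall x, I x ->
    levy_subordinator (sd_prob Y x) (sd_subordinator Y) (sd_gamma Y) (sd_nu Y);
  sd_independent : forall x, I x ->
    independent_processes (sd_prob Y x) (sd_diffusion Y) (sd_subordinator Y) }.

(* Eigenvalues and normalized eigenfunctions of the generator of X. *)
Definition sd_eigensystem (I : set R) Y : (nat -> R) -> (nat -> R -> R) -> Prop :=
  eigensystem I (sd_q I Y)
    (L2_generator I (sd_q I Y) (sd_prob Y) (sd_diffusion Y)).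

(* [p t x] is the density of the law of [Z t] started at [x]. *)
Definition transition_density (I : set R) (Px : R -> probability O R)
    (Z : R -> O -> R) p : Prop :=
  forall t x : R, 0 < t -> I x ->
    [/\ measurable_fun I (p t x), (forall y, I y -> (0 <= p t x y)%E) &
        forall A : set R, measurable A -> A `<=` I ->
          Px x (Z t @^-1` A) = (\int[leb]_(y in A) p t x y)%E].

(* The law of Y_t determines [p t x y] only for a.e. y.  The pointwise version
   is E[p_X(T_t, x, y)], with p_X the continuous transition density of X (with
   respect to dy); it may be infinite. *)
Definition pointwise_density (I : set R) Y p : Prop :=
  exists pX : R -> R -> R -> R,
  [/\ transition_density I (sd_prob Y) (sd_diffusion Y)
        (fun t x y => (pX t x y)%:E),
      {within [set z : R * R * R | [/\ 0 < z.1.1, I z.1.2 & I z.2]],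
         continuous (fun z : R * R * R => pX z.1.1 z.1.2 z.2)} &
      forall t x y : R, 0 < t -> I x -> I y ->
        p t x y = (\int[sd_prob Y x]_(w in [set w | 0 < sd_subordinator Y t w]%R)
                     (pX (sd_subordinator Y t w) x y)%:E)%E].

(* The bound on the eigenfunctions is uniform in n. *)
Definition summability (I : set R) Y (lam : nat -> R) (phi : nat -> R -> R)
    : Prop :=
  (forall t : R, 0 < t -> (\sum_(0 <= n <oo) (expR (lam n * t))%:E < +oo)%E) /\
  (0 < sd_gamma Y \/
   [/\ sd_gamma Y = 0,
       (forall K : set R, compact K -> K `<=` I ->
          exists M : R, forall n x, K x -> `|phi n x| <= M) &
       (forall t : R, 0 < t ->
          (\sum_(0 <= n <oo) (expR (- sd_phi Y (- lam n) * t))%:E < +oo)%E)]).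

End subordinate_diffusion.

Definition identical_densities (R : realType) (I : set R)
    (p1 p2 : R -> R -> R -> \bar R) : Prop :=
  forall t x y : R, 0 < t -> I x -> I y -> p1 t x y = p2 t x y.

(* [lam] are the eigenvalues of the diffusion underlying [Y1]. *)
Definition equivalent_triplets (R : realType) (I : set R)
    (d1 d2 : measure_display) (O1 : measurableType d1) (O2 : measurableType d2)
    (Y1 : subordinate_data R O1) (Y2 : subordinate_data R O2)
    (lam : nat -> R) (c : R) : Prop :=
  [/\ (forall x, I x -> sd_theta Y1 x = c^-1 *: sd_theta Y2 x),
      sd_gamma Y1 = c * sd_gamma Y2 &
      forall n, (1 <= n)%N ->
        sd_omega_hat Y1 (- lam n) = (c%:E * sd_omega_hat Y2 (- (c * lam n))%R)%E].

(* Main.v *)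
(** Part (1).  With [U = exp(-T_t)], Bernstein approximation of [s |-> X_(-ln s)] writes
    [E f(X_(T_t))] as a limit of mixtures of the [P_s f] whose weights do not depend on
    the starting point, so the subordinate semigroup multiplies [phi_n] by
    [exp(-phi(-lambda_n) t)].  Letting [t] tend to infinity, equal densities have equal
    stationary densities [q]; comparing the two orthonormal eigenbases of one self-adjoint
    operator with simple, strictly ordered eigenvalues gives the same eigenfunctions up to
    sign and [phi_1(-lambda_n) = phi_2(-lambda'_n)].  Integrating
    [(sigma^2 q phi_n')' = 2 lambda_n q phi_n] from the boundary shows that
    [lambda_n sigma'^2 = lambda'_n sigma^2] wherever [phi_n' <> 0], and these open sets
    together are dense, so [sigma^2 / sigma'^2] is constant; [mu] follows from
    [(sigma^2 q)' = 2 mu q].  Finally [phi(lambda) = lambda (gamma + omegahat(lambda))],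
    where [omegahat] vanishes at infinity and [- lambda_n] tends to infinity.

    Part (2).  Proportional coefficients give the same [q] and eigensystem.  The diffusion
    density has a pointwise Mercer expansion, obtained by testing the semigroup against
    averages over shrinking windows, with tail controlled by [exp(lambda_N s / 2)] times
    the diagonal.  Integrating it over the law of [T_t] on [T_t > 0] leaves a series that
    depends only on the numbers [phi(-lambda_n)], because [P(T_t = 0)] is the limit of
    [exp(-phi(-lambda_n) t)]. *)

Require Import Defs.
From HB Require Import structures.
From mathcomp Require Import all_boot all_order all_algebra.
From mathcomp Require Import all_classical all_reals all_analysis.
From mathcomp Require Import measurable_realfun.
From mathcomp Require Import ring lra finmap.

Set Implicit Arguments.
Unset Strict Implicit.
Unset Printing Implicit Defensive.

Import Order.TTheory GRing.Theory Num.Theory.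
Import numFieldNormedType.Exports.
Local Open Scope classical_set_scope.
Local Open Scope ring_scope.

(** * Weighted L2 spaces *)

(** Independence of [X] and [T] is known only on finite cylinders, and [X] is measurable only at
    fixed times, so [X_(T_t)] cannot be conditioned on [T_t] directly. Polynomials in [exp(-T_t)]
    involve finitely many times, and their expectations are Laplace transforms at integers, the same
    under every [Px x]. This limit is available for bounded continuous functions, while
    eigenfunctions may be unbounded; hence a truncation before eigenfunctions are compared.
    Semigroup identities hold almost everywhere; continuity of eigenfunctions, coefficients and
    densities restores them at every point of [I], endpoints included. A dense open set on which
    [sigma^2 / sigma'^2] is locally constant would not suffice (Cantor's function); the C^1
    regularity of the ratio closes this gap. In the converse the off-diagonal series has no sign and
    its sum is not known to be finite in advance; polarization reduces it to three nonnegative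
    series, of which the two diagonal ones are finite by the summability condition. *)

Section ae_tools.
Context {d : measure_display} {T : measurableType d} {R : realType}.
Variable mu : {measure set T -> \bar R}.

Lemma ae_imp (P Q : T -> Prop) : (forall x, P x -> Q x) ->
  {ae mu, forall x, P x} -> {ae mu, forall x, Q x}.
Proof. by move=> PQ; apply: filterS. Qed.

Lemma ae_imp2 (P1 P2 Q : T -> Prop) : (forall x, P1 x -> P2 x -> Q x) ->
  {ae mu, forall x, P1 x} -> {ae mu, forall x, P2 x} -> {ae mu, forall x, Q x}.
Proof. by move=> PQ; apply: filterS2. Qed.

Lemma ae_and (P1 P2 : T -> Prop) :
  {ae mu, forall x, P1 x} -> {ae mu, forall x, P2 x} ->
  {ae mu, forall x, P1 x /\ P2 x}.
Proof. exact: ae_imp2. Qed.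

End ae_tools.

Section weighted_L2.
Context {R : realType} (I : set R) (q : R -> R).
Hypotheses (mI : measurable I) (mq : measurable_fun I q).
Hypothesis q0 : forall x, I x -> 0 < q x.
Let mI' : measurable (I : set (measurableTypeR R)) := mI.
Local Notation leb := (@lebesgue_measure R).
Local Notation dot := (L2dot I q).
Local Notation L2 := (L2 I q).
Local Notation integrable f := (leb.-integrable I (EFin \o f)).
Implicit Types f g h : R -> R.

Lemma integrable_scale a f : integrable f -> integrable (fun x => a * f x).
Proof.
by move=> If; apply: eq_integrable (integrableZl mI' a If) => // x _; rewrite /= EFinM.
Qed.

Lemma measurable_weight3 f g : measurable_fun I f -> measurable_fun I g ->
  measurable_fun I (fun x => f x * g x * q x).
Proof. by move=> mf mg; apply: measurable_funM => //; exact: measurable_funM. Qed.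

Lemma L2P f : L2 f <-> measurable_fun I f /\ integrable (fun x => f x * f x * q x).
Proof.
have E : (\int[leb]_(x in I) `|(f x * f x * q x)%:E|)%E = L2norm_sq I q f.
  apply: eq_integral => x /set_mem Ix /=.
  by rewrite ger0_norm -expr2// mulr_ge0 ?sqr_ge0// ltW ?q0.
split=> -[mf fo]; split=> //.
- apply/integrableP; split; last by rewrite E.
  by apply/measurable_EFinP; exact: measurable_weight3.
- by move/integrableP : fo => [_]; rewrite E.
Qed.

Lemma L2_integrable_le f h : measurable_fun I f -> integrable h ->
  (forall x, I x -> f x * f x * q x <= h x) -> L2 f.
Proof.
move=> mf ih fh; apply/L2P; split=> //.
apply: (le_integrable mI' _ _ ih).
- by apply/measurable_EFinP; exact: measurable_weight3.
- move=> x Ix /=; rewrite lee_fin ger0_norm; last first.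
    by rewrite -expr2 mulr_ge0 ?sqr_ge0// ltW ?q0.
  by rewrite (le_trans (fh _ Ix))// ler_norm.
Qed.

Lemma L2_integrable f g : L2 f -> L2 g -> integrable (fun x => f x * g x * q x).
Proof.
move=> /L2P[mf If] /L2P[mg Ig].
apply: (@le_integrable _ _ _ _ _ mI' _ (EFin \o (fun x => f x * f x * q x + g x * g x * q x))).
- by apply/measurable_EFinP; exact: measurable_weight3.
- move=> x Ix /=; rewrite lee_fin; have := q0 Ix => qx.
  rewrite -mulrDl 2!normrM [in X in _ <= X]normrM (gtr0_norm qx) ler_pM2r//.
  rewrite [X in _ <= X]ger0_norm; last by rewrite addr_ge0// -expr2 sqr_ge0.
  rewrite -!expr2 -(real_normK (num_real (f x))) -(real_normK (num_real (g x))).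
  have := sqr_ge0 (`|f x| - `|g x|); have := sqr_ge0 (`|f x| + `|g x|); nra.
- exact: (integrableD mI' If Ig).
Qed.

Lemma L2norm_sqE f : L2 f -> L2norm_sq I q f = (dot f f)%:E.
Proof.
move=> Lf; rewrite /L2dot /Rintegral fineK; last first.
  exact: (integrable_fin_num mI' (L2_integrable Lf Lf)).
by apply: eq_integral => x _; rewrite expr2.
Qed.

Lemma L2D f g : L2 f -> L2 g -> L2 (fun x => f x + g x).
Proof.
move=> /L2P[mf If] /L2P[mg Ig].
apply: (@L2_integrable_le _ (fun x => 2 * (f x * f x * q x + g x * g x * q x))).
- exact: measurable_funD.
- exact/integrable_scale/(integrableD mI' If Ig).
- move=> x Ix; rewrite -mulrDl mulrA ler_pM2r ?q0//.
  have := sqr_ge0 (f x - g x); nra.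
Qed.

Lemma L2Z a f : L2 f -> L2 (fun x => a * f x).
Proof.
move=> /L2P[mf If].
apply: (@L2_integrable_le _ (fun x => a ^+ 2 * (f x * f x * q x))).
- exact: measurable_funM.
- exact: integrable_scale.
- by move=> x Ix; rewrite le_eqVlt; apply/orP; left; apply/eqP; ring.
Qed.

Lemma L2N f : L2 f -> L2 (fun x => - f x).
Proof.
by move=> /(L2Z (-1)); congr (Defs.L2 _ _ _); apply/funext => x; rewrite mulN1r.
Qed.

Lemma L2B f g : L2 f -> L2 g -> L2 (fun x => f x - g x).
Proof. by move=> Lf /L2N; exact: L2D. Qed.

Lemma L20 : L2 (fun=> 0).
Proof.
apply: (@L2_integrable_le _ (fun=> 0)) => //; first exact: integrable0.
by move=> x Ix; rewrite !mul0r.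
Qed.

Lemma L2_sum n (F : 'I_n -> R -> R) : (forall i, L2 (F i)) ->
  L2 (fun x => \sum_(i < n) F i x).
Proof.
move=> LF; elim: n F LF => [|n ih] F LF.
  by under eq_fun do rewrite big_ord0; exact: L20.
by under eq_fun do rewrite big_ord_recr/=; apply/L2D; [exact: ih|exact: LF].
Qed.

Lemma dotC f g : dot f g = dot g f.
Proof. by apply: eq_Rintegral => x _; rewrite (mulrC (f x)). Qed.

Lemma dotDl f g h : L2 f -> L2 g -> L2 h ->
  dot (fun x => f x + g x) h = dot f h + dot g h.
Proof.
move=> Lf Lg Lh; rewrite /L2dot -RintegralD//; last 2 first.
- exact: L2_integrable.
- exact: L2_integrable.
by apply: eq_Rintegral => x _; rewrite -mulrDl -mulrDl.
Qed.

Lemma dotZl a f h : L2 f -> L2 h -> dot (fun x => a * f x) h = a * dot f h.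
Proof.
move=> Lf Lh; rewrite /L2dot -RintegralZl//; last exact: L2_integrable.
by apply: eq_Rintegral => x _; rewrite !mulrA.
Qed.

Lemma dotNl f h : L2 f -> L2 h -> dot (fun x => - f x) h = - dot f h.
Proof.
move=> Lf Lh; rewrite -mulN1r -dotZl//; congr (L2dot _ _ _ _).
by apply/funext => x; rewrite mulN1r.
Qed.

Lemma dotBl f g h : L2 f -> L2 g -> L2 h ->
  dot (fun x => f x - g x) h = dot f h - dot g h.
Proof. by move=> Lf Lg Lh; rewrite dotDl ?dotNl//; exact: L2N. Qed.

Lemma dotDr f g h : L2 f -> L2 g -> L2 h ->
  dot h (fun x => f x + g x) = dot h f + dot h g.
Proof. by move=> Lf Lg Lh; rewrite dotC dotDl// !(dotC h). Qed.

Lemma dotBr f g h : L2 f -> L2 g -> L2 h ->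
  dot h (fun x => f x - g x) = dot h f - dot h g.
Proof. by move=> Lf Lg Lh; rewrite dotC dotBl// !(dotC h). Qed.

Lemma dotZr a f h : L2 f -> L2 h -> dot h (fun x => a * f x) = a * dot h f.
Proof. by move=> Lf Lh; rewrite dotC dotZl// (dotC h). Qed.

Lemma dot_suml n (F : 'I_n -> R -> R) h : (forall i, L2 (F i)) -> L2 h ->
  dot (fun x => \sum_(i < n) F i x) h = \sum_(i < n) dot (F i) h.
Proof.
move=> LF Lh; elim: n F LF => [|n ih] F LF.
  rewrite big_ord0 -[RHS](mul0r (dot (fun=> 0) h)) -dotZl//; last exact: L20.
  by congr (L2dot _ _ _ _); apply/funext => x; rewrite big_ord0 mul0r.
rewrite big_ord_recr/= -ih// -dotDl//; last exact: L2_sum.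
by congr (L2dot _ _ _ _); apply/funext => x; rewrite big_ord_recr.
Qed.

Lemma dot_ge0 f : 0 <= dot f f.
Proof.
apply: Rintegral_ge0 => x Ix; rewrite -expr2 mulr_ge0 ?sqr_ge0//.
exact/ltW/q0.
Qed.

Definition L2n f := Num.sqrt (dot f f).

Lemma L2n_ge0 f : 0 <= L2n f. Proof. exact: sqrtr_ge0. Qed.

Lemma L2n_sq f : L2n f ^+ 2 = dot f f.
Proof. by rewrite sqr_sqrtr// dot_ge0. Qed.

Lemma dot_sqD f g : L2 f -> L2 g ->
  dot (fun x => f x + g x) (fun x => f x + g x) = dot f f + 2 * dot f g + dot g g.
Proof.
move=> Lf Lg; have Lfg := L2D Lf Lg.
by rewrite dotDl// !dotDr// (dotC g f); ring.
Qed.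

Lemma dot_sqB f g : L2 f -> L2 g ->
  dot (fun x => f x - g x) (fun x => f x - g x) = dot f f - 2 * dot f g + dot g g.
Proof.
move=> Lf Lg; have Lfg := L2B Lf Lg.
by rewrite dotBl// !dotBr// (dotC g f); ring.
Qed.

(** Nonnegativity of the quadratic [t |-> |f - t g|^2], evaluated at its minimizer
    [dot f g / dot g g]. *)
Lemma dot_CS f g : L2 f -> L2 g -> `|dot f g| <= L2n f * L2n g.
Proof.
move=> Lf Lg.
suff H : dot f g ^+ 2 <= dot f f * dot g g.
  rewrite -(@ler_pXn2r _ 2)// ?nnegrE ?mulr_ge0 ?L2n_ge0//.
  by rewrite real_normK ?num_real// exprMn !L2n_sq.
have P t : 0 <= dot f f - 2 * t * dot f g + t ^+ 2 * dot g g.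
  have := dot_ge0 (fun x => f x - t * g x).
  have Lt := L2Z t Lg.
  by rewrite dot_sqB// dotZr// dotZl// dotZr//; congr (_ <= _); ring.
have [g0|g0] := eqVneq (dot g g) 0.
  suff -> : dot f g = 0 by rewrite g0 expr0n mulr0.
  have [//|fg0] := eqVneq (dot f g) 0.
  (* With [dot g g = 0] the quadratic is affine in [t]; at this [t] it would equal -1. *)
  have := P ((dot f f + 1) / (2 * dot f g)).
  rewrite g0 mulr0 addr0.
  rewrite (_ : 2 * _ * _ = dot f f + 1); last by field.
  by rewrite opprD addrA subrr add0r lerNr oppr0 ler10.
have gp : 0 < dot g g by rewrite lt_neqAle eq_sym g0 dot_ge0.
have H := P (dot f g / dot g g); rewrite -subr_ge0.
have -> : dot f f * dot g g - dot f g ^+ 2 =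
  dot g g * (dot f f - 2 * (dot f g / dot g g) * dot f g + (dot f g / dot g g) ^+ 2 * dot g g).
  by field.
by rewrite mulr_ge0 ?dot_ge0.
Qed.

Lemma L2nD f g : L2 f -> L2 g -> L2n (fun x => f x + g x) <= L2n f + L2n g.
Proof.
move=> Lf Lg; rewrite -(@ler_pXn2r _ 2)// ?nnegrE ?addr_ge0 ?L2n_ge0//.
rewrite sqrrD !L2n_sq dot_sqD// lerD2r lerD2l mulr_natl ler_pMn2r//.
by rewrite (le_trans (ler_norm _))// dot_CS.
Qed.

Lemma L2nZ a f : L2 f -> L2n (fun x => a * f x) = `|a| * L2n f.
Proof.
move=> Lf; rewrite /L2n dotZl ?dotZr//; last exact: L2Z.
by rewrite mulrA -expr2 sqrtrM ?sqr_ge0// sqrtr_sqr.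
Qed.

Lemma dot_ae f g h : measurable_fun I f -> measurable_fun I g -> measurable_fun I h ->
  {ae leb, forall x, I x -> f x = g x} -> dot f h = dot g h.
Proof.
move=> mf mg mh fg; congr fine; apply: ae_eq_integral => //.
- by apply/measurable_EFinP; exact: measurable_weight3.
- by apply/measurable_EFinP; exact: measurable_weight3.
- by apply: ae_imp fg => x /[apply] ->.
Qed.

Lemma L2n_ae f g : measurable_fun I f -> measurable_fun I g ->
  {ae leb, forall x, I x -> f x = g x} -> L2n f = L2n g.
Proof.
by move=> mf mg fg; rewrite /L2n (dot_ae _ _ _ fg)// dotC (dot_ae _ _ _ fg).
Qed.

Lemma dot0_ae f : L2 f -> dot f f = 0 -> {ae leb, forall x, I x -> f x = 0}.
Proof.
move=> Lf f0; have mf := Lf.1.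
have : (\int[leb]_(x in I) `|(f x ^+ 2 * q x)%:E| = 0%:E)%E.
  rewrite -f0 -L2norm_sqE//; apply: eq_integral => x /set_mem Ix /=.
  by rewrite ger0_norm// mulr_ge0 ?sqr_ge0// ltW ?q0.
have mfe : measurable_fun (I : set (measurableTypeR R)) (fun x => (f x ^+ 2 * q x)%:E).
  by apply/measurable_EFinP; apply: measurable_funM => //; exact: measurable_funX.
move=> /(proj1 (ae_eq_integral_abs _ mI' mfe)) H0; apply: ae_imp H0 => x H Ix.
have /= := H Ix; move=> [] /eqP.
by rewrite mulf_eq0 sqrf_eq0 (gt_eqF (q0 Ix)) orbF => /eqP.
Qed.

Lemma bounded_L2 M f : integrable q -> measurable_fun I f ->
  (forall x, I x -> `|f x| <= M) -> L2 f.
Proof.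
move=> iq mf fM.
apply: (@L2_integrable_le _ (fun x => M ^+ 2 * q x)) => //.
- exact: integrable_scale.
- move=> x Ix; rewrite ler_pM2r ?q0// -expr2 -(real_normK (num_real (f x))).
  by rewrite ler_sqr ?nnegrE ?fM// (le_trans _ (fM x Ix)).
Qed.

Lemma cvg_dot (F : nat -> R -> R) f g : (forall n, L2 (F n)) -> L2 f -> L2 g ->
  L2n (fun x => f x - F n x) @[n --> \oo] --> 0 ->
  dot (F n) g @[n --> \oo] --> dot f g.
Proof.
move=> LF Lf Lg Ff; apply/cvgrPdist_le => e e0.
(* The [+ 1] keeps the divisor positive when [g] has norm 0. *)
have e1 : 0 < e / (L2n g + 1) by rewrite divr_gt0// ltr_wpDl ?L2n_ge0.
move/cvgrPdist_le : Ff => /(_ _ e1); apply: filterS => n.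
rewrite sub0r normrN ger0_norm ?L2n_ge0// => H.
rewrite -dotBl//; apply: (le_trans (dot_CS (L2B Lf (LF n)) Lg)).
apply: (@le_trans _ _ (e / (L2n g + 1) * (L2n g + 1))).
  by rewrite ler_pM ?L2n_ge0// lerDl.
by rewrite divfK// gt_eqF// ltr_wpDl ?L2n_ge0.
Qed.

End weighted_L2.

(** * Real-valued integrals: dominated convergence and finite sums *)

Section Rintegral_tools.
Context {d : measure_display} {T : measurableType d} {R : realType}.
Variables (mu : {measure set T -> \bar R}) (D : set T).
Hypothesis mD : measurable D.

(** [Rintegral] is the [fine] part of an extended integral; the dominating function makes the limit
    finite, so that the extended limit passes to the reals. *)
Lemma dominated_Rintegral (f_ : nat -> T -> R) (f g : T -> R) :
  (forall n, measurable_fun D (f_ n)) ->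
  (forall x, D x -> f_^~ x @ \oo --> f x) ->
  mu.-integrable D (EFin \o g) ->
  (forall n x, D x -> `|f_ n x| <= g x) ->
  mu.-integrable D (EFin \o f) /\
  \int[mu]_(x in D) f_ n x @[n --> \oo] --> \int[mu]_(x in D) f x.
Proof.
move=> mf ff ig fg.
have mlim : measurable_fun D f by exact: (measurable_fun_cvg (D := D) (h := f_)).
have [] := @dominated_convergence _ _ _ mu D mD (fun n => EFin \o f_ n)
  (EFin \o f) (EFin \o g).
- by move=> n; exact/measurable_EFinP.
- exact/measurable_EFinP.
- by apply: aeW => x Dx; apply: cvg_EFin; [exact: nearW|exact: ff].
- by [].
- by apply: aeW => x n Dx; rewrite lee_fin; exact: fg.
move=> If _ H; split=> //.
have F : (\int[mu]_(x in D) (f x)%:E)%E = (\int[mu]_(x in D) f x)%:E.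
  by rewrite fineK//; exact: integrable_fin_num.
by move: H; rewrite [X in _ --> X]F => /fine_cvgP[].
Qed.

Lemma integrable_sumr n (F : 'I_n -> T -> R) :
  (forall i, mu.-integrable D (EFin \o F i)) ->
  mu.-integrable D (EFin \o (fun x => \sum_(i < n) F i x)).
Proof.
move=> iF.
have := @integrable_sum _ _ _ mu D mD _ (index_enum 'I_n) xpredT (fun i => EFin \o F i) (fun i _ => iF i).
by apply: eq_integrable => // x _; rewrite /= sumEFin.
Qed.

Lemma Rintegral_sumr n (F : 'I_n -> T -> R) :
  (forall i, mu.-integrable D (EFin \o F i)) ->
  \int[mu]_(x in D) (\sum_(i < n) F i x) = \sum_(i < n) \int[mu]_(x in D) F i x.
Proof.
elim: n F => [|n ih] F iF.
  under eq_Rintegral do rewrite big_ord0.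
  by rewrite big_ord0 Rintegral_cst// mul0r.
under eq_Rintegral do rewrite big_ord_recr/=.
rewrite big_ord_recr/= -ih// -RintegralD//.
exact: integrable_sumr.
Qed.

End Rintegral_tools.

Lemma bounded_integrable_prob {d : measure_display} {O : measurableType d}
    {R : realType} (P : probability O R) (f : O -> R) (M : R) :
  measurable_fun setT f -> (forall w, `|f w| <= M) ->
  P.-integrable setT (EFin \o f).
Proof.
move=> mf fM.
have iM : P.-integrable setT (EFin \o cst M) by exact: finite_measure_integrable_cst.
apply: le_integrable iM => //; first exact/measurable_EFinP.
by move=> w _; rewrite lee_fin/= (le_trans (fM w))// ler_norm.
Qed.

(** * Extension from sets to nonnegative functions; independence *)

Section nonneg_induction.
Import HBSimple HBNNSimple.
Context {d : measure_display} {T : measurableType d} {R : realType}.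
Local Open Scope ereal_scope.

(** The standard machine: a nonnegative measurable function is an increasing limit of simple ones.
    It lifts to functions the three identities given on sets only: independence, invariance of [q],
    and the Markov property. *)
Lemma nonneg_measurable_ind (P : (T -> \bar R) -> Prop) :
  (forall A, measurable A -> P (fun x => (\1_A x)%:E)) ->
  (forall f g, measurable_fun setT f -> measurable_fun setT g ->
    (forall x, 0 <= f x) -> (forall x, 0 <= g x) -> P f -> P g -> P (f \+ g)) ->
  (forall (c : R) f, (0 <= c)%R -> measurable_fun setT f ->
    (forall x, 0 <= f x) -> P f -> P (fun x => c%:E * f x)) ->
  (forall f : (T -> \bar R)^nat, (forall n, measurable_fun setT (f n)) ->
    (forall n x, 0 <= f n x) -> (forall x, nondecreasing_seq (f^~ x)) ->
    (forall n, P (f n)) -> P (fun x => limn (f^~ x))) ->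
  forall f, measurable_fun setT f -> (forall x, 0 <= f x) -> P f.
Proof.
move=> P1 PD PZ Plim f mf f0.
pose g n := nnsfun_approx measurableT mf n.
have -> : f = (fun x => limn (fun n => (g n x)%:E)).
  apply/funext => x; apply/esym/cvg_lim => //.
  exact: (@cvg_nnsfun_approx _ _ _ _ measurableT f mf).
apply: (Plim (fun n => EFin \o g n)).
- by move=> n; exact/measurable_EFinP.
- by move=> n x; rewrite lee_fin.
- by move=> x m n mn; rewrite lee_fin; exact/lefP/nd_nnsfun_approx.
move=> n; move: (g n) => h.
have -> : EFin \o h = (fun x => \sum_(i < #|` fset_set (h @` setT)|)
    ((fset_set (h @` setT))`_i%R)%:E *
    (\1_(h @^-1` [set (fset_set (h @` setT))`_i%R]) x)%:E).
  by apply/funext => x /=; rewrite fimfunEord sumEFin.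
set s := fset_set _; set N := #|` _|.
have s0 i : (i < N)%N -> (0 <= s`_i)%R.
  move=> iN; have : s`_i%R \in s by apply: mem_nth.
  by rewrite in_fset_set// => /set_mem[x _ <-].
(* Measurability and nonnegativity of the partial sums are carried along because [PD] asks for
   them. *)
suff : forall k, (k <= N)%N -> [/\ measurable_fun setT
    (fun x => \sum_(i < k) (s`_i%R)%:E * (\1_(h @^-1` [set s`_i%R]) x)%:E),
    (forall x, 0 <= \sum_(i < k) (s`_i%R)%:E * (\1_(h @^-1` [set s`_i%R]) x)%:E) &
    P (fun x => \sum_(i < k) (s`_i%R)%:E * (\1_(h @^-1` [set s`_i%R]) x)%:E)].
  by move=> /(_ N (leqnn N))[].
have m1 i : measurable_fun setT (fun x => (\1_(h @^-1` [set s`_i%R]) x)%:E : \bar R).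
  exact/measurable_EFinP/measurable_indic.
elim=> [_|k ih kN].
  have E : (fun x => \sum_(i < 0) (s`_i%R)%:E * (\1_(h @^-1` [set s`_i%R]) x)%:E) =
    (fun x : T => (\1_(set0 : set T) x)%:E).
    by apply/funext => x; rewrite big_ord0 indic0.
  rewrite E; split; [exact/measurable_EFinP/measurable_indic| |exact: P1].
  by move=> x; rewrite big_ord0.
have [mk k0 Pk] := ih (ltnW kN).
have -> : (fun x => \sum_(i < k.+1) (s`_i%R)%:E * (\1_(h @^-1` [set s`_i%R]) x)%:E) =
  (fun x => \sum_(i < k) (s`_i%R)%:E * (\1_(h @^-1` [set s`_i%R]) x)%:E) \+
  (fun x => (s`_k%R)%:E * (\1_(h @^-1` [set s`_k%R]) x)%:E).
  by apply/funext => x /=; rewrite big_ord_recr.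
have mz : measurable_fun setT (fun x => (s`_k%R)%:E * (\1_(h @^-1` [set s`_k%R]) x)%:E).
  exact: measurable_funeM.
have z0 x : 0 <= (s`_k%R)%:E * (\1_(h @^-1` [set s`_k%R]) x)%:E.
  by rewrite mule_ge0 ?lee_fin ?s0.
split; [exact: emeasurable_funD|by move=> x; rewrite big_ord_recr; exact: (adde_ge0 (k0 x) (z0 x))|].
apply: PD => //; apply: PZ => //; first exact: s0.
exact: P1.
Qed.

End nonneg_induction.

Section independence.
Context {d : measure_display} {O : measurableType d} {R : realType}.
Variables (P : probability O R).
Local Open Scope ereal_scope.

Lemma integral_indic_comp (Z : O -> R) A : measurable_fun setT Z -> measurable A ->
  \int[P]_w (\1_A (Z w))%:E = P (Z @^-1` A).
Proof.
move=> mZ mA; have mZA : measurable (Z @^-1` A) by rewrite -[Z @^-1` A]setTI; exact: mZ.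
by rewrite -[Z @^-1` A]setIT -integral_indic// setIT.
Qed.

(** Treats one variable at a time. Independence uses it twice: with [Z] the first variable and
    [k = g(T)], and, to check the hypothesis on a set [A], with [Z = T] and [k] the indicator of [X]
    in [A]. *)
Lemma factor_expectation (Z : O -> R) (k : O -> R) (c : R) :
  measurable_fun setT Z -> measurable_fun setT k ->
  (forall w, 0 <= k w)%R -> (0 <= c)%R ->
  (forall A, measurable A -> \int[P]_w ((k w)%:E * (\1_A (Z w))%:E) = c%:E * P (Z @^-1` A)) ->
  forall f : R -> \bar R, measurable_fun setT f -> (forall x, 0 <= f x) ->
  \int[P]_w ((k w)%:E * f (Z w)) = c%:E * \int[P]_w f (Z w).
Proof.
move=> mZ mk k0 c0 H.
have mc (f : R -> \bar R) : measurable_fun setT f -> measurable_fun setT (fun w => f (Z w)).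
  by move=> mf; exact: measurableT_comp.
have mkc (f : R -> \bar R) : measurable_fun setT f ->
    measurable_fun setT (fun w => (k w)%:E * f (Z w)).
  by move=> mf; apply: emeasurable_funM; [exact/measurable_EFinP|exact: mc].
have ke0 w : 0 <= (k w)%:E by rewrite lee_fin.
apply: nonneg_measurable_ind.
- by move=> A mA; rewrite H// integral_indic_comp.
- move=> f h mf mh f0 h0 Hf Hh.
  rewrite ge0_integralD//; [|exact: mc|exact: mc].
  rewrite ge0_muleDr ?integral_ge0// -Hf -Hh -ge0_integralD//.
  + by apply: eq_integral => w _; rewrite ge0_muleDr.
  + by move=> w _; rewrite mule_ge0.
  + exact: mkc.
  + by move=> w _; rewrite mule_ge0.
  + exact: mkc.
- move=> a f a0 mf f0 Hf.
  rewrite ge0_integralZl_EFin//; last exact: mc.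
  rewrite muleCA -Hf -ge0_integralZl_EFin//.
  + by apply: eq_integral => w _; rewrite muleCA.
  + by move=> w _; rewrite mule_ge0.
  + exact: mkc.
- move=> f mf f0 ndf Hf.
  have cvf x : cvgn (f^~ x) by exact: ereal_nondecreasing_is_cvgn.
  have E1 w : (k w)%:E * limn (f^~ (Z w)) = limn (fun n => (k w)%:E * f n (Z w)).
    by apply/esym/cvg_lim => //; apply: cvgeZl.
  under eq_integral do rewrite E1.
  rewrite monotone_convergence//.
  + under eq_fun do rewrite Hf.
    rewrite monotone_convergence//.
    * apply/cvg_lim => //; apply: cvgeZl => //; apply: ereal_nondecreasing_is_cvgn => m n mn.
      by apply: ge0_le_integral => //; [exact: mc|exact: mc|move=> w _; exact: ndf].
    * by move=> n; exact: mc.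
  + by move=> n; exact: mkc.
  + by move=> n w _; rewrite mule_ge0.
  + by move=> w _ m n mn; rewrite lee_wpmul2l//; exact: ndf.
Qed.

Variables (X T : O -> R).
Hypotheses (mX : measurable_fun setT X) (mT : measurable_fun setT T).
Hypothesis XT : forall A B, measurable A -> measurable B ->
  P (X @^-1` A `&` T @^-1` B) = P (X @^-1` A) * P (T @^-1` B).

Lemma independent_ge0_expectation (f : R -> \bar R) (g : R -> R) (c : R) :
  measurable_fun setT f -> measurable_fun setT g ->
  (forall x, 0 <= f x) -> (forall x, 0 <= g x)%R ->
  \int[P]_w (g (T w))%:E = c%:E ->
  \int[P]_w ((g (T w))%:E * f (X w)) = c%:E * (\int[P]_w f (X w)).
Proof.
move=> mf mg f0 g0 gc.
have mXA A : measurable A -> measurable (X @^-1` A).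
  by move=> mA; rewrite -[X @^-1` A]setTI; exact: mX.
have mTA A : measurable A -> measurable (T @^-1` A).
  by move=> mA; rewrite -[T @^-1` A]setTI; exact: mT.
have c0 : (0 <= c)%R by rewrite -lee_fin -gc integral_ge0// => w _; rewrite lee_fin.
apply: factor_expectation => //; first exact: measurableT_comp.
move=> A mA.
transitivity (\int[P]_w ((\1_A (X w))%:E * (EFin \o g) (T w))).
  by apply: eq_integral => w _; rewrite muleC.
have PXA : P (X @^-1` A) = (fine (P (X @^-1` A)))%:E.
  by rewrite fineK// fin_num_measure//; exact: mXA.
rewrite (@factor_expectation T (\1_A \o X) (fine (P (X @^-1` A)))) //.
- by rewrite gc muleC -PXA.
- by apply: measurableT_comp => //; exact: measurable_indic.
- by rewrite fine_ge0.
- move=> B mB; rewrite -PXA -XT//.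
  have mXTB : measurable (X @^-1` A `&` T @^-1` B) by apply: measurableI; [exact: mXA|exact: mTA].
  rewrite -[in RHS](setIT (_ `&` _)) -integral_indic//.
  by apply: eq_integral => w _; rewrite /= !indicE in_setI -EFinM -natrM mulnb.
- exact/measurable_EFinP.
Qed.

End independence.

(** * Orthonormal eigenbases and contraction semigroups *)

Lemma cvg_sum_single {R : realType} (u : nat -> R) n :
  (forall k, k != n -> u k = 0) -> (\sum_(k < N) u k) @[N --> \oo] --> u n.
Proof.
move=> u0; apply: cvg_near_cst; exists n.+1 => // N /= nN.
rewrite (bigD1 (Ordinal nN))//= big1 ?addr0// => i ni.
by apply: u0; apply: contra_neq ni => ni; exact/val_inj.
Qed.

Lemma strictly_decr_inj {R : realType} (a : nat -> R) :
  (forall n, a n.+1 < a n) -> forall m n, (m < n)%N -> a n < a m.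
Proof.
move=> ad m n; elim: n => // n ih; rewrite ltnS leq_eqVlt => /predU1P[->//|/ih].
exact/lt_trans.
Qed.

(** Strong induction. If the sequences agree below [n] and [c n = e m] with [m < n], then
    [c n = c m], against strict decrease; so [m >= n] and [c n <= e n]. The roles are then
    exchanged. *)
Lemma strictly_decr_same_range {R : realType} (a b : nat -> R) :
  (forall n, a n.+1 < a n) -> (forall n, b n.+1 < b n) ->
  (forall n, exists m, a n = b m) -> (forall n, exists m, b n = a m) ->
  forall n, a n = b n.
Proof.
move=> /strictly_decr_inj ad /strictly_decr_inj bd ab ba; elim/ltn_ind => n ih.
have aux (c e : nat -> R) : (forall m n, (m < n)%N -> c n < c m) ->
    (forall m n, (m < n)%N -> e n < e m) -> (forall n, exists m, c n = e m) ->
    (forall m, (m < n)%N -> c m = e m) -> c n <= e n.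
  move=> cd ed ce ih'; have [m cm] := ce n; rewrite cm.
  have [mn|nm|->//] := ltngtP m n; last exact/ltW/ed.
  by move: (cd _ _ mn); rewrite cm (ih' _ mn) ltxx.
by apply/le_anti/andP; split; apply: aux => // m mn; rewrite ih.
Qed.

Section eigenbasis.
Context {R : realType} (I : set R) (q : R -> R).
Hypotheses (mI : measurable I) (mq : measurable_fun I q).
Hypothesis q0 : forall x, I x -> 0 < q x.
Local Notation leb := (@lebesgue_measure R).
Local Notation dot := (L2dot I q).
Local Notation L2 := (L2 I q).
Local Notation L2n := (L2n I q).
Implicit Types f g h : R -> R.

(** The part of [eigensystem] that mentions no operator, so that a basis attached to one process can
    be used in the L^2 space of the other. *)
Record orthobasis (phi : nat -> R -> R) : Prop := {
  ob_L2 : forall n, L2 (phi n);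
  ob_orthonormal : forall m n, dot (phi m) (phi n) = (m == n)%:R;
  ob_basis : forall f, L2 f ->
    (fun N : nat => L2norm_sq I q
       (fun x => f x - \sum_(n < N) dot f (phi n) * phi n x))
      @ \oo --> 0%E }.

Section one_basis.
Variables (phi : nat -> R -> R) (B : orthobasis phi).
Let Lphi := ob_L2 B.

Definition eproj N f x := \sum_(n < N) dot f (phi n) * phi n x.

Lemma L2_eproj N f : L2 (eproj N f).
Proof. by apply: (@L2_sum _ _ _ mI mq q0) => i; exact: L2Z. Qed.

Lemma cvg_eproj f : L2 f -> L2n (fun x => f x - eproj N f x) @[N --> \oo] --> 0.
Proof.
move=> Lf; have := ob_basis B Lf.
have E N : L2norm_sq I q (fun x => f x - \sum_(n < N) dot f (phi n) * phi n x) =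
    (L2n (fun x => f x - eproj N f x) ^+ 2)%:E.
  by rewrite L2n_sq// -L2norm_sqE//; apply: L2B => //; exact: L2_eproj.
under eq_fun do rewrite E.
move/fine_cvgP => [_ /cvgrPdist_lt H].
apply/cvgrPdist_lt => e e0; have /H := exprn_gt0 2 e0.
apply: filterS => N /=; rewrite !sub0r !normrN normrX ltr_pXn2r// ?nnegrE//.
exact: ltW.
Qed.

Lemma dot_eproj N f g : L2 f -> L2 g ->
  dot (eproj N f) g = \sum_(n < N) dot f (phi n) * dot g (phi n).
Proof.
move=> Lf Lg; rewrite dot_suml//; last by move=> i; exact: L2Z.
by apply: eq_bigr => i _; rewrite dotZl// (dotC _ _ g).
Qed.

Lemma parseval f g : L2 f -> L2 g ->
  (\sum_(n < N) dot f (phi n) * dot g (phi n)) @[N --> \oo] --> dot f g.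
Proof.
move=> Lf Lg; under eq_fun do rewrite -dot_eproj//.
by apply: cvg_dot => //; [move=> n; exact: L2_eproj|exact: cvg_eproj].
Qed.

Lemma dot_basis0 f : L2 f -> (forall n, dot f (phi n) = 0) -> dot f f = 0.
Proof.
move=> Lf f0; rewrite -(cvg_lim (@Rhausdorff R) (parseval Lf Lf)).
under eq_fun do under eq_bigr do rewrite f0 mul0r.
under eq_fun do rewrite big1//.
exact: lim_cst.
Qed.

(** The difference of the two sides has all its coefficients equal to 0, hence norm 0 by
    Parseval. *)
Lemma dot_single_coef f n : L2 f -> (forall k, k != n -> dot f (phi k) = 0) ->
  {ae leb, forall x, I x -> f x = dot f (phi n) * phi n x}.
Proof.
move=> Lf f0; pose e := dot f (phi n).
have Lg : L2 (fun x => f x - e * phi n x) by apply: L2B => //; exact: L2Z.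
apply: ae_imp (dot0_ae mI mq q0 Lg _) => [x /[apply]/eqP|].
  by rewrite subr_eq0 => /eqP.
apply: dot_basis0 => // k; rewrite dotBl//; last exact: L2Z.
rewrite dotZl// (ob_orthonormal B) eq_sym.
have [->|kn] := eqVneq k n; first by rewrite mulr1 subrr.
by rewrite f0// mulr0 subrr.
Qed.

(* [A] plays the role of a contraction semigroup at a fixed time. *)
Section contraction.
Variables (A : (R -> R) -> R -> R) (a : nat -> R).
Hypothesis AL2 : forall f, L2 f -> L2 (A f).
Hypothesis Acontr : forall f, L2 f -> dot (A f) (A f) <= dot f f.
Hypothesis Alin : forall c f g, L2 f -> L2 g ->
  {ae leb, forall x, I x -> A (fun x => c * f x + g x) x = c * A f x + A g x}.
Hypothesis Aphi : forall n, {ae leb, forall x, I x -> A (phi n) x = a n * phi n x}.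

Lemma contraction_sum N (c : nat -> R) :
  {ae leb, forall x, I x -> A (fun x => \sum_(n < N) c n * phi n x) x =
    \sum_(n < N) c n * (a n * phi n x)}.
Proof.
have LS M : L2 (fun x => \sum_(n < M) c n * phi n x).
  by apply: (@L2_sum _ _ _ mI mq q0) => i; exact: L2Z.
elim: N => [|N ih].
  (* The zero function enters as [- phi_0 + phi_0], linearity being given in the form [c f + g]. *)
  apply: ae_imp (Alin (- 1) (Lphi 0%N) (Lphi 0%N)) => x /[apply].
  rewrite (_ : (fun x => _) = (fun x => \sum_(n < 0) c n * phi n x)).
    by move=> ->; rewrite big_ord0 mulN1r addNr.
  by apply/funext => y; rewrite big_ord0 mulN1r addNr.
have := Alin (c N) (Lphi N) (LS N).
rewrite (_ : (fun x => c N * _ + _) = (fun x => \sum_(n < N.+1) c n * phi n x)).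
  move=> H; apply: ae_imp (ae_and H (ae_and ih (Aphi N))) => x [H1 [H2 H3]] Ix.
  by rewrite H1// H2// H3// big_ord_recr/= addrC.
by apply/funext => y; rewrite big_ord_recr/= addrC.
Qed.

Lemma contraction_B f g : L2 f -> L2 g ->
  {ae leb, forall x, I x -> A (fun x => f x - g x) x = A f x - A g x}.
Proof.
move=> Lf Lg; apply: ae_imp (Alin (- 1) Lg Lf) => x /[apply].
by under eq_fun do rewrite mulN1r addrC; rewrite mulN1r addrC.
Qed.

Lemma contraction_cvg (F : nat -> R -> R) f g :
  (forall n, L2 (F n)) -> L2 f -> L2 g ->
  L2n (fun x => f x - F n x) @[n --> \oo] --> 0 ->
  dot (A (F n)) g @[n --> \oo] --> dot (A f) g.
Proof.
move=> LF Lf Lg Ff; apply: cvg_dot => //; [by move=> n; exact: AL2|exact: AL2|].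
apply: (squeeze_cvgr _ (cvg_cst 0) Ff).
apply: nearW => n; rewrite L2n_ge0/=.
have LB : L2 (fun x => f x - F n x) by exact: L2B.
rewrite -(@L2n_ae _ _ _ mI mq (A (fun x => f x - F n x))).
- by rewrite ler_wsqrtr// Acontr.
- exact: (AL2 LB).1.
- exact: (L2B mI mq q0 (AL2 Lf) (AL2 (LF n))).1.
- exact: contraction_B.
Qed.

(** On finite eigenexpansions [A] is explicit; contractivity carries the formula to the limit of the
    projections. *)
Lemma contraction_spectral f g : L2 f -> L2 g ->
  (\sum_(n < N) a n * (dot f (phi n) * dot g (phi n))) @[N --> \oo] --> dot (A f) g.
Proof.
move=> Lf Lg; have LE := L2_eproj^~ f.
suff E N : \sum_(n < N) a n * (dot f (phi n) * dot g (phi n)) = dot (A (eproj N f)) g.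
  under eq_fun do rewrite E.
  exact: (@contraction_cvg (fun N => eproj N f) f g LE Lf Lg (cvg_eproj Lf)).
have Ls i : L2 (fun x => dot f (phi i) * (a i * phi i x)) by do 2 apply: L2Z => //.
rewrite (@dot_ae _ _ _ mI mq _ (fun x => \sum_(n < N) dot f (phi n) * (a n * phi n x)) g) //.
- rewrite dot_suml//; apply: eq_bigr => i _.
  by rewrite !dotZl// ?(dotC _ _ (phi i) g)//; [ring|exact: L2Z].
- exact: (AL2 (LE N)).1.
- exact: (L2_sum mI mq q0 (fun i : 'I_N => Ls i)).1.
- exact: Lg.1.
- exact: (contraction_sum N (fun n => dot f (phi n))).
Qed.

(** Expansion along the eigenbasis takes the place of self-adjointness of [A]: tested against
    [phi n], the spectral series has one nonzero term. *)
Lemma contraction_coef f n : L2 f -> dot (A f) (phi n) = a n * dot f (phi n).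
Proof.
move=> Lf; have H := contraction_spectral Lf (Lphi n).
rewrite -(cvg_lim (@Rhausdorff R) H).
have -> : a n * dot f (phi n) = a n * (dot f (phi n) * dot (phi n) (phi n)).
  by rewrite (ob_orthonormal B) eqxx mulr1.
apply/cvg_lim; first exact: Rhausdorff.
apply: (cvg_sum_single (u := fun k => a k * (dot f (phi k) * dot (phi n) (phi k)))).
by move=> k kn; rewrite (ob_orthonormal B) eq_sym (negbTE kn) !mulr0.
Qed.

End contraction.
End one_basis.

(** The last hypothesis says that eigenvectors of one operator for different eigenvalues are
    orthogonal. If [a n] were none of the [b m], then [phi n] would be orthogonal to the whole basis
    [psi]; so the ranges coincide, and strict decrease matches the indices. Only one coefficient of
    [phi n] then survives, and Parseval gives it square 1. *)
Lemma orthobasis_match (phi psi : nat -> R -> R) (a b : nat -> R) :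
  orthobasis phi -> orthobasis psi ->
  (forall n, a n.+1 < a n) -> (forall n, b n.+1 < b n) ->
  (forall n m, (a n - b m) * dot (phi n) (psi m) = 0) ->
  forall n, a n = b n /\ exists2 e : R, e ^+ 2 = 1 &
    {ae leb, forall x, I x -> phi n x = e * psi n x}.
Proof.
move=> Bphi Bpsi ad bd ab.
have ex (phi' psi' : nat -> R -> R) (a' b' : nat -> R) : orthobasis phi' ->
    orthobasis psi' -> (forall n m, (a' n - b' m) * dot (phi' n) (psi' m) = 0) ->
    forall n, exists m, a' n = b' m.
  move=> Bphi' Bpsi' ab' n; apply: contrapT => /forallNP H.
  have : dot (phi' n) (phi' n) = 0.
    apply: (dot_basis0 Bpsi' (ob_L2 Bphi' n)) => m.
    have /eqP := ab' n m; rewrite mulf_eq0 => /orP[|/eqP//].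
    by rewrite subr_eq0 => /eqP /H.
  by rewrite (ob_orthonormal Bphi') eqxx => /eqP; rewrite oner_eq0.
have E : forall n, a n = b n.
  apply: strictly_decr_same_range => //; first exact: ex ab.
  apply: (ex psi phi) => // n m; rewrite dotC.
  by have := ab m n; rewrite -opprB mulNr => /eqP; rewrite oppr_eq0 => /eqP.
move=> n; split; first exact: E.
have Z k : k != n -> dot (phi n) (psi k) = 0.
  move=> kn; have /eqP := ab n k; rewrite mulf_eq0 => /orP[|/eqP//].
  rewrite subr_eq0 E => /eqP bnk; move: kn; rewrite neq_ltn => /orP[kn|nk].
  - by have := strictly_decr_inj bd kn; rewrite bnk ltxx.
  - by have := strictly_decr_inj bd nk; rewrite bnk ltxx.
exists (dot (phi n) (psi n)); last first.
  by apply: dot_single_coef => //; exact: (ob_L2 Bphi).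
have H := parseval Bpsi (ob_L2 Bphi n) (ob_L2 Bphi n).
rewrite (ob_orthonormal Bphi) eqxx /= in H.
apply: (cvg_unique (@Rhausdorff R) _ H); rewrite expr2.
apply: (cvg_sum_single (u := fun k => dot (phi n) (psi k) * dot (phi n) (psi k))).
by move=> k kn; rewrite Z// mul0r.
Qed.

End eigenbasis.

(** * From an L^2 eigenvector of the generator to an eigenvector of the semigroup *)

Section semigroup_eigen.
Context {R : realType} (I : set R) (q : R -> R).
Hypotheses (mI : measurable I) (mq : measurable_fun I q).
Hypothesis q0 : forall x, I x -> 0 < q x.
Local Notation leb := (@lebesgue_measure R).
Local Notation dot := (L2dot I q).
Local Notation L2 := (L2 I q).
Local Notation L2n := (L2n I q).
Variable S : R -> (R -> R) -> R -> R.
Hypothesis SL2 : forall (s : R) f, 0 <= s -> L2 f -> L2 (S s f).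
Hypothesis Scontr : forall (s : R) f, 0 <= s -> L2 f -> dot (S s f) (S s f) <= dot f f.
Hypothesis Slin : forall (s c : R) f g, 0 <= s -> L2 f -> L2 g ->
  {ae leb, forall x, I x -> S s (fun x => c * f x + g x) x = c * S s f x + S s g x}.
Hypothesis S0 : forall f, L2 f -> {ae leb, forall x, I x -> S 0 f x = f x}.
Hypothesis SD : forall (s u : R) f, 0 <= s -> 0 <= u -> L2 f ->
  {ae leb, forall x, I x -> S (s + u) f x = S s (S u f) x}.

(** From [exp x * (1 - x) <= 1] and [(1 - x)(1 + x + x^2) = 1 - x^3 >= 1] for [x <= 0]. *)
Lemma expR_quadratic (x : R) : x <= 0 -> `|expR x - 1 - x| <= x ^+ 2.
Proof.
move=> x0; rewrite ger0_norm; last by have := expR_ge1Dx x; lra.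
have := expR_ge1Dx (- x); rewrite expRN => H.
have ex := expR_gt0 x.
have : expR x * (1 - x) <= 1.
  by rewrite mulrC -ler_pdivlMr// div1r.
have : expR x <= 1 by rewrite -(@expR0 R) ler_expR.
nra.
Qed.

(* The defect [D u = |S_u phi - e^(lam u) phi|] is subadditive for [lam <= 0] and
   [o(u)] at 0, hence [D s <= N * D (s / N)] tends to 0. *)
Lemma generator_eigen_semigroup (lam : R) phi : lam <= 0 -> L2 phi ->
  (fun h : R => L2norm_sq I q
     (fun x => (S h phi x - phi x) / h - lam * phi x)) @ 0^'+ --> 0%E ->
  forall s : R, 0 <= s -> {ae leb, forall x, I x -> S s phi x = expR (lam * s) * phi x}.
Proof.
move=> lam0 Lphi gen.
pose D (u : R) := L2n (fun x => S u phi x - expR (lam * u) * phi x).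
have LS (u : R) : 0 <= u -> L2 (S u phi) by move=> ?; exact: SL2.
have LD (u : R) : 0 <= u -> L2 (fun x => S u phi x - expR (lam * u) * phi x).
  by move=> u0; apply: L2B => //; [exact: LS|exact: L2Z].
have Dadd (s u : R) : 0 <= s -> 0 <= u -> D (s + u) <= D s + D u.
  move=> s0 u0.
  have L1 := SL2 s0 (LD _ u0).
  have L2' := L2Z mI mq q0 (expR (lam * u)) (LD _ s0).
  (* The defect at [s + u] is [S_s] applied to the defect at [u], plus [exp(lam u)] times the defect
     at [s]. The first term is bounded by contractivity, the second by [lam <= 0]. *)
  rewrite /D (@L2n_ae _ _ _ mI mq _ (fun x => S s (fun x => S u phi x - expR (lam * u) * phi x) x +
     expR (lam * u) * (S s phi x - expR (lam * s) * phi x))).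
  - apply: (le_trans (L2nD mI mq q0 L1 L2')).
    rewrite addrC lerD//.
      rewrite L2nZ//; last exact: LD.
      by rewrite ger0_norm ?expR_ge0// ler_piMl ?L2n_ge0// -(@expR0 R) ler_expR mulr_le0_ge0.
    by rewrite ler_wsqrtr// Scontr//; exact: LD.
  - by apply: (LD _ _).1; exact: addr_ge0.
  - exact: (L2D mI mq q0 L1 L2').1.
  - have := Slin (- expR (lam * u)) s0 Lphi (LS _ u0).
    apply: ae_imp2 (SD s0 u0 Lphi) => x H1 H2 Ix; rewrite H1//.
    have := H2 Ix; under eq_fun do rewrite mulNr addrC.
    by move=> ->; rewrite mulrDr expRD; ring.
have DN (s : R) N : 0 <= s -> D (s *+ N.+1) <= D s *+ N.+1.
  move=> s0; elim: N => [|N ih]; first by rewrite !mulr1n.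
  rewrite mulrS [X in _ <= X]mulrS (le_trans (Dadd _ _ _ _))// ?mulrn_wge0//.
  by rewrite lerD2l.
have Do (e : R) : 0 < e -> exists2 h0, 0 < h0 & forall h, 0 < h -> h < h0 -> D h <= h * e.
  move=> e0.
  have LG (h : R) : 0 < h -> L2 (fun x => (S h phi x - phi x) / h - lam * phi x).
    move=> h0; apply: L2B => //; last exact: L2Z.
    under eq_fun do rewrite mulrC.
    by apply: L2Z => //; apply: L2B => //; apply: LS; exact: ltW.
  have e2 : 0 < e / 2 by rewrite divr_gt0.
  have /fine_cvgP[_ /cvgrPdist_lt/(_ _ (exprn_gt0 2 e2))] := gen.
  move=> -[h1/= h10 H1].
  (* The second-order remainder of [exp(lam h)] contributes at most [h * (h * C)]; the [+ 1] keeps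
     the divisor in the choice of [h0] positive. *)
  pose C := lam ^+ 2 * L2n phi + 1.
  have C0 : 0 < C by rewrite ltr_wpDl// mulr_ge0 ?sqr_ge0 ?L2n_ge0.
  exists (Num.min h1 (e / 2 / C)); first by rewrite lt_min h10 divr_gt0.
  move=> h h0; rewrite lt_min => /andP[hh1 hC].
  have := H1 h; rewrite /= sub0r normrN gtr0_norm// => /(_ hh1 h0) /=.
  rewrite L2norm_sqE//; last exact: LG.
  rewrite /= -L2n_sq// sub0r normrN normrX ltr_pXn2r// ?nnegrE ?(ltW e2)//.
  rewrite ger0_norm ?L2n_ge0// => Hg.
  have Lr : L2 (fun x => (1 + lam * h - expR (lam * h)) * phi x) by exact: L2Z.
  have Lg := L2Z mI mq q0 h (LG _ h0).
  (* The defect splits into [h] times the error of the difference quotient and the second-order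
     remainder of the exponential; each receives half of [h * e]. *)
  rewrite /D (_ : (fun x => _) = (fun x => h * ((S h phi x - phi x) / h - lam * phi x) +
    (1 + lam * h - expR (lam * h)) * phi x)); last first.
    by apply/funext => x; field; rewrite gt_eqF.
  apply: (le_trans (L2nD mI mq q0 Lg Lr)).
  rewrite L2nZ//; last exact: LG.
  rewrite L2nZ// gtr0_norm// [e]splitr mulrDr lerD//.
    by rewrite ler_pM2l// ltW.
  rewrite (_ : 1 + _ - _ = - (expR (lam * h) - 1 - lam * h)) ?normrN; last by ring.
  apply: (@le_trans _ _ ((lam * h) ^+ 2 * L2n phi)).
    by rewrite ler_wpM2r ?L2n_ge0// expR_quadratic// mulr_le0_ge0// ltW.
  rewrite exprMn (_ : _ * _ * _ = h * (h * (lam ^+ 2 * L2n phi))); last by ring.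
  rewrite ler_pM2l//; apply: (@le_trans _ _ (h * C)).
    by rewrite ler_pM2l// lerDl.
  by rewrite -ler_pdivlMr// ltW.
move=> s; rewrite le_eqVlt => /predU1P[<-|s0].
  by apply: ae_imp (S0 Lphi) => x /[apply] ->; rewrite mulr0 expR0 mul1r.
suff Ds : D s = 0.
  have := LD _ (ltW s0) => /(dot0_ae mI mq q0).
  rewrite -L2n_sq//; rewrite /D in Ds; rewrite Ds expr0n => /(_ erefl).
  by apply: ae_imp => x /[apply]/eqP; rewrite subr_eq0 => /eqP.
apply/eqP; rewrite eq_le L2n_ge0 andbT; apply/ler_addgt0Pl => e e0.
rewrite addr0.
have es : 0 < e / s by rewrite divr_gt0.
have [h0 h00 H] := Do _ es.
(* [N + 1] exceeds [s / h0], so the step [s / (N + 1)] falls below [h0]. *)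
pose N := Num.truncn (s / h0).
have sN : s / h0 < N.+1%:R by rewrite truncnS_gt.
have -> : s = (s / N.+1%:R) *+ N.+1 by rewrite -mulr_natr divfK.
have sN0 : 0 < s / N.+1%:R by rewrite divr_gt0.
apply: (le_trans (DN _ _ (ltW sN0))).
have := H _ sN0; rewrite ltr_pdivrMr// mulrC -ltr_pdivrMr// => /(_ sN) {}H.
rewrite -[X in X <= _]mulr_natr; apply: (@le_trans _ _ ((e / s * (s / N.+1%:R)) * N.+1%:R)).
  by rewrite ler_pM2r// [X in _ <= X]mulrC.
rewrite mulrA divfK; last by rewrite gt_eqF.
by rewrite divfK// gt_eqF.
Qed.

End semigroup_eigen.

(** * Expectation at an independent random time *)

Section bernstein.
Context {R : realType}.
Implicit Types (u : R) (f : nat -> R).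

(** The Bernstein polynomial [binom(N,k) u^k (1-u)^(N-k)], given by Pascal's rule so that sign,
    moments and measurability are inductions on [N]. *)
Fixpoint bern (N k : nat) u : R :=
  if N is N'.+1 then
    (1 - u) * bern N' k u + (if k is k'.+1 then u * bern N' k' u else 0)
  else (k == 0%N)%:R.

Lemma bern_gt N k u : (N < k)%N -> bern N k u = 0.
Proof.
elim: N k => [|N ih] [|k]//=; rewrite ltnS => Nk.
by rewrite !ih ?mulr0 ?addr0// ltnW.
Qed.

Lemma bern_ge0 N k u : 0 <= u <= 1 -> 0 <= bern N k u.
Proof.
move=> /andP[u0 u1]; elim: N k => [|N ih] k /=; first exact: ler0n.
by rewrite addr_ge0 ?mulr_ge0 ?subr_ge0//; case: k => // k; rewrite mulr_ge0.
Qed.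

(** Conditioning a binomial variable on its last trial; every moment below follows from this
    recursion. *)
Lemma bern_sumS N f u : \sum_(k < N.+2) f k * bern N.+1 k u =
  (1 - u) * (\sum_(k < N.+1) f k * bern N k u) +
  u * (\sum_(k < N.+1) f k.+1 * bern N k u).
Proof.
rewrite /= (eq_bigr (fun k : 'I_N.+2 => (1 - u) * (f k * bern N k u) +
   f k * (if nat_of_ord k is k'.+1 then u * bern N k' u else 0))); last first.
  by move=> k _; rewrite mulrDr mulrCA.
rewrite big_split/=; congr (_ + _).
  by rewrite big_ord_recr/= bern_gt// !mulr0 addr0 mulr_sumr.
rewrite big_ord_recl/= mulr0 add0r mulr_sumr.
by apply: eq_bigr => k _; rewrite mulrCA.
Qed.

Lemma bern_sum1 N u : \sum_(k < N.+1) bern N k u = 1.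
Proof.
elim: N => [|N ih]; first by rewrite big_ord_recl big_ord0 addr0.
have E n : \sum_(k < n.+1) 1 * bern n k u = \sum_(k < n.+1) bern n k u.
  by apply: eq_bigr => k _; rewrite mul1r.
by rewrite -E (bern_sumS N (fun=> 1)) E ih; ring.
Qed.

Lemma bern_moment1 N u : \sum_(k < N.+1) k%:R * bern N k u = N%:R * u.
Proof.
elim: N => [|N ih]; first by rewrite big_ord_recl big_ord0 addr0 !mul0r.
rewrite (bern_sumS N (fun k => k%:R)) ih.
under eq_bigr do rewrite -natr1 mulrDl mul1r.
by rewrite big_split/= ih bern_sum1 -natr1; ring.
Qed.

Lemma bern_moment2 N u :
  \sum_(k < N.+1) k%:R ^+ 2 * bern N k u = N%:R * u * (1 - u) + (N%:R * u) ^+ 2.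
Proof.
elim: N => [|N ih].
  by rewrite big_ord_recl big_ord0 addr0 !mul0r expr0n/= mul0r; ring.
rewrite (bern_sumS N (fun k => k%:R ^+ 2)) ih.
rewrite (eq_bigr (fun k : 'I_N.+1 => k%:R ^+ 2 * bern N k u +
   (2 * (k%:R * bern N k u) + bern N k u))); last first.
  by move=> k _; rewrite -natr1; ring.
rewrite !big_split/= ih -mulr_sumr bern_moment1 bern_sum1 -natr1; ring.
Qed.

Lemma bern_variance N u :
  \sum_(k < N.+1) (k%:R - N%:R * u) ^+ 2 * bern N k u = N%:R * u * (1 - u).
Proof.
rewrite (eq_bigr (fun k : 'I_N.+1 => k%:R ^+ 2 * bern N k u +
   ((- (2 * N%:R * u)) * (k%:R * bern N k u) + (N%:R * u) ^+ 2 * bern N k u))); last first.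
  by move=> k _; ring.
by rewrite !big_split/= -!mulr_sumr bern_moment2 bern_moment1 bern_sum1; ring.
Qed.

Lemma bern_poly N k : exists p : {poly R}, forall u, bern N k u = p.[u].
Proof.
elim: N k => [|N ih] k; first by exists ((k == 0%N)%:R)%:P => u; rewrite hornerC.
have [p pE] := ih k; case: k pE => [|k] pE.
  by exists ((1 - 'X) * p) => u; rewrite /= !hornerE pE ?addr0.
have [r rE] := ih k.
by exists ((1 - 'X) * p + 'X * r) => u; rewrite /= !hornerE pE rE.
Qed.

(** Chebyshev's argument: nodes within [d] of [u] are handled by continuity, the others by
    [2 M (k/N - u)^2 / d^2], whose mean is at most [C / N]. Continuity is asked at the single point
    [u] because the function later built from a path may jump at 0. *)
Lemma bernstein_cvg (h : R -> R) (M u : R) : 0 <= u <= 1 ->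
  (forall y : R, 0 <= y <= 1 -> `|h y| <= M) ->
  (forall e : R, 0 < e -> exists2 d : R, 0 < d &
     forall y : R, 0 <= y <= 1 -> `|y - u| < d -> `|h y - h u| < e) ->
  (\sum_(k < N.+1) h (k%:R / N%:R) * bern N k u) @[N --> \oo] --> h u.
Proof.
move=> u01 hM hc; apply/cvgrPdist_le => e e0.
have e2 : 0 < e / 2 by rewrite divr_gt0.
have [d d0 hd] := hc _ e2.
have M0 : 0 <= M by rewrite (le_trans _ (hM u u01)).
pose C := 2 * M / d ^+ 2.
have C0 : 0 <= C by rewrite divr_ge0 ?sqr_ge0 ?mulr_ge0.
pose N0 := Num.truncn (C / (e / 2)).
exists N0.+1 => // N /= N0N.
have Np : 0 < N%:R :> R by rewrite ltr0n (leq_trans _ N0N).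
have NC : C / N%:R <= e / 2.
  rewrite ler_pdivrMr// mulrC -ler_pdivrMr// ltW// (lt_le_trans (truncnS_gt _))//.
  by rewrite ler_nat.
have E : h u = \sum_(k < N.+1) h u * bern N k u by rewrite -mulr_sumr bern_sum1 mulr1.
rewrite [X in `|X - _|]E -sumrB.
under eq_bigr do rewrite -mulrBl.
apply: (le_trans (ler_norm_sum _ _ _)).
have kN01 (k : 'I_N.+1) : 0 <= (k%:R / N%:R : R) <= 1.
  rewrite divr_ge0//= ler_pdivrMr// mul1r ler_nat -ltnS; exact: ltn_ord.
apply: (@le_trans _ _ (\sum_(k < N.+1) (e / 2 * bern N k u +
   C / N%:R ^+ 2 * ((k%:R - N%:R * u) ^+ 2 * bern N k u)))).
  apply: ler_sum => k _; rewrite normrM (ger0_norm (bern_ge0 _ _ u01)).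
  rewrite mulrA -mulrDl ler_wpM2r ?bern_ge0//.
  have [kd|kd] := ltP `|k%:R / N%:R - u| d.
    rewrite distrC (le_trans (ltW (hd _ (kN01 k) kd)))// lerDl.
    by rewrite mulr_ge0 ?sqr_ge0// divr_ge0// exprn_ge0.
  rewrite (@le_trans _ _ (2 * M))//.
    have := hM _ u01; have := hM _ (kN01 k).
    by have := ler_normB (h u) (h (k%:R / N%:R)); lra.
  rewrite ler_wpDl ?(ltW e2)//.
  have -> : C / N%:R ^+ 2 * (k%:R - N%:R * u) ^+ 2 = C * (k%:R / N%:R - u) ^+ 2.
    by field; rewrite gt_eqF.
  rewrite /C mulrAC -mulrA ler_peMr ?mulr_ge0//.
  rewrite ler_pdivlMr ?exprn_gt0// mul1r -[X in _ <= X]real_normK ?num_real//.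
  by rewrite ler_sqr ?nnegrE// ltW.
rewrite big_split/= -!mulr_sumr bern_sum1 bern_variance mulr1.
rewrite [X in _ <= X]splitr lerD2l (le_trans _ NC)//.
have -> : C / N%:R ^+ 2 * (N%:R * u * (1 - u)) = C / N%:R * (u * (1 - u)).
  by field; rewrite gt_eqF.
rewrite ler_piMr// ?divr_ge0// ?(ltW Np)//; nra.
Qed.

Definition log_time (N k : nat) : R := - ln (k%:R / N%:R).

Lemma log_time_ge0 N k : (k <= N)%N -> 0 <= log_time N k.
Proof.
rewrite /log_time => kN; rewrite oppr_ge0.
(* For [N = 0] the quotient is 0 by convention, and so is [ln 0]. *)
case: N kN => [|N] kN; first by rewrite invr0 mulr0 ln0.
by rewrite ln_le0// ler_pdivrMr// mul1r ler_nat.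
Qed.

(** A mixture of values of [z] at the times [- ln (k/N)]. The node [k = 0] is [u = 0], an infinite
    time, and receives the value 0. The weights are the Bernstein polynomials at [exp(-T)], or their
    expectations. *)
Definition bern_mix (z : R -> R) (a : nat -> nat -> R) N : R :=
  \sum_(k < N.+1) (if nat_of_ord k == 0%N then 0 else z (log_time N k)) * a N k.

Lemma bern_mix_norm_le (z : R -> R) (a : nat -> nat -> R) N M :
  (forall s : R, 0 <= s -> `|z s| <= M) -> (forall k, 0 <= a N k) ->
  \sum_(k < N.+1) a N k = 1 -> `|bern_mix z a N| <= M.
Proof.
move=> zM a0 a1; have M0 : 0 <= M by rewrite (le_trans _ (zM 0 _)).
apply: (le_trans (ler_norm_sum _ _ _)).
rewrite -[M]mulr1 -a1 mulr_sumr; apply: ler_sum => k _.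
rewrite normrM (ger0_norm (a0 k)) ler_wpM2r//.
case: eqP => _; first by rewrite normr0.
by rewrite zM// log_time_ge0// -ltnS ltn_ord.
Qed.

(** Bernstein approximation of [y |-> z (- ln y)], extended by 0 at [y = 0], at the point
    [exp(-tau)], which is positive and therefore away from the possible jump. *)
Lemma bernstein_time_cvg (z : R -> R) (M tau : R) : 0 <= tau ->
  (forall s : R, 0 <= s -> `|z s| <= M) -> {within `[0, +oo[, continuous z} ->
  bern_mix z (fun N k => bern N k (expR (- tau))) N @[N --> \oo] --> z tau.
Proof.
move=> tau0 zM zc.
have u01 : 0 <= expR (- tau) <= 1.
  by rewrite expR_ge0/= -(@expR0 R) ler_expR oppr_le0.
have M0 : 0 <= M by rewrite (le_trans _ (zM 0 _)).
pose h (y : R) := if y <= 0 then 0 else z (- ln y).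
have hu : h (expR (- tau)) = z tau by rewrite /h leNgt expR_gt0/= expRK opprK.
rewrite -hu.
suff E N : bern_mix z (fun N k => bern N k (expR (- tau))) N =
    \sum_(k < N.+1) h (k%:R / N%:R) * bern N k (expR (- tau)).
  under eq_fun do rewrite E.
  apply: (bernstein_cvg (M := M)) => //.
  - move=> y /andP[y0 y1]; rewrite /h; case: ifPn; first by rewrite normr0.
    by rewrite -ltNge => yp; rewrite zM// oppr_ge0 ln_le0.
  - move=> e e0; rewrite hu.
    have tauI : `[0, +oo[%classic tau by rewrite /= in_itv/= tau0.
    have /cvgrPdist_lt/(_ _ e0)[d' /= d'0 Hd'] := (subspace_continuousP _ _).1 zc tau tauI.
    have /(@cvgrPdist_lt _ _ _ (nbhs (expR (- tau)))) := continuous_ln (expR_gt0 (- tau)).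
    move=> /(_ _ d'0)[d/= d0 Hd].
    exists (Num.min d (expR (- tau))); first by rewrite lt_min d0 expR_gt0.
    move=> y /andP[y0 y1]; rewrite lt_min => /andP[yd yu].
    have yp : 0 < y by move: yu; rewrite ltr_distl subrr => /andP[].
    rewrite /h leNgt yp/= distrC; apply: Hd'.
      have := Hd y; rewrite /= distrC => /(_ yd).
      by rewrite expRK opprK -opprD normrN.
    by rewrite /= in_itv/= andbT oppr_ge0 ln_le0.
apply: eq_bigr => k _; congr (_ * _); rewrite /h /log_time.
have [k0|k0] := eqVneq (nat_of_ord k) 0%N; first by rewrite k0 mul0r lexx.
rewrite leNgt divr_gt0 ?ltr0n ?lt0n//=.
by apply: contra k0 => /eqP N0; move: (ltn_ord k); rewrite {2}N0 ltnS leqn0.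
Qed.

End bernstein.

Section expectation_at_random_time.
Context {d : measure_display} {O : measurableType d} {R : realType}.
Variables (P : probability O R) (Z : R -> O -> R) (T : O -> R) (M : R).
Hypotheses (mT : measurable_fun setT T) (T0 : forall w, 0 <= T w).
Hypothesis mZ : forall s : R, 0 <= s -> measurable_fun setT (Z s).
Hypothesis ZM : forall (s : R) w, 0 <= s -> `|Z s w| <= M.
Hypothesis cZ : forall w, {within `[0, +oo[, continuous (Z^~ w)}.

Lemma measurable_bern_time N k : measurable_fun setT (fun w => bern N k (expR (- T w))).
Proof.
have mu : measurable_fun setT (fun w => expR (- T w)).
  by apply: measurableT_comp => //; exact: measurableT_comp.
elim: N k => [|N ih] k /=; first exact: measurable_cst.
apply: measurable_funD; first by apply: measurable_funM => //; exact: measurable_funB.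
by case: k => [|k]; [exact: measurable_cst|exact: measurable_funM].
Qed.

Lemma bern_time_bound N k w : 0 <= bern N k (expR (- T w)) <= 1.
Proof.
have u01 : 0 <= expR (- T w) <= 1.
  by rewrite expR_ge0/= -(@expR0 R) ler_expR oppr_le0.
rewrite bern_ge0//=; have [kN|Nk] := leqP k N; last by rewrite bern_gt.
rewrite -(bern_sum1 N (expR (- T w))) (bigD1 (Ordinal (kN : (k < N.+1)%N)))//=.
by rewrite lerDl sumr_ge0// => i _; rewrite bern_ge0.
Qed.

Let mix N w := bern_mix (Z^~ w) (fun N k => bern N k (expR (- T w))) N.

Let mmix N : measurable_fun setT (mix N).
Proof.
apply: measurable_sum => k; apply: measurable_funM; last exact: measurable_bern_time.
by case: eqP => _; [exact: measurable_cst|apply/mZ/log_time_ge0; rewrite -ltnS].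
Qed.

(** A pointwise limit of finite mixtures of fixed-time values; this stands in for joint
    measurability in time and outcome. *)
Lemma measurable_at_random_time : measurable_fun setT (fun w => Z (T w) w).
Proof.
apply: (measurable_fun_cvg (D := setT) (h := mix)) => // w _.
by apply: (bernstein_time_cvg (M := M)) => // s; exact: ZM.
Qed.

Hypothesis ZT : forall (s : R) N k, 0 <= s ->
  \int[P]_w (Z s w * bern N k (expR (- T w))) =
  \int[P]_w Z s w * \int[P]_w bern N k (expR (- T w)).

(** Dominated convergence by the constant [M]. Independence enters through [ZT] alone, at one fixed
    time per term. *)
Lemma expectation_at_random_time :
  bern_mix (fun s => \int[P]_w Z s w) (fun N k => \int[P]_w bern N k (expR (- T w))) N
    @[N --> \oo] --> \int[P]_w Z (T w) w.
Proof.
have u01 w : 0 <= expR (- T w) <= 1.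
  by rewrite expR_ge0/= -(@expR0 R) ler_expR oppr_le0.
have iM : P.-integrable setT (EFin \o cst M) by exact: finite_measure_integrable_cst.
have [] := @dominated_Rintegral _ _ _ P setT measurableT mix (fun w => Z (T w) w) (cst M).
- exact: mmix.
- by move=> w _; apply: (bernstein_time_cvg (M := M)) => // s; exact: ZM.
- exact: iM.
- move=> N w _; apply: bern_mix_norm_le => //.
  + by move=> s; exact: ZM.
  + by move=> k; rewrite bern_ge0.
  + by rewrite bern_sum1.
suff -> : bern_mix (fun s => \int[P]_w Z s w)
  (fun N k => \int[P]_w bern N k (expR (- T w))) = (fun N => \int[P]_w mix N w) by move=> _.
apply/funext => N.
rewrite /mix /bern_mix Rintegral_sumr//.
  apply: eq_bigr => k _; case: eqP => _.
    by rewrite mul0r; under eq_Rintegral do rewrite mul0r; rewrite Rintegral_cst// mul0r.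
  by rewrite ZT// log_time_ge0// -ltnS.
move=> k; apply: (@bounded_integrable_prob _ _ _ _ _ M).
  apply: measurable_funM; last exact: measurable_bern_time.
  by case: eqP => _; [exact: measurable_cst|apply/mZ/log_time_ge0; rewrite -ltnS].
move=> w; have /andP[b0 b1] := bern_time_bound N k w.
rewrite normrM (ger0_norm b0).
have zM : `|if nat_of_ord k == 0%N then 0 else Z (log_time N k) w| <= M.
  case: eqP => _; last by apply/ZM/log_time_ge0; rewrite -ltnS.
  by rewrite normr0 (le_trans _ (ZM w (lexx 0))).
by rewrite (le_trans _ zM)// ler_piMr.
Qed.

End expectation_at_random_time.

(** * Markov semigroups and stationary densities *)

Section markov_semigroup.
Context {R : realType} {d : measure_display} {O : measurableType d}.
Variables (I : set R) (q : R -> R) (Px : R -> probability O R) (X : R -> O -> R).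
Hypotheses (mI : measurable I) (mq : measurable_fun I q).
Hypothesis q0 : forall x, I x -> 0 < q x.
Hypothesis MP : markov_process I Px X.
Local Notation leb := (@lebesgue_measure R).
Hypothesis inv : forall (t : R) (A : set R), 0 <= t -> measurable A -> A `<=` I ->
  (\int[leb]_(x in I) (Px x (X t @^-1` A) * (q x)%:E) =
   \int[leb]_(x in A) (q x)%:E)%E.
Let mI' : measurable (I : set (measurableTypeR R)) := mI.

Local Open Scope ereal_scope.

Let mqE : measurable_fun (I : set (measurableTypeR R)) (fun x => (q x)%:E).
Proof. exact/measurable_EFinP. Qed.

Let qE0 x : I x -> 0 <= (q x)%:E.
Proof. by move=> /q0 qx; rewrite lee_fin ltW. Qed.

(** The expectation in the extended reals, for nonnegative [f]: additivity, monotone limits and the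
    Markov property then hold at every starting point. The real-valued [semigroup] is recovered from
    positive and negative parts in [semigroupE]. *)
Definition markov_mean t (f : R -> \bar R) x := \int[Px x]_w f (X t w).

Lemma measurable_markov_comp t (f : R -> \bar R) : (0 <= t)%R ->
  measurable_fun setT f -> measurable_fun setT (fun w => f (X t w)).
Proof. by move=> t0 mf; apply: measurableT_comp => //; exact: (markov_meas MP). Qed.

Lemma markov_preimageI t A : (0 <= t)%R -> X t @^-1` (A `&` I) = X t @^-1` A.
Proof.
move=> t0; apply/seteqP; split => [w []//|w Aw]; split=> //.
exact: (markov_state MP).
Qed.

Lemma markov_mean_ge0 t f x : (forall y, 0 <= f y) -> 0 <= markov_mean t f x.
Proof. by move=> f0; apply: integral_ge0. Qed.

Lemma markov_meanD t f g x : (0 <= t)%R ->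
  measurable_fun setT f -> measurable_fun setT g ->
  (forall y, 0 <= f y) -> (forall y, 0 <= g y) ->
  markov_mean t (f \+ g) x = markov_mean t f x + markov_mean t g x.
Proof.
by move=> t0 mf mg f0 g0; apply: ge0_integralD => //; exact: measurable_markov_comp.
Qed.

Lemma markov_meanZ t (c : R) f x : (0 <= t)%R -> (0 <= c)%R ->
  measurable_fun setT f -> (forall y, 0 <= f y) ->
  markov_mean t (fun y => c%:E * f y) x = c%:E * markov_mean t f x.
Proof.
by move=> t0 c0 mf f0; apply: ge0_integralZl_EFin => //; exact: measurable_markov_comp.
Qed.

Lemma nd_markov_mean t (f : nat -> R -> \bar R) x : (0 <= t)%R ->
  (forall n, measurable_fun setT (f n)) -> (forall n y, 0 <= f n y) ->
  (forall y, nondecreasing_seq (f^~ y)) ->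
  nondecreasing_seq (fun n => markov_mean t (f n) x).
Proof.
move=> t0 mf f0 ndf m n mn; apply: ge0_le_integral => //.
- exact: measurable_markov_comp.
- exact: measurable_markov_comp.
- by move=> w _; exact: ndf.
Qed.

Lemma markov_mean_lim t (f : nat -> R -> \bar R) x : (0 <= t)%R ->
  (forall n, measurable_fun setT (f n)) -> (forall n y, 0 <= f n y) ->
  (forall y, nondecreasing_seq (f^~ y)) ->
  markov_mean t (fun y => limn (f^~ y)) x = limn (fun n => markov_mean t (f n) x).
Proof.
move=> t0 mf f0 ndf; rewrite /markov_mean monotone_convergence//.
by move=> n; exact: measurable_markov_comp.
Qed.

Lemma measurable_markov_mean t f : (0 <= t)%R ->
  measurable_fun setT f -> (forall y, 0 <= f y) ->
  measurable_fun I (markov_mean t f).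
Proof.
move=> t0; move: f.
apply: (@nonneg_measurable_ind _ _ _ (fun f => measurable_fun I (markov_mean t f))).
- move=> A mA; apply: eq_measurable_fun (markov_kernel MP t0 mA) => x _.
  by rewrite /markov_mean integral_indic_comp//; exact: (markov_meas MP).
- move=> f g mf mg f0 g0 Hf Hg.
  apply: eq_measurable_fun (emeasurable_funD Hf Hg) => x _.
  by rewrite /markov_mean ge0_integralD//; exact: measurable_markov_comp.
- move=> c f c0 mf f0 Hf.
  apply: eq_measurable_fun (measurable_funeM c%:E Hf) => x _.
  by rewrite /markov_mean ge0_integralZl_EFin//; exact: measurable_markov_comp.
- move=> f mf f0 ndf Hf.
  apply: (@emeasurable_fun_cvg _ _ _ I (fun n => markov_mean t (f n))) => // x Ix.
  rewrite markov_mean_lim//; apply: ereal_nondecreasing_is_cvgn.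
  exact: nd_markov_mean.
Qed.

Lemma invariant_markov_mean t f : (0 <= t)%R ->
  measurable_fun setT f -> (forall y, 0 <= f y) ->
  \int[leb]_(x in I) (markov_mean t f x * (q x)%:E) =
  \int[leb]_(x in I) (f x * (q x)%:E).
Proof.
move=> t0; move: f.
have mm f : measurable_fun setT f -> (forall y, 0 <= f y) ->
    measurable_fun (I : set (measurableTypeR R)) (fun x => markov_mean t f x * (q x)%:E).
  move=> mf f0; apply: emeasurable_funM => //.
  exact: (measurable_markov_mean t0 mf f0).
have mfI (f : R -> \bar R) : measurable_fun setT f ->
    measurable_fun (I : set (measurableTypeR R)) (fun x => f x * (q x)%:E).
  by move=> mf; apply: emeasurable_funM => //; exact: measurable_funTS.
apply: nonneg_measurable_ind.
- move=> A mA.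
  (* [inv] speaks of subsets of [I]; intersecting with [I] changes nothing because paths stay in
     [I]. *)
  transitivity (\int[leb]_(x in I) (Px x (X t @^-1` (A `&` I)) * (q x)%:E)).
    apply: eq_integral => x _; rewrite markov_preimageI// /markov_mean.
    by rewrite integral_indic_comp//; exact: (markov_meas MP).
  rewrite inv//; last exact: measurableI.
  rewrite setIC integral_mkcondr; apply: eq_integral => x _.
  rewrite patchE indicE; case: ifPn => xA; first by rewrite mul1e.
  by rewrite mul0e.
- move=> f g mf mg f0 g0 Hf Hg.
  transitivity (\int[leb]_(x in I) (markov_mean t f x * (q x)%:E + markov_mean t g x * (q x)%:E)).
    apply: eq_integral => x _; rewrite -ge0_muleDl ?markov_mean_ge0//.
    by rewrite /markov_mean ge0_integralD//; exact: measurable_markov_comp.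
  rewrite ge0_integralD//; last 4 first.
  + by move=> x Ix; rewrite mule_ge0 ?qE0 ?markov_mean_ge0.
  + exact: mm.
  + by move=> x Ix; rewrite mule_ge0 ?qE0 ?markov_mean_ge0.
  + exact: mm.
  rewrite Hf Hg -ge0_integralD//; last 4 first.
  + by move=> x Ix; rewrite mule_ge0 ?qE0.
  + exact: mfI.
  + by move=> x Ix; rewrite mule_ge0 ?qE0.
  + exact: mfI.
  by apply: eq_integral => x _; rewrite ge0_muleDl.
- move=> c f c0 mf f0 Hf.
  transitivity (\int[leb]_(x in I) (c%:E * (markov_mean t f x * (q x)%:E))).
    apply: eq_integral => x _; rewrite muleA; congr (_ * _).
    by rewrite /markov_mean ge0_integralZl_EFin//; exact: measurable_markov_comp.
  rewrite ge0_integralZl_EFin//; last 2 first.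
  + by move=> x Ix; rewrite mule_ge0 ?qE0 ?markov_mean_ge0.
  + exact: mm.
  rewrite Hf -ge0_integralZl_EFin//; last 2 first.
  + by move=> x Ix; rewrite mule_ge0 ?qE0.
  + exact: mfI.
  by apply: eq_integral => x _; rewrite muleA.
- move=> f mf f0 ndf Hf.
  have limM (g : nat -> \bar R) x : (forall n, 0 <= g n) -> nondecreasing_seq g ->
      limn g * (q x)%:E = limn (fun n => g n * (q x)%:E).
    move=> g0 ndg; apply/esym/cvg_lim => //; apply: cvgeZr => //.
    exact: ereal_nondecreasing_is_cvgn.
  transitivity (\int[leb]_(x in I) limn (fun n => markov_mean t (f n) x * (q x)%:E)).
    apply: eq_integral => x _; rewrite markov_mean_lim// limM//.
      by move=> n; exact: markov_mean_ge0.
    exact: nd_markov_mean.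
  rewrite monotone_convergence//; last 3 first.
  + by move=> n; apply: mm => // y; exact: f0.
  + by move=> n x Ix; rewrite mule_ge0 ?qE0 ?markov_mean_ge0.
  + by move=> x Ix m n mn; rewrite lee_wpmul2r ?qE0//; exact: nd_markov_mean.
  under eq_fun do rewrite Hf.
  rewrite -monotone_convergence//; last 3 first.
  + by move=> n; apply: mfI.
  + by move=> n x Ix; rewrite mule_ge0 ?qE0.
  + by move=> x Ix m n mn; rewrite lee_wpmul2r ?qE0//; exact: ndf.
  by apply: eq_integral => x _; rewrite limM//.
Qed.

Lemma measurable_markov_mean_comp s t f : (0 <= s)%R -> (0 <= t)%R ->
  measurable_fun setT f -> (forall y, 0 <= f y) ->
  measurable_fun setT (fun w => markov_mean t f (X s w)).
Proof.
move=> s0 t0 mf f0; apply: (measurable_comp mI).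
- by move=> _ [w _ <-]; exact: (markov_state MP).
- exact: measurable_markov_mean.
- exact: (markov_meas MP).
Qed.

Lemma chapman_kolmogorov s u f x : I x -> (0 <= s)%R -> (0 <= u)%R ->
  measurable_fun setT f -> (forall y, 0 <= f y) ->
  markov_mean (s + u) f x = markov_mean s (markov_mean u f) x.
Proof.
move=> Ix s0 u0; have su0 : (0 <= s + u)%R by rewrite addr_ge0.
have mM := markov_meas MP.
move: f; apply: nonneg_measurable_ind.
- move=> A mA.
  rewrite /markov_mean integral_indic_comp//; last exact: mM.
  (* The Markov property without a conditioning event: with [n = 0] the cylinder is the whole
     space. *)
  have := @markov_property _ _ _ _ _ _ MP x s u 0 (fun=> 0%R) (fun=> setT) A Ix s0 u0.
  move=> /(_ (fun _ => _)).
  rewrite (_ : cylinder _ _ _ _ = setT); last by apply/seteqP; split.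
  rewrite setTI => -> //; last by rewrite lexx.
  apply: eq_integral => w _; rewrite integral_indic_comp//; exact: mM.
- move=> f g mf mg f0 g0 Hf Hg.
  rewrite (markov_meanD x su0 mf mg f0 g0) Hf Hg.
  transitivity (\int[Px x]_w (markov_mean u f (X s w) + markov_mean u g (X s w))).
    apply/esym/ge0_integralD => //.
    + by move=> w _; exact: markov_mean_ge0.
    + exact: measurable_markov_mean_comp.
    + by move=> w _; exact: markov_mean_ge0.
    + exact: measurable_markov_mean_comp.
  by apply: eq_integral => w _; rewrite markov_meanD.
- move=> c f c0 mf f0 Hf.
  rewrite (markov_meanZ x su0 c0 mf f0) Hf.
  transitivity (\int[Px x]_w (c%:E * markov_mean u f (X s w))).
    apply/esym/ge0_integralZl_EFin => //.
    + by move=> w _; exact: markov_mean_ge0.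
    + exact: measurable_markov_mean_comp.
  by apply: eq_integral => w _; rewrite markov_meanZ.
- move=> f mf f0 ndf Hf.
  rewrite markov_mean_lim//; under eq_fun do rewrite Hf.
  rewrite [RHS]/markov_mean.
  under [RHS]eq_integral do rewrite markov_mean_lim//.
  rewrite monotone_convergence//.
  + by move=> n; exact: measurable_markov_mean_comp.
  + by move=> n w _; exact: markov_mean_ge0.
  + by move=> w _; exact: nd_markov_mean.
Qed.

Local Close Scope ereal_scope.
Local Notation S := (semigroup Px X).
Local Notation dot := (L2dot I q).
Local Notation L2 := (L2 I q).
Implicit Types (f g : R -> R) (t s u c x : R).

Let patchX (f : R -> R) t w : 0 <= t -> (f \_ I) (X t w) = f (X t w).
Proof. by move=> t0; rewrite patchE mem_set//; exact: (markov_state MP). Qed.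

Let mpatch (f : R -> R) : measurable_fun I f -> measurable_fun setT (f \_ I).
Proof. by move=> mf; apply/(measurable_restrictT _ _).1. Qed.

(** [f] is controlled on [I] only; its extension by 0 is measurable on the line and has the same
    values along paths. *)
Lemma semigroup_patch t f : 0 <= t -> S t f = S t (f \_ I).
Proof.
by move=> t0; apply/funext => x; apply: eq_Rintegral => w _; rewrite patchX.
Qed.

Lemma measurable_path_comp t f : 0 <= t -> measurable_fun I f ->
  measurable_fun setT (fun w : O => f (X t w)).
Proof.
move=> t0 mf; rewrite (_ : (fun w => _) = (fun w => (f \_ I) (X t w))).
  by apply: measurableT_comp; [exact: mpatch|exact: (markov_meas MP)].
by apply/funext => w; rewrite patchX.
Qed.

Lemma semigroupE t f x : 0 <= t ->
  S t f x = fine (markov_mean t (EFin \o (f \_ I))^\+%E x -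
                  markov_mean t (EFin \o (f \_ I))^\-%E x).
Proof.
move=> t0; rewrite semigroup_patch// /semigroup /Rintegral integralE /markov_mean.
congr (fine (_ - _)%E); apply: eq_integral => w _.
  by rewrite !funeposE.
by rewrite !funenegE.
Qed.

Lemma measurable_semigroup t f : 0 <= t -> measurable_fun I f ->
  measurable_fun I (S t f).
Proof.
move=> t0 mf; have mE : measurable_fun setT (EFin \o (f \_ I)).
  by apply/measurable_EFinP; exact: mpatch.
rewrite (_ : S t f = fine \o (fun x => (markov_mean t (EFin \o (f \_ I))^\+%E x -
                  markov_mean t (EFin \o (f \_ I))^\-%E x)%E)); last first.
  by apply/funext => x; exact: semigroupE.
apply: measurableT_comp => //; apply: emeasurable_funB.
- by apply: measurable_markov_mean => //; exact: measurable_funepos.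
- by apply: measurable_markov_mean => //; exact: measurable_funeneg.
Qed.

Let sq f : R -> \bar R := fun y => (((f \_ I) y) ^+ 2)%:E.

Let msq f : measurable_fun I f -> measurable_fun setT (sq f).
Proof. by move=> mf; apply/measurable_EFinP/measurable_funX; exact: mpatch. Qed.

Let sq0 f y : (0 <= sq f y)%E. Proof. by rewrite lee_fin sqr_ge0. Qed.

Lemma markov_integrable t f x : 0 <= t -> measurable_fun I f ->
  (markov_mean t (sq f) x < +oo)%E ->
  (Px x).-integrable setT (EFin \o (fun w => f (X t w) ^+ 2)) /\
  (Px x).-integrable setT (EFin \o (fun w => f (X t w))).
Proof.
move=> t0 mf foo.
have mfX := measurable_path_comp t0 mf.
have i2 : (Px x).-integrable setT (EFin \o (fun w => f (X t w) ^+ 2)).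
  apply/integrableP; split; first by apply/measurable_EFinP/measurable_funX.
  move: foo; congr (_ < _)%E; apply: eq_integral => w _ /=.
  by rewrite /sq patchX// ger0_norm// sqr_ge0.
split=> //.
have i1 : (Px x).-integrable setT (EFin \o cst 1) by exact: finite_measure_integrable_cst.
apply: le_integrable (integrableD measurableT i1 i2) => //.
  exact/measurable_EFinP.
move=> w _ /=; rewrite lee_fin [X in _ <= X]ger0_norm; last first.
  by rewrite addr_ge0// sqr_ge0.
rewrite -(real_normK (num_real (f (X t w)))).
have := sqr_ge0 (`|f (X t w)| - 1); have := sqr_ge0 (`|f (X t w)|); nra.
Qed.

(** Nonnegativity of the mean of [(f(X_t) - m)^2] with [m = S t f x]. An infinite second moment
    makes the bound trivial, and a finite one makes [f(X_t)] integrable. *)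
Lemma semigroup_jensen t f x : 0 <= t -> measurable_fun I f ->
  ((S t f x ^+ 2)%:E <= markov_mean t (sq f) x)%E.
Proof.
move=> t0 mf.
have [foo|] := ltP (markov_mean t (sq f) x) +oo%E; last first.
  by rewrite leye_eq => /eqP ->; rewrite leey.
have [i2 i1] := markov_integrable t0 mf foo.
have -> : markov_mean t (sq f) x = (\int[Px x]_w (f (X t w) ^+ 2))%:E.
  rewrite /Rintegral fineK; last exact: integrable_fin_num.
  by apply: eq_integral => w _; rewrite /sq patchX.
rewrite lee_fin; set m := S t f x.
have ic : (Px x).-integrable setT (EFin \o cst (m ^+ 2)).
  exact: finite_measure_integrable_cst.
have i1' : (Px x).-integrable setT (EFin \o (fun w => 2 * m * f (X t w))).
  by apply: eq_integrable (integrableZl measurableT (2 * m) i1) => // w _; rewrite /= EFinM.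
have : 0 <= \int[Px x]_w (f (X t w) ^+ 2 - 2 * m * f (X t w) + m ^+ 2).
  apply: Rintegral_ge0 => w _.
  rewrite (_ : _ + _ = (f (X t w) - m) ^+ 2); last by ring.
  exact: sqr_ge0.
rewrite RintegralD//; last exact: (integrableB measurableT i2 i1').
rewrite RintegralB// RintegralZl// Rintegral_cst// -/(S t f x) -/m.
have -> : fine (Px x [set: O]) = 1 := congr1 fine (probability_setT (Px x)).
by lra.
Qed.

Lemma semigroup_sq_integrable t f : 0 <= t -> L2 f ->
  (\int[leb]_(x in I) (markov_mean t (sq f) x * (q x)%:E) = (dot f f)%:E)%E.
Proof.
move=> t0 Lf; rewrite invariant_markov_mean//; last exact: (msq Lf.1).
rewrite -L2norm_sqE//; apply: eq_integral => x xI.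
by rewrite /sq patchE xI EFinM.
Qed.

(** Jensen's inequality at each point, then invariance of [q] turns the integral of the second
    moments into the norm of [f]. *)
Lemma semigroup_L2 t f : 0 <= t -> L2 f -> L2 (S t f).
Proof.
move=> t0 Lf; have mf := Lf.1; split; first exact: measurable_semigroup.
apply: (@le_lt_trans _ _ (\int[leb]_(x in I) (markov_mean t (sq f) x * (q x)%:E))%E).
  apply: ge0_le_integral => //.
  - by move=> x Ix; rewrite lee_fin mulr_ge0 ?sqr_ge0// ltW ?q0.
  - apply/measurable_EFinP; apply: measurable_funM => //; apply: measurable_funX.
    exact: measurable_semigroup.
  - apply: emeasurable_funM => //; apply: measurable_markov_mean => //.
    exact: msq.
  - by move=> x Ix; rewrite EFinM lee_wpmul2r ?qE0//; exact: semigroup_jensen.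
by rewrite semigroup_sq_integrable// ltry.
Qed.

Lemma semigroup_contraction t f : 0 <= t -> L2 f -> dot (S t f) (S t f) <= dot f f.
Proof.
move=> t0 Lf; have mf := Lf.1; have LS := semigroup_L2 t0 Lf.
rewrite -lee_fin -L2norm_sqE// -(semigroup_sq_integrable t0 Lf).
apply: ge0_le_integral => //.
- by move=> x Ix; rewrite lee_fin mulr_ge0 ?sqr_ge0// ltW ?q0.
- apply/measurable_EFinP; apply: measurable_funM => //; apply: measurable_funX.
  exact: measurable_semigroup.
- apply: emeasurable_funM => //; apply: measurable_markov_mean => //.
  exact: msq.
- by move=> x Ix; rewrite EFinM lee_wpmul2r ?qE0//; exact: semigroup_jensen.
Qed.

(** The source of the almost-everywhere qualifiers: at an exceptional starting point [f(X_t)] may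
    fail to be integrable, and [semigroup] is then not a true expectation. *)
Lemma markov_mean_sq_lty t f : 0 <= t -> L2 f ->
  {ae leb, forall x, I x -> (markov_mean t (sq f) x < +oo)%E}.
Proof.
move=> t0 Lf.
have ms : measurable_fun (I : set (measurableTypeR R)) (fun x => (markov_mean t (sq f) x * (q x)%:E)%E).
  apply: emeasurable_funM => //; apply: measurable_markov_mean => //.
  exact: (msq Lf.1).
have : leb.-integrable I (fun x => (markov_mean t (sq f) x * (q x)%:E)%E).
  apply/integrableP; split => //.
  rewrite (_ : (\int[_]_(_ in _) _)%E = (dot f f)%:E) ?ltry//.
  rewrite -(semigroup_sq_integrable t0 Lf); apply: eq_integral => x /set_mem Ix.
  by rewrite gee0_abs// mule_ge0 ?qE0 ?markov_mean_ge0.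
move=> /(integrable_ae mI') H; apply: ae_imp H => x H Ix.
have := H Ix; have := @markov_mean_ge0 t (sq f) x (sq0 f).
case: (markov_mean t (sq f) x) => [r _ _|_|//]; first by rewrite ltry.
by rewrite gt0_mulye// lte_fin q0.
Qed.

Lemma semigroup_lin t c f g : 0 <= t -> L2 f -> L2 g ->
  {ae leb, forall x, I x -> S t (fun y => c * f y + g y) x = c * S t f x + S t g x}.
Proof.
move=> t0 Lf Lg.
apply: ae_imp2 (markov_mean_sq_lty t0 Lf) (markov_mean_sq_lty t0 Lg) => x Hf Hg Ix.
have [_ i1] := markov_integrable t0 Lf.1 (Hf Ix).
have [_ i2] := markov_integrable t0 Lg.1 (Hg Ix).
rewrite /semigroup -RintegralZl// -RintegralD//.
by apply: eq_integrable (integrableZl measurableT c i1) => // w _; rewrite /= EFinM.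
Qed.

Lemma semigroup0 f x : I x -> measurable_fun I f -> S 0 f x = f x.
Proof.
move=> Ix mf; have mX0 := markov_meas MP (lexx 0).
have m1 : measurable [set w | X 0 w = x].
  rewrite (_ : [set w | _] = X 0 @^-1` [set x])//.
  by rewrite -[_ @^-1` _]setTI; apply: mX0 => //; exact: measurable_set1.
have ae1 : {ae Px x, forall w, setT w -> (f (X 0 w))%:E = (f x)%:E}.
  exists (~` [set w | X 0 w = x]); split.
  - exact: measurableC.
  - by rewrite probability_setC// (markov_start MP Ix) subee.
  - by move=> w /=; apply: contra_not => ->.
rewrite /semigroup /Rintegral (ae_eq_integral _ _ _ _ _ ae1)//; last first.
  by apply/measurable_EFinP; exact: measurable_path_comp.
have E1 : fine (Px x [set: O]) = 1 := congr1 fine (probability_setT (Px x)).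
by rewrite -[LHS]/(\int[Px x]_w (f x)) Rintegral_cst// E1 mulr1.
Qed.

(** Chapman-Kolmogorov for the positive and negative parts, subtracted at the points where both
    means are finite. *)
Lemma semigroup_add s u f : 0 <= s -> 0 <= u -> L2 f ->
  {ae leb, forall x, I x -> S (s + u) f x = S s (S u f) x}.
Proof.
move=> s0 u0 Lf; have su0 : 0 <= s + u by rewrite addr_ge0.
apply: ae_imp (markov_mean_sq_lty su0 Lf) => x Hf Ix.
have [_ i1] := markov_integrable su0 Lf.1 (Hf Ix).
have mE : measurable_fun setT (EFin \o (f \_ I)).
  by apply/measurable_EFinP; apply: mpatch; exact: Lf.1.
have mp : measurable_fun setT (EFin \o (f \_ I))^\+%E by exact: measurable_funepos.
have mn : measurable_fun setT (EFin \o (f \_ I))^\-%E by exact: measurable_funeneg.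
have ip : (Px x).-integrable setT (fun w => markov_mean u (EFin \o (f \_ I))^\+%E (X s w)).
  apply/integrableP; split; first exact: measurable_markov_mean_comp.
  under eq_integral do rewrite gee0_abs ?markov_mean_ge0//.
  rewrite -/(markov_mean s _ x) -chapman_kolmogorov//.
  have := integral_funepos_lt_pinfty measurableT i1; congr (_ < _)%E.
  by apply: eq_integral => w _; rewrite !funeposE /= patchX.
have im : (Px x).-integrable setT (fun w => markov_mean u (EFin \o (f \_ I))^\-%E (X s w)).
  apply/integrableP; split; first exact: measurable_markov_mean_comp.
  under eq_integral do rewrite gee0_abs ?markov_mean_ge0//.
  rewrite -/(markov_mean s _ x) -chapman_kolmogorov//.
  have := integral_funeneg_lt_pinfty measurableT i1; congr (_ < _)%E.
  by apply: eq_integral => w _; rewrite !funenegE /= patchX.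
rewrite semigroupE// !chapman_kolmogorov// /semigroup /Rintegral.
congr fine; rewrite -integralB//.
apply: ae_eq_integral => //.
- exact: (measurable_int _ (integrableB measurableT ip im)).
- apply/measurable_EFinP.
  exact: (measurable_path_comp s0 (measurable_semigroup u0 Lf.1)).
- have := integrable_ae measurableT ip; have := integrable_ae measurableT im.
  apply: ae_imp2 => w Hm Hp _.
  rewrite -[fine _]/(S u f (X s w)) semigroupE//= fineK// fin_numB.
  by rewrite Hp// Hm.
Qed.

End markov_semigroup.

(** * The state interval, primitives up to its endpoints, and the stationary density *)

Section state_interval.
Context {R : realType} (l r : \bar R) (I : set R).
Hypothesis HI : interval_with_endpoints l r I.
Local Notation leb := (@lebesgue_measure R).
Implicit Types (f g h F : R -> R) (x y z a b : R).

Lemma interior_state x : interior_pt l r x -> I x.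
Proof. by case: HI => _ H _; exact: H. Qed.

Lemma state_segment x y z : I x -> I y -> x <= z -> z <= y -> I z.
Proof.
case: HI => lr ioI Iio Ix Iy; rewrite le_eqVlt => /predU1P[<-//|xz].
rewrite le_eqVlt => /predU1P[->//|zy]; apply: ioI; split.
- by apply: (le_lt_trans (Iio _ Ix).1); rewrite lte_fin.
- by apply: (lt_le_trans _ (Iio _ Iy).2); rewrite lte_fin.
Qed.

Lemma measurable_state : measurable I.
Proof.
apply: is_interval_measurable => x y Ix Iy z /andP[xz zy].
exact: (state_segment Ix Iy).
Qed.

Lemma interior_exists : exists x, interior_pt l r x.
Proof.
case: HI => + _ _; rewrite /interior_pt.
case: l => [a| |]; case: r => [b| |]//= ab.
- exists ((a + b) / 2); rewrite !lte_fin; move: ab; rewrite lte_fin; lra.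
- by exists (a + 1); rewrite ltry lte_fin ltrDl.
- by exists (b - 1); rewrite ltNyr lte_fin gtrBl.
- by exists 0; rewrite ltry ltNyr.
Qed.

Lemma interior_near x : interior_pt l r x -> \forall y \near x, interior_pt l r y.
Proof.
move=> [lx xr]; apply: filterI.
  case: l lx => [a| |]//= lx; last by apply: filterE => y; exact: ltNyr.
  by rewrite lte_fin in lx; apply: filterS (lt_nbhsr lx) => y; rewrite lte_fin.
case: r xr => [b| |]//= xr; last by apply: filterE => y; exact: ltry.
by rewrite lte_fin in xr; apply: filterS (lt_nbhsl xr) => y; rewrite lte_fin.
Qed.

Lemma interior_ball x : interior_pt l r x ->
  exists2 e : R, 0 < e & forall y, `|y - x| <= e -> interior_pt l r y.
Proof.
move=> /interior_near[e /= e0 H]; exists (e / 2); first by rewrite divr_gt0.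
move=> y ye; apply: H; rewrite /= distrC (le_lt_trans ye)//.
by rewrite ltr_pdivrMr// ltr_pMr// ltr1n.
Qed.

(** Serves to approach an endpoint belonging to [I] along interior points. *)
Lemma interior_segment x z t : I x -> interior_pt l r z -> 0 < t -> t <= 1 ->
  interior_pt l r (x + t * (z - x)).
Proof.
move=> Ix [lz zr] t0 t1; have [_ _ /(_ _ Ix)[lx xr]] := HI.
have [xz|zx|->] := ltgtP x z; last by rewrite subrr mulr0 addr0; split.
- split.
    by apply: (le_lt_trans lx); rewrite lte_fin ltrDl mulr_gt0// subr_gt0.
  apply: le_lt_trans zr; rewrite lee_fin -lerBrDl ler_piMl// subr_ge0 ltW//.
- split.
    apply: (lt_le_trans lz); rewrite lee_fin -lerBlDl -[X in X <= _]opprB -[X in _ <= X]opprK lerN2.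
    by rewrite -mulrN opprB ler_piMl// subr_ge0 ltW.
  by apply: lt_le_trans xr; rewrite lte_fin gtrDl pmulr_rlt0// subr_lt0.
Qed.

Lemma within_dist f x e : {within I, continuous f} -> I x -> 0 < e ->
  exists2 d, 0 < d & forall y, I y -> `|y - x| < d -> `|f y - f x| < e.
Proof.
move=> cf Ix e0.
have /cvgrPdist_lt/(_ _ e0)[d /= d0 H] := (subspace_continuousP _ _).1 cf x Ix.
exists d => // y Iy yd; rewrite distrC; apply: H => //.
by rewrite /= distrC.
Qed.

Lemma within_interior_continuous f x : {within I, continuous f} ->
  interior_pt l r x -> {for x, continuous f}.
Proof.
move=> cf ix; apply/cvgrPdist_lt => e e0.
have [d d0 H] := within_dist cf (interior_state ix) e0.
near=> y; rewrite distrC; apply: H.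
  by apply: interior_state; near: y; exact: interior_near.
by near: y; exists d => //= y; rewrite distrC.
Unshelve. all: by end_near. Qed.

Lemma interior_approx x e : I x -> 0 < e ->
  exists2 y, interior_pt l r y & `|y - x| < e.
Proof.
move=> Ix e0; have [z iz] := interior_exists.
pose t := Num.min 1 (e / 2 / (`|z - x| + 1)).
have z1 : 0 < `|z - x| + 1 by rewrite ltr_wpDl.
have t0 : 0 < t by rewrite lt_min ltr01 !divr_gt0.
have t1 : t <= 1 by rewrite ge_min lexx.
exists (x + t * (z - x)); first exact: interior_segment.
rewrite addrAC subrr add0r normrM gtr0_norm//.
apply: (@le_lt_trans _ _ (e / 2 / (`|z - x| + 1) * (`|z - x| + 1))).
  apply: ler_pM => //; [exact: ltW|by rewrite ge_min lexx orbT|by rewrite lerDl].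
by rewrite divfK ?gt_eqF// ltr_pdivrMr// ltr_pMr// ltr1n.
Qed.

Lemma within_eq_interior f g : {within I, continuous f} -> {within I, continuous g} ->
  (forall x, interior_pt l r x -> f x = g x) -> forall x, I x -> f x = g x.
Proof.
move=> cf cg fg x Ix; apply/eqP; rewrite -subr_eq0 -normr_le0.
apply/ler_addgt0Pl => e e0; rewrite addr0.
have e2 : 0 < e / 2 by rewrite divr_gt0.
have [d1 d10 H1] := within_dist cf Ix e2.
have [d2 d20 H2] := within_dist cg Ix e2.
have dd : 0 < Num.min d1 d2 by rewrite lt_min d10.
have [y iy] := interior_approx Ix dd; rewrite lt_min => /andP[].
move=> /(H1 _ (interior_state iy)) h1 /(H2 _ (interior_state iy)) h2.
rewrite (_ : f x - g x = - (f y - f x) + (g y - g x)); last by rewrite (fg y iy); ring.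
rewrite (le_trans (ler_normD _ _))// normrN [leRHS]splitr lerD// ltW//.
Qed.

(** The ball contains an interval of positive length inside [I], which no null set can cover. *)
Lemma not_ae_interior (P : R -> Prop) x e : interior_pt l r x -> 0 < e ->
  (forall y, `|y - x| < e -> ~ P y) -> ~ {ae leb, forall y, I y -> P y}.
Proof.
move=> ix e0 nP [N [mN N0 sN]].
have [d d0 Hd] := interior_ball ix.
pose c := Num.min e d.
have c0 : 0 < c by rewrite lt_min e0.
pose J : set R := `]x - c, x + c[%classic.
have sub : J `<=` N.
  move=> y; rewrite /J/= in_itv/= -ltr_distl => yc; apply: sN => /= H.
  apply: (nP y); first by rewrite (lt_le_trans yc)// ge_min lexx.
  by apply: H; apply/interior_state/Hd; rewrite (le_trans (ltW yc))// ge_min lexx orbT.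
have mJ : measurable (J : set (measurableTypeR R)) by exact: measurable_itv.
have : (leb J <= leb N)%E := le_measure leb (mem_set mJ) (mem_set mN) sub.
rewrite N0 /J lebesgue_measure_itv/= lte_fin ltrD2l gtrN// -EFinD lee_fin.
rewrite (_ : x + c - (x - c) = c + c); last by ring.
by rewrite leNgt addr_gt0.
Qed.

Lemma interior_ae_eq f g : (forall x, interior_pt l r x -> {for x, continuous f}) ->
  (forall x, interior_pt l r x -> {for x, continuous g}) ->
  {ae leb, forall x, I x -> f x = g x} -> forall x, interior_pt l r x -> f x = g x.
Proof.
move=> cf cg fg x ix; apply: contrapT => fgx.
have cfg : {for x, continuous (fun y => f y - g y)}.
  by apply: cvgB; [exact: cf|exact: cg].
have e0 : 0 < `|f x - g x| by rewrite normr_gt0 subr_eq0; exact/eqP.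
have /cvgrPdist_lt/(_ _ e0)[d /= d0 H] := cfg.
apply: (not_ae_interior ix d0 _ fg) => y yd fgy.
have := H y; rewrite /= distrC => /(_ yd).
by rewrite fgy subrr subr0 ltxx.
Qed.

(** The passage from L^2 classes to functions: almost-everywhere equality is equality on the
    interior by continuity, then at the endpoints in [I] by approximation from inside. *)
Lemma within_ae_eq f g : {within I, continuous f} -> {within I, continuous g} ->
  {ae leb, forall x, I x -> f x = g x} -> forall x, I x -> f x = g x.
Proof.
move=> cf cg fg; apply: within_eq_interior => //.
by apply: interior_ae_eq => // x; exact: within_interior_continuous.
Qed.

Lemma continuous_segment_integrable f a b : {within I, continuous f} ->
  I a -> I b -> leb.-integrable `[a, b] (EFin \o f).
Proof.
move=> cf Ia Ib; apply: continuous_compact_integrable; first exact: segment_compact.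
apply: continuous_subspaceW cf => x /=; rewrite in_itv/= => /andP[ax xb].
exact: (state_segment Ia Ib).
Qed.

(** The fundamental theorem of calculus on a small segment around [x]; changing the base point
    changes [F] by a constant. *)
Lemma increment_derive F h : (forall x, interior_pt l r x -> {for x, continuous h}) ->
  (forall x y, interior_pt l r x -> interior_pt l r y -> x <= y ->
     F y - F x = \int[leb]_(z in `[x, y]) h z) ->
  forall x, interior_pt l r x -> is_derive x (1 : R) F (h x).
Proof.
move=> ch Fh x ix; have [e e0 He] := interior_ball ix.
pose a := x - e; pose b := x + e.
have ab y : a <= y -> y <= b -> interior_pt l r y.
  by move=> ay yb; apply: He; rewrite ler_distl ay.
have axb : a < x < b by rewrite /a /b ltrBlDr ltrDl e0.
have /andP[ax xb] := axb.
have ih : leb.-integrable `[a, b] (EFin \o h).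
  apply: continuous_compact_integrable; first exact: segment_compact.
  apply: continuous_in_subspaceT => y /set_mem/=; rewrite in_itv/= => /andP[ay yb].
  by apply/ch/ab.
have [dG GE] := continuous_FTC1_closed xb ih ax (ch _ ix).
apply: (@near_eq_is_derive _ _ _ (fun y => F a + \int[leb]_(t in `[a, y]) h t)).
- near=> y.
  have ay : a <= y by apply/ltW; near: y; exact: lt_nbhsr.
  have yb : y <= b by apply/ltW; near: y; exact: lt_nbhsl.
  have ia := ab a (lexx a) (ltW (lt_trans ax xb)).
  by rewrite -(Fh a y ia (ab _ ay yb) ay) subrKC.
- rewrite -GE derive1E -[X in is_derive _ _ _ X]add0r.
  apply: is_deriveD; apply: DeriveDef => //.
Unshelve. all: by end_near. Qed.

Lemma Rintegral_segment_add f a b c : {within I, continuous f} -> I a -> I c ->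
  a <= b -> b <= c ->
  \int[leb]_(z in `[a, c]) f z = \int[leb]_(z in `[a, b]) f z + \int[leb]_(z in `[b, c]) f z.
Proof.
move=> cf Ia Ic ab bc; have Ib := state_segment Ia Ic ab bc.
have iac := continuous_segment_integrable cf Ia Ic.
have ibc := continuous_segment_integrable cf Ib Ic.
have := Rintegral_itvB (x := b) iac; rewrite !bnd_simp => /(_ ab bc).
rewrite Rintegral_itv_obnd_cbnd; first by move=> <-; rewrite addrC subrK.
by apply: integrableS ibc => //; apply: subset_itvr; rewrite bnd_simp.
Qed.

Lemma Rintegral_segment_bound f M a b : {within I, continuous f} -> I a -> I b ->
  a <= b -> (forall z, a <= z -> z <= b -> `|f z| <= M) ->
  `|\int[leb]_(z in `[a, b]) f z| <= M * (b - a).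
Proof.
move=> cf Ia Ib ab fM; have ifab := continuous_segment_integrable cf Ia Ib.
have mJ : measurable (`[a, b]%classic : set (measurableTypeR R)) by exact: measurable_itv.
apply: (le_trans (le_normr_Rintegral mJ ifab)).
have Jfin : (leb (`[a, b]%classic : set (measurableTypeR R)) = (b - a)%:E)%E.
  rewrite lebesgue_measure_itv/= lte_fin; case: ltP => // ba.
  by rewrite (_ : b = a) ?subrr//; apply/le_anti; rewrite ab ba.
have -> : M * (b - a) = \int[leb]_(z in `[a, b]) M.
  by rewrite Rintegral_cst//; congr (M * _); rewrite -[LHS]/(fine (b - a)%:E) -Jfin.
apply: le_Rintegral => //.
- exact: integrable_norm.
- by apply: continuous_compact_integrable; [exact: segment_compact|move=> ?; exact: cvg_cst].
- by move=> z; rewrite /= in_itv/= => /andP[az zb]; exact: fM.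
Qed.

Section oriented_primitive.
Variables (h : R -> R) (x0 : R).
Hypotheses (ch : {within I, continuous h}) (Ix0 : I x0).
Local Notation E := (oriented_integral h x0).

Lemma oriented_integralB x y : I x -> I y -> x <= y ->
  E y - E x = \int[leb]_(z in `[x, y]) h z.
Proof.
move=> Ix Iy xy; rewrite /oriented_integral.
have [x0x|xx0] := leP x0 x.
  rewrite (le_trans x0x xy) (Rintegral_segment_add ch Ix0 Iy x0x xy).
  by rewrite addrAC subrr add0r.
have [x0y|yx0] := leP x0 y.
  by rewrite (Rintegral_segment_add ch Ix Iy (ltW xx0) x0y) opprK addrC.
by rewrite (Rintegral_segment_add ch Ix Ix0 xy (ltW yx0)) opprK addrC addrK.
Qed.

Lemma oriented_integral_continuous : {within I, continuous E}.
Proof.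
apply/subspace_continuousP => x Ix; apply/cvgrPdist_le => e e0.
have [d d0 Hd] := within_dist ch Ix ltr01.
pose M := `|h x| + 1.
have M0 : 0 < M by rewrite ltr_wpDl.
have bd a b : I a -> I b -> a <= b -> `|a - x| < d -> `|b - x| < d ->
    `|E b - E a| <= M * (b - a).
  move=> Ia Ib ab ax bx; rewrite oriented_integralB//.
  apply: Rintegral_segment_bound => // z az zb.
  have Iz := state_segment Ia Ib az zb.
  have zx : `|z - x| < d.
    move: ax bx; rewrite !ltr_distl => /andP[xa _] /andP[_ bx].
    by rewrite (lt_le_trans xa az) (le_lt_trans zb bx).
  have := Hd _ Iz zx; rewrite /M => hz.
  rewrite -(subrK (h x) (h z)) addrC (le_trans (ler_normD _ _))// lerD2l ltW//.
exists (Num.min d (e / M)); first by rewrite /= lt_min d0 divr_gt0.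
move=> y /=; rewrite lt_min distrC => /andP[yd ye] Iy.
apply: (@le_trans _ _ (M * `|y - x|)); last first.
  by rewrite mulrC -ler_pdivlMr// ltW.
have xd : `|x - x| < d by rewrite subrr normr0.
have [xy|yx] := leP x y.
  by rewrite distrC (le_trans (bd x y _ _ _ _ _))// ler_wpM2l ?(ltW M0)// ler_norm.
rewrite (le_trans (bd y x _ _ (ltW yx) _ _))// ler_wpM2l ?(ltW M0)//.
by rewrite distrC ler_norm.
Qed.

Lemma oriented_integral_derive x : interior_pt l r x -> is_derive x (1 : R) E (h x).
Proof.
apply: increment_derive => [y|y z iy iz yz]; first exact: within_interior_continuous.
by rewrite oriented_integralB//; exact: interior_state.
Qed.

End oriented_primitive.

Section stationary.
Variables mu sigma : R -> R.
Hypotheses (cmu : {within I, continuous mu}) (csigma : {within I, continuous sigma}).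
Hypothesis sigma0 : forall x, I x -> 0 < sigma x.
Hypothesis mass_fin : (\int[leb]_(x in I) (speed_density I mu sigma x)%:E < +oo)%E.
Local Notation Z := (\int[leb]_(y in I) speed_density I mu sigma y).
Hypothesis Z0 : Z != 0.
Local Notation q := (stationary_density I mu sigma).
Local Notation x0 := (xget 0 I).
Local Notation h := (fun y => 2 * mu y / sigma y ^+ 2).
Local Notation E := (oriented_integral h x0).

Lemma xget_state : I x0.
Proof.
case: xgetP => [x _ //|H]; have [x /interior_state Ix] := interior_exists.
by have := H x.
Qed.

Lemma continuous_within_drift_ratio : {within I, continuous h}.
Proof.
apply/subspace_continuousP => x Ix.
have cs := (subspace_continuousP _ _).1 csigma x Ix.
have cm := (subspace_continuousP _ _).1 cmu x Ix.
apply: cvgM; first by apply: cvgM => //; exact: cvg_cst.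
apply: cvgV; first by rewrite expf_neq0// gt_eqF// sigma0.
by rewrite expr2; under eq_fun do rewrite expr2; exact: cvgM.
Qed.

Lemma speed_density_gt0 x : I x -> 0 < speed_density I mu sigma x.
Proof. by move=> Ix; rewrite mulr_gt0 ?expR_gt0// invr_gt0 exprn_gt0// sigma0. Qed.

Lemma speed_mass_gt0 : 0 < Z.
Proof.
rewrite lt_neqAle eq_sym Z0/=; apply: Rintegral_ge0 => x Ix.
exact/ltW/speed_density_gt0.
Qed.

Lemma stationary_density_gt0 x : I x -> 0 < q x.
Proof. by move=> Ix; rewrite divr_gt0 ?speed_mass_gt0// speed_density_gt0. Qed.

Lemma speed_density_continuous : {within I, continuous speed_density I mu sigma}.
Proof.
apply/subspace_continuousP => x Ix.
have cs := (subspace_continuousP _ _).1 csigma x Ix.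
have cE := (subspace_continuousP _ _).1
  (oriented_integral_continuous continuous_within_drift_ratio xget_state) x Ix.
apply: cvgM.
  apply: cvgV; first by rewrite expf_neq0// gt_eqF// sigma0.
  by rewrite expr2; under eq_fun do rewrite expr2; exact: cvgM.
by apply: (@cvg_comp _ _ _ _ expR _ _ _ cE); exact: continuous_expR.
Qed.

Lemma stationary_density_continuous : {within I, continuous q}.
Proof.
apply/subspace_continuousP => x Ix.
apply: cvgM; last exact: cvg_cst.
exact: ((subspace_continuousP _ _).1 speed_density_continuous x Ix).
Qed.

Lemma stationary_density_integrable : leb.-integrable I (EFin \o q).
Proof.
have mI : measurable (I : set (measurableTypeR R)) := measurable_state.
have im : leb.-integrable I (EFin \o speed_density I mu sigma).
  apply/integrableP; split.
    apply/measurable_EFinP; apply: subspace_continuous_measurable_fun => //.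
    exact: speed_density_continuous.
  move: mass_fin; congr (_ < _)%E; apply: eq_integral => x /set_mem Ix /=.
  by rewrite gtr0_norm// speed_density_gt0.
apply: eq_integrable (integrableZl mI Z^-1 im) => // x _.
by rewrite /= -EFinM mulrC.
Qed.

(** [sigma^2 q] is, up to the normalizing constant, the exponential of the primitive of
    [2 mu / sigma^2]: the factor [sigma^-2] of the speed density cancels. *)
Lemma scale_density_derive x : interior_pt l r x ->
  is_derive x (1 : R) (fun y => sigma y ^+ 2 * q y) (2 * mu x * q x).
Proof.
move=> ix; have Ix := interior_state ix.
have dE := oriented_integral_derive continuous_within_drift_ratio xget_state ix.
have sq y : I y -> sigma y ^+ 2 * q y = expR (E y) * Z^-1.
  move=> Iy; rewrite /stationary_density /speed_density mulrA mulrA.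
  by rewrite divff ?mul1r// expf_neq0// gt_eqF// sigma0.
apply: (@near_eq_is_derive _ _ _ (fun y => Z^-1 * expR (E y))).
  near=> y; rewrite sq ?(mulrC (Z^-1))//; apply: interior_state.
  by near: y; exact: interior_near.
have dexp := is_derive1_comp (is_derive_expR (E x)) dE.
have -> : 2 * mu x * q x = Z^-1 *: (expR (E x) * h x).
  rewrite /stationary_density /speed_density /GRing.scale /=.
  by field; rewrite Z0 gt_eqF// sigma0.
exact: is_deriveZ.
Unshelve. all: by end_near. Qed.

End stationary.

End state_interval.

(** * The eigenfunction equation *)

Section one_diffusion.
Context {R : realType} (l r : \bar R) (I : set R).
Hypothesis HI : interval_with_endpoints l r I.
Local Notation leb := (@lebesgue_measure R).
Implicit Types (f g h F phi : R -> R) (x y z a b lam : R).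

(** The analytic part of [Assumption1], with a nonzero speed mass, so that the arguments on
    differential equations involve no process. [Rintegral] being a [fine] part, a nonzero value is
    what makes the normalization meaningful. *)
Record regular_coefficients (mu sigma : R -> R) : Prop := {
  reg_drift : C2_on l r I mu;
  reg_sigma : C2_on l r I sigma;
  reg_pos : forall x, I x -> 0 < sigma x;
  reg_fin : (\int[leb]_(x in I) (speed_density I mu sigma x)%:E < +oo)%E;
  reg_mass : \int[leb]_(y in I) speed_density I mu sigma y != 0 }.

Variables mu sigma : R -> R.
Hypothesis reg : regular_coefficients mu sigma.
Local Notation q := (stationary_density I mu sigma).

Lemma reg_drift_cont : {within I, continuous mu}.
Proof. by have [f1 [f2 []]] := reg_drift reg. Qed.

Lemma reg_sigma_cont : {within I, continuous sigma}.
Proof. by have [f1 [f2 []]] := reg_sigma reg. Qed.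

Lemma reg_q_gt0 x : I x -> 0 < q x.
Proof. exact: (stationary_density_gt0 (reg_pos reg) (reg_mass reg)). Qed.

Lemma reg_q_cont : {within I, continuous q}.
Proof.
exact: (stationary_density_continuous HI reg_drift_cont reg_sigma_cont (reg_pos reg)).
Qed.

Lemma reg_q_integrable : leb.-integrable I (EFin \o q).
Proof.
exact: (stationary_density_integrable HI reg_drift_cont reg_sigma_cont (reg_pos reg) (reg_fin reg)).
Qed.

Lemma reg_scale_derive x : interior_pt l r x ->
  is_derive x (1 : R) (fun y => sigma y ^+ 2 * q y) (2 * mu x * q x).
Proof.
exact: (scale_density_derive HI reg_drift_cont reg_sigma_cont (reg_pos reg) (reg_mass reg)).
Qed.

Lemma is_derive_continuous f x (c : R) : is_derive x (1 : R) f c -> {for x, continuous f}.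
Proof.
by move=> [df _]; exact/differentiable_continuous/derivable1_diffP.
Qed.

(** Here [f2] is merely integrable, so continuity comes from that of the indefinite integral in its
    upper limit. *)
Lemma interior_increment_continuous f1 f2 :
  (forall x y, interior_pt l r x -> interior_pt l r y -> x <= y ->
     leb.-integrable `[x, y] (EFin \o f2) /\
     f1 y - f1 x = \int[leb]_(z in `[x, y]) f2 z) ->
  forall x, interior_pt l r x -> {for x, continuous f1}.
Proof.
move=> H x ix; have [e e0 He] := interior_ball ix.
pose a := x - e; pose b := x + e.
have ab y : a <= y -> y <= b -> interior_pt l r y.
  by move=> ay yb; apply: He; rewrite ler_distl ay.
have ax : a < x by rewrite /a ltrBlDr ltrDl.
have xb : x < b by rewrite /b ltrDl.
have axb := lt_trans ax xb.
have ia := ab a (lexx a) (ltW axb).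
have ib := ab b (ltW axb) (lexx b).
have [i2 _] := H _ _ ia ib (ltW axb).
have cG := parameterized_integral_continuous (ltW axb) i2.
have xab : x \in `]a, b[ by rewrite in_itv/= ax.
have cGx := within_continuous_continuous axb cG xab.
pose G y := f1 a + parameterized_integral leb a y f2.
have cG' : {for x, continuous G} by apply: cvgD => //; exact: cvg_cst.
have GE y : a <= y -> y <= b -> f1 y = G y.
  move=> ay yb; have [_ Hy] := H _ _ ia (ab _ ay yb) ay.
  by rewrite /G -(subrK (f1 a) (f1 y)) Hy addrC.
rewrite /prop_for /continuous_at (GE x (ltW ax) (ltW xb)).
apply: cvg_trans cG'; apply: near_eq_cvg; near=> y; apply/esym/GE.
- by apply/ltW; near: y; exact: lt_nbhsr.
- by apply/ltW; near: y; exact: lt_nbhsl.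
Unshelve. all: by end_near. Qed.

(* The equation [mu phi' + sigma^2 phi'' / 2 = lam phi] in self-adjoint form is
   [(sigma^2 q phi')' = 2 lam q phi]. *)
Lemma eigenfunction_ode phi f0 lam : {within I, continuous phi} ->
  {ae leb, forall x, I x -> f0 x = phi x} ->
  diffusion_operator l r I mu sigma f0 (fun x => lam * phi x) ->
  exists f1 : R -> R,
  [/\ (forall x, interior_pt l r x -> is_derive x (1 : R) phi (f1 x)),
      (forall x, interior_pt l r x ->
         is_derive x (1 : R) f1 (2 * (lam * phi x - mu x * f1 x) / sigma x ^+ 2)),
      (forall x, interior_pt l r x ->
         is_derive x (1 : R) (fun y => sigma y ^+ 2 * q y * f1 y) (2 * lam * q x * phi x)) &
      tends_to_0_left l r (fun x => sigma x ^+ 2 * q x * f1 x)].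
Proof.
move=> cphi f0phi [f1 [f2 [df0 incr ode lim0 _]]]; exists f1.
have f0E x : interior_pt l r x -> f0 x = phi x.
  apply: (interior_ae_eq HI) => // y iy; last exact: (within_interior_continuous HI).
  exact: (is_derive_continuous (df0 _ iy)).
have cf1 := interior_increment_continuous incr.
(* The equation solved for the second derivative. This [g] is continuous and equals [f2] almost
   everywhere, hence [f1] is continuously differentiable with derivative [g]. *)
pose g x := 2 * (lam * phi x - mu x * f1 x) / sigma x ^+ 2.
have cg x : interior_pt l r x -> {for x, continuous g}.
  move=> ix; have Ix := interior_state HI ix.
  have cm := within_interior_continuous HI reg_drift_cont ix.
  have cs := within_interior_continuous HI reg_sigma_cont ix.
  have cp := within_interior_continuous HI cphi ix.
  apply: cvgM.
    apply: cvgM; first exact: cvg_cst.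
    by apply: cvgB; apply: cvgM => //; [exact: cvg_cst|exact: cf1].
  apply: cvgV; first by rewrite expf_neq0// gt_eqF// (reg_pos reg).
  by rewrite expr2; under eq_fun do rewrite expr2; exact: cvgM.
have incr_g x y : interior_pt l r x -> interior_pt l r y -> x <= y ->
    f1 y - f1 x = \int[leb]_(z in `[x, y]) g z.
  move=> ix iy xy; have [i2 ->] := incr _ _ ix iy xy.
  have inI z : `[x, y]%classic z -> interior_pt l r z.
    rewrite /= in_itv/= => /andP[xz zy]; case: ix iy => lx xr [ly yr]; split.
      by apply: (lt_le_trans lx); rewrite lee_fin.
    by apply: le_lt_trans yr; rewrite lee_fin.
  congr fine; apply: ae_eq_integral => //.
  - exact: (measurable_int _ i2).
  - apply/measurable_EFinP; apply: subspace_continuous_measurable_fun => //.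
    by apply: continuous_in_subspaceT => z /set_mem/inI; exact: cg.
  - apply: ae_imp ode => z + /inI iz => /(_ (interior_state HI iz)) gz.
    rewrite /g gz; congr EFin; field.
    by rewrite gt_eqF// (reg_pos reg)//; exact: interior_state iz.
have df1 x : interior_pt l r x -> is_derive x (1 : R) f1 (g x).
  exact: (increment_derive cg incr_g).
split=> //.
- move=> x ix; apply: near_eq_is_derive (df0 _ ix).
  by near=> y; apply: f0E; near: y; exact: interior_near.
- move=> x ix; have Ix := interior_state HI ix.
  have := is_deriveM (reg_scale_derive ix) (df1 _ ix).
  have -> // : (sigma x ^+ 2 * q x) *: g x + f1 x *: (2 * mu x * q x) = 2 * lam * q x * phi x.
  by rewrite /g /GRing.scale /=; field; rewrite gt_eqF// (reg_pos reg).
Unshelve. all: by end_near. Qed.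

End one_diffusion.

(** * Two diffusions with a common stationary density and common eigenfunctions *)

Section two_diffusions.
Context {R : realType} (l r : \bar R) (I : set R).
Hypothesis HI : interval_with_endpoints l r I.
Local Notation leb := (@lebesgue_measure R).
Implicit Types (f g h F phi : R -> R) (x y z a b lam : R).

Lemma interior_convex x y z : interior_pt l r x -> interior_pt l r y ->
  x <= z -> z <= y -> interior_pt l r z.
Proof.
move=> [lx xr] [ly yr] xz zy; split.
  by apply: (lt_le_trans lx); rewrite lee_fin.
by apply: le_lt_trans yr; rewrite lee_fin.
Qed.

Lemma derive0_cst F : (forall x, interior_pt l r x -> is_derive x (1 : R) F 0) ->
  forall x y, interior_pt l r x -> interior_pt l r y -> F x = F y.
Proof.
move=> dF x y; wlog xy : x y / x <= y => [H ix iy|ix iy].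
  by have [xy|/ltW yx] := leP x y; [exact: H xy ix iy|exact/esym/(H _ _ yx iy ix)].
have dxy z : z \in `]x, y[ -> is_derive z (1 : R) F 0.
  rewrite in_itv/= => /andP[/ltW xz /ltW zy].
  exact/dF/(interior_convex ix iy xz zy).
have cxy : {within `[x, y], continuous F}.
  apply: continuous_in_subspaceT => z /set_mem/=; rewrite in_itv/= => /andP[xz zy].
  exact/(@is_derive_continuous _ _ _ 0)/dF/(interior_convex ix iy xz zy).
have [c _ /eqP] := @MVT_segment R F (fun=> 0) x y xy dxy cxy.
by rewrite mul0r subr_eq0 => /eqP ->.
Qed.

Lemma derive0_left_limit0 F : (forall x, interior_pt l r x -> is_derive x (1 : R) F 0) ->
  tends_to_0_left l r F -> forall x, interior_pt l r x -> F x = 0.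
Proof.
move=> dF F0 x ix; apply/eqP; rewrite -normr_le0; apply/ler_addgt0Pl => e e0.
rewrite addr0; have [a ia Ha] := F0 _ e0.
have [d d0 Hd] := interior_ball ia.
have iz : interior_pt l r (a - d) by apply: Hd; rewrite addrAC subrr add0r normrN gtr0_norm.
rewrite (derive0_cst dF ix iz) ltW// Ha//; first by case: iz.
by rewrite ltrBlDr ltrDl.
Qed.

Lemma tends_to_0_left_lin f g a b : tends_to_0_left l r f -> tends_to_0_left l r g ->
  tends_to_0_left l r (fun x => a * f x - b * g x).
Proof.
move=> f0 g0 e e0; pose c := `|a| + `|b| + 1.
have c0 : 0 < c by rewrite ltr_wpDl// addr_ge0.
have ec : 0 < e / c by rewrite divr_gt0.
have [x ix fx] := f0 _ ec; have [y iy gy] := g0 _ ec.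
exists (Num.min x y); first by rewrite minEle; case: ifP.
move=> z lz; rewrite lt_min => /andP[zx zy].
rewrite (le_lt_trans (ler_normB _ _))// !normrM.
apply: (@le_lt_trans _ _ ((`|a| + `|b|) * (e / c))).
  by rewrite mulrDl lerD// ler_wpM2l// ltW// ?fx ?gy.
by rewrite mulrA ltr_pdivrMr// mulrC ltr_pM2l// ltrDl.
Qed.

Variables mu1 sigma1 mu2 sigma2 : R -> R.
Hypothesis reg1 : regular_coefficients l r I mu1 sigma1.
Hypothesis reg2 : regular_coefficients l r I mu2 sigma2.
Local Notation q1 := (stationary_density I mu1 sigma1).
Local Notation q2 := (stationary_density I mu2 sigma2).
Hypothesis q12 : forall x, I x -> q1 x = q2 x.

(** Since [q1 = q2], the combination [lam2 sigma1^2 q1 f1 - lam1 sigma2^2 q2 f1] has derivative 0,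
    and it tends to 0 at the left endpoint by the boundary condition. It is therefore 0, and [q2 f1]
    can be cancelled. *)
Lemma eigen_ratio lam1 lam2 phi f1 :
  (forall x, interior_pt l r x ->
     is_derive x (1 : R) (fun y => sigma1 y ^+ 2 * q1 y * f1 y) (2 * lam1 * q1 x * phi x)) ->
  tends_to_0_left l r (fun x => sigma1 x ^+ 2 * q1 x * f1 x) ->
  (forall x, interior_pt l r x ->
     is_derive x (1 : R) (fun y => sigma2 y ^+ 2 * q2 y * f1 y) (2 * lam2 * q2 x * phi x)) ->
  tends_to_0_left l r (fun x => sigma2 x ^+ 2 * q2 x * f1 x) ->
  forall x, interior_pt l r x -> f1 x != 0 ->
  lam2 * sigma1 x ^+ 2 = lam1 * sigma2 x ^+ 2.
Proof.
move=> d1 t1 d2 t2 x ix f1x; have Ix := interior_state HI ix.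
have := @derive0_left_limit0 (fun y => lam2 * (sigma1 y ^+ 2 * q1 y * f1 y) -
  lam1 * (sigma2 y ^+ 2 * q2 y * f1 y)) _ (tends_to_0_left_lin _ _ t1 t2) x ix.
have dW y : interior_pt l r y -> is_derive y (1 : R) (fun y => lam2 * (sigma1 y ^+ 2 * q1 y * f1 y) -
  lam1 * (sigma2 y ^+ 2 * q2 y * f1 y)) 0.
  move=> iy; have := is_deriveB (is_deriveZ lam2 (d1 _ iy)) (is_deriveZ lam1 (d2 _ iy)).
  have -> : lam2 *: (2 * lam1 * q1 y * phi y) - lam1 *: (2 * lam2 * q2 y * phi y) = 0.
    by rewrite /GRing.scale /= (q12 (interior_state HI iy)); ring.
  exact.
move=> /(_ dW) W0.
have /eqP : (lam2 * sigma1 x ^+ 2 - lam1 * sigma2 x ^+ 2) * (q2 x * f1 x) = 0.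
  by rewrite -[RHS]W0 (q12 Ix); ring.
rewrite mulf_eq0 subr_eq0 => /orP[/eqP//|].
by rewrite mulf_eq0 (negbTE f1x) orbF gt_eqF// (reg_q_gt0 reg2).
Qed.

(* The eigenfunctions have no common critical interval: on such an interval they
   would all vanish for [n >= 1], contradicting completeness. *)
Lemma eigen_derivative_dense (q : R -> R) (phi f1 : nat -> R -> R) (lam : nat -> R)
    mu sigma x e :
  measurable_fun I q -> (forall x, I x -> 0 < q x) ->
  leb.-integrable I (EFin \o q) ->
  orthobasis I q phi -> (forall x, I x -> phi 0%N x = 1) ->
  (forall n, lam n.+1 != 0) -> (forall x, I x -> 0 < sigma x) ->
  (forall n x, interior_pt l r x -> is_derive x (1 : R) (f1 n)
     (2 * (lam n * phi n x - mu x * f1 n x) / sigma x ^+ 2)) ->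
  interior_pt l r x -> 0 < e ->
  exists n y, [/\ interior_pt l r y, `|y - x| < e & f1 n.+1 y != 0].
Proof.
move=> mq q0 iq B phi0 lam0 sigma0 df1 ix e0; apply: contrapT => none.
have mI := measurable_state HI.
have [d d0 Hd] := interior_ball ix.
pose c := Num.min e d; have c0 : 0 < c by rewrite lt_min e0.
have f10 n y : `|y - x| < c -> f1 n.+1 y = 0.
  rewrite lt_min => /andP[ye yd]; apply: contrapT => /eqP fy; apply: none.
  by exists n, y; split=> //; apply: Hd; exact: ltW.
(* Where [f1] vanishes identically, the equation reduces to [2 lam phi / sigma^2 = 0]. *)
have phi_0 n y : `|y - x| < c -> phi n.+1 y = 0.
  move=> yc; have iy : interior_pt l r y.
    by apply: Hd; move: yc; rewrite lt_min => /andP[_ /ltW].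
  have dy := df1 n.+1 _ iy.
  have d0y : is_derive y (1 : R) (f1 n.+1) 0.
    have dcst : is_derive y (1 : R) (cst 0 : R -> R) 0 by exact: is_derive_cst.
    apply: near_eq_is_derive dcst.
    have c1 : 0 < c - `|y - x| by rewrite subr_gt0.
    exists (c - `|y - x|) => // z /=; rewrite distrC => zc; rewrite f10//.
    by rewrite -(subrK y z) -addrA (le_lt_trans (ler_normD _ _))// -ltrBrDr.
  have := @derive_val _ _ _ _ _ _ _ dy; rewrite (@derive_val _ _ _ _ _ _ _ d0y).
  move=> /esym/eqP; rewrite f10// mulr0 subr0 !mulf_eq0 invr_eq0 expf_eq0/=.
  rewrite (gt_eqF (sigma0 _ (interior_state HI iy))) pnatr_eq0 (negbTE (lam0 n)) !orbF/=.
  by move/eqP.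
(* The indicator of the right half of the interval is orthogonal to every [phi k] with [k >= 1], so
   it would be almost everywhere constant on [I]. A zero constant is refuted around [x + c/2], a
   nonzero one around [x - c/2]. *)
pose J : set R := `]x, x + c[%classic.
have mJ : measurable J by exact: measurable_itv.
pose f : R -> R := \1_J.
have mf : measurable_fun I f by apply: measurable_funTS; exact: measurable_indic.
have Lf : L2 I q f.
  apply: (@bounded_L2 _ _ _ _ _ _ 1) => // y Iy.
  by rewrite /f indicE; case: (y \in J); rewrite ?normr1 ?normr0.
have f0 k : k != 0%N -> L2dot I q f (phi k) = 0.
  case: k => // k _; rewrite /L2dot.
  transitivity (\int[leb]_(y in I) (0 : R)); last by rewrite Rintegral_cst// mul0r.
  apply: eq_Rintegral => y _; rewrite /f indicE.
  have [|_] := boolP (y \in J); last by rewrite !mul0r.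
  move=> /set_mem; rewrite /J/= in_itv/= => /andP[xy yc].
  rewrite phi_0 ?mulr0 ?mul0r//.
  by rewrite gtr0_norm ?subr_gt0// ltrBlDl.
have H := dot_single_coef mI mq q0 B Lf f0.
have c4 : 0 < c / 4 by rewrite divr_gt0.
have near_val y : `|y - x| <= c -> interior_pt l r y.
  by move=> yc; apply: Hd; rewrite (le_trans yc)// ge_min lexx orbT.
have xr : interior_pt l r (x + c / 2).
  apply: near_val; rewrite addrAC subrr add0r gtr0_norm ?divr_gt0//.
  by rewrite ler_pdivrMr// ler_peMr ?(ltW c0)// ler1n.
have xl : interior_pt l r (x - c / 2).
  apply: near_val; rewrite addrAC subrr add0r normrN gtr0_norm ?divr_gt0//.
  by rewrite ler_pdivrMr// ler_peMr ?(ltW c0)// ler1n.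
have [k0|k0] := eqVneq (L2dot I q f (phi 0%N)) 0.
  apply: (not_ae_interior HI xr c4 _ H) => y yc.
  rewrite k0 mul0r /f indicE mem_set; first by move/eqP; rewrite oner_eq0.
  by rewrite /J/= in_itv/=; move: yc; rewrite ltr_distl; lra.
apply: (not_ae_interior HI xl c4 _ H) => y yc.
have iy : interior_pt l r y.
  by apply: near_val; move: yc; rewrite ltr_distl ler_distl; lra.
rewrite /f indicE memNset ?phi0 ?mulr1.
- by move/esym/eqP; rewrite (negbTE k0).
- exact: (interior_state HI).
- by rewrite /J/= in_itv/=; move: yc; rewrite ltr_distl; lra.
Qed.

(** [k = sigma1^2 / sigma2^2] is locally constant on a dense open set, which alone would allow a
    Cantor function. But [k] is C^1, so [k'] vanishes everywhere, and the single value of [k] is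
    [lam1 n / lam2 n] for every [n >= 1]. *)
Lemma common_eigenfunctions_coefficients (phi f1 : nat -> R -> R) (lam1 lam2 : nat -> R) :
  orthobasis I q1 phi -> (forall x, I x -> phi 0%N x = 1) ->
  (forall n, {within I, continuous (phi n)}) ->
  (forall n, lam1 n.+1 < 0) -> (forall n, lam2 n.+1 < 0) ->
  (forall n x, interior_pt l r x -> is_derive x (1 : R) (phi n) (f1 n x)) ->
  (forall n x, interior_pt l r x -> is_derive x (1 : R) (f1 n)
     (2 * (lam1 n * phi n x - mu1 x * f1 n x) / sigma1 x ^+ 2)) ->
  (forall n x, interior_pt l r x ->
     is_derive x (1 : R) (fun y => sigma1 y ^+ 2 * q1 y * f1 n y) (2 * lam1 n * q1 x * phi n x)) ->
  (forall n, tends_to_0_left l r (fun x => sigma1 x ^+ 2 * q1 x * f1 n x)) ->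
  (forall n x, interior_pt l r x ->
     is_derive x (1 : R) (fun y => sigma2 y ^+ 2 * q2 y * f1 n y) (2 * lam2 n * q2 x * phi n x)) ->
  (forall n, tends_to_0_left l r (fun x => sigma2 x ^+ 2 * q2 x * f1 n x)) ->
  exists2 c : R, 0 < c & (forall n, lam2 n.+1 = c * lam1 n.+1) /\
    (forall x, I x -> sigma1 x ^+ 2 = c^-1 * sigma2 x ^+ 2 /\ mu1 x = c^-1 * mu2 x).
Proof.
move=> B phi0 cphi neg1 neg2 dphi df1 dw1 t1 dw2 t2.
have mI := measurable_state HI.
have cq1 := reg_q_cont HI reg1.
have mq1 : measurable_fun I q1.
  by apply: subspace_continuous_measurable_fun.
have iq1 := reg_q_integrable HI reg1.
have q10 := reg_q_gt0 reg1.
have s10 := reg_pos reg1; have s20 := reg_pos reg2.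
pose k x := sigma1 x ^+ 2 / sigma2 x ^+ 2.
have kE n x : interior_pt l r x -> f1 n.+1 x != 0 -> k x = lam1 n.+1 / lam2 n.+1.
  move=> ix fx; have s2x : sigma2 x != 0.
    by rewrite gt_eqF// s20//; exact: interior_state ix.
  have l2n : lam2 n.+1 != 0 by rewrite lt_eqF.
  have := eigen_ratio (dw1 n.+1) (t1 n.+1) (dw2 n.+1) (t2 n.+1) ix fx.
  move=> H; apply/eqP; rewrite /k eqr_div ?expf_neq0//.
  by apply/eqP; rewrite mulrC H.
have [g1 [g1' [cs1 cg1 _ ds1]]] := reg_sigma reg1.
have [g2 [g2' [cs2 cg2 _ ds2]]] := reg_sigma reg2.
pose k' x := 2 * sigma1 x * (g1 x * sigma2 x - g2 x * sigma1 x) / sigma2 x ^+ 3.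
have dk x : interior_pt l r x -> is_derive x (1 : R) k (k' x).
  move=> ix; have s2x : sigma2 x != 0 by rewrite gt_eqF// s20//; exact: interior_state ix.
  have s2x2 : sigma2 x ^+ 2 != 0 by rewrite expf_neq0.
  have d1 := is_deriveX 2 (ds1 _ ix).1.
  have d2' := is_deriveX 2 (ds2 _ ix).1.
  have d2 : is_derive x (1 : R) (fun y => (sigma2 y ^+ 2)^-1)
      (- (sigma2 x ^+ 2) ^- 2 *: ((2 * sigma2 x ^+ 2.-1) *: g2 x)).
    by apply: (@is_deriveV _ (sigma2 ^+ 2)).
  have := is_deriveM d1 d2.
  rewrite (_ : _ + _ = k' x)//.
  by rewrite /k' /GRing.scale /= !fctE expr1; field.
have ck' x : interior_pt l r x -> {for x, continuous k'}.
  move=> ix; have s2x : sigma2 x != 0 by rewrite gt_eqF// s20//; exact: interior_state ix.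
  have c1 := within_interior_continuous HI cs1 ix.
  have c2 := within_interior_continuous HI cs2 ix.
  have h1 := within_interior_continuous HI cg1 ix.
  have h2 := within_interior_continuous HI cg2 ix.
  apply: cvgM.
    by apply: cvgM; [apply: cvgM => //; exact: cvg_cst|apply: cvgB; exact: cvgM].
  apply: cvgV; first by rewrite expf_neq0.
  by rewrite !exprS expr0 mulr1; under eq_fun do rewrite !exprS expr0 mulr1; do 2 apply: cvgM => //.
(* If [k' x] were nonzero, so would be [k' y] at some nearby [y] where an [f1 n.+1] is nonzero; yet
   [k] is constant around such a [y]. *)
have k'0 x : interior_pt l r x -> k' x = 0.
  move=> ix; apply: contrapT => /eqP k'x.
  have e0 : 0 < `|k' x| by rewrite normr_gt0.
  have /cvgrPdist_lt/(_ _ e0)[d /= d0 Hd] := ck' _ ix.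
  have lam10 n : lam1 n.+1 != 0 by rewrite lt_eqF.
  have [n [y [iy yx fy]]] := eigen_derivative_dense mq1 q10 iq1 B phi0 lam10 s10 df1 ix d0.
  have k'y : k' y != 0.
    have := Hd y; rewrite /= distrC => /(_ yx).
    by apply: contraTneq => ->; rewrite subr0 ltxx.
  have cf : {for y, continuous (f1 n.+1)} := is_derive_continuous (df1 n.+1 _ iy).
  have fy0 : 0 < `|f1 n.+1 y| by rewrite normr_gt0.
  have dky : is_derive y (1 : R) k 0.
    have dcst : is_derive y (1 : R) (cst (lam1 n.+1 / lam2 n.+1) : R -> R) 0.
      exact: is_derive_cst.
    apply: near_eq_is_derive dcst; near=> z; rewrite /= (kE n)//.
      by near: z; exact: interior_near.
    have : `|f1 n.+1 y - f1 n.+1 z| < `|f1 n.+1 y|.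
      by near: z; move/cvgrPdist_lt : cf; exact.
    by apply: contraTneq => ->; rewrite subr0 ltxx.
  have := @derive_val _ _ _ _ _ _ _ dky; rewrite (@derive_val _ _ _ _ _ _ _ (dk _ iy)).
  by move/eqP; rewrite (negbTE k'y).
have kcst : forall x y, interior_pt l r x -> interior_pt l r y -> k x = k y.
  by apply: derive0_cst => x ix; rewrite -(k'0 _ ix); exact: dk.
(* Each [phi n.+1] is non-constant: a constant one would be a multiple of [phi 0] and orthogonal to
   itself. *)
have crit n : exists2 y, interior_pt l r y & f1 n.+1 y != 0.
  apply: contrapT => none.
  have f10 y : interior_pt l r y -> f1 n.+1 y = 0.
    by move=> iy; apply: contrapT => /eqP fy; apply: none; exists y.
  have [y0 iy0] := interior_exists HI.
  have pc x : I x -> phi n.+1 x = phi n.+1 y0 * phi 0%N x.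
    move=> Ix; rewrite phi0// mulr1.
    apply: (within_eq_interior HI (cphi n.+1) (g := cst (phi n.+1 y0))) => //.
      by move=> ?; exact: cvg_cst.
    move=> z iz /=; apply: derive0_cst => // u iu; rewrite -(f10 _ iu); exact: dphi.
  have d0 : L2dot I q1 (phi n.+1) (phi 0%N) = phi n.+1 y0.
    transitivity (L2dot I q1 (fun x => phi n.+1 y0 * phi 0%N x) (phi 0%N)).
      by apply: eq_Rintegral => x /set_mem Ix; rewrite pc.
    rewrite dotZl//; [|exact: ob_L2 B _|exact: ob_L2 B _].
    by rewrite (ob_orthonormal B) mulr1.
  have : L2dot I q1 (phi n.+1) (phi n.+1) = 0.
    rewrite -[RHS](mul0r (L2dot I q1 (phi 0%N) (phi n.+1))).
    rewrite -dotZl//; [|exact: ob_L2 B _|exact: ob_L2 B _].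
    apply: eq_Rintegral => x /set_mem Ix; rewrite {1}pc// -d0.
    by rewrite (ob_orthonormal B).
  by rewrite (ob_orthonormal B) eqxx => /eqP; rewrite oner_eq0.
have kall n x : interior_pt l r x -> k x = lam1 n.+1 / lam2 n.+1.
  by move=> ix; have [y iy fy] := crit n; rewrite (kcst _ _ ix iy) (kE n).
pose c := lam2 1%N / lam1 1%N.
have c0 : 0 < c by rewrite /c nmulr_rgt0// invr_lt0.
have sE x : I x -> sigma1 x ^+ 2 = c^-1 * sigma2 x ^+ 2.
  move=> Ix.
  apply: (within_eq_interior HI (f := fun x => sigma1 x ^+ 2)
    (g := fun x => c^-1 * sigma2 x ^+ 2)) => // [y|y|z ix].
  - by under eq_fun do rewrite expr2; apply: cvgM; exact: cs1.
  - apply: cvgM; first exact: cvg_cst.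
    by under eq_fun do rewrite expr2; apply: cvgM; exact: cs2.
  - have s2x : sigma2 z != 0 by rewrite gt_eqF// s20//; exact: interior_state ix.
    rewrite (_ : c^-1 = k z); first by rewrite /k divfK// expf_neq0.
    by rewrite (kall 0%N)// /c invf_div.
exists c => //; split=> [n|x Ix].
  have [y iy fy] := crit 0%N.
  have := kall n _ iy; rewrite (kall 0%N)// => /eqP.
  have n1 m : lam1 m.+1 != 0 by rewrite lt_eqF.
  have n2 m : lam2 m.+1 != 0 by rewrite lt_eqF.
  by rewrite eqr_div// => /eqP H; rewrite /c mulrAC (mulrC _ (lam1 _)) -H mulrAC divff ?mul1r.
split; first exact: sE.
apply: (within_eq_interior HI (reg_drift_cont reg1) (g := fun x => c^-1 * mu2 x)) => // [|{Ix}x ix].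
  by move=> y; apply: cvgM; [exact: cvg_cst|exact: (reg_drift_cont reg2)].
have Ix := interior_state HI ix.
have d1 := reg_scale_derive HI reg1 ix.
have d2 := is_deriveZ c^-1 (reg_scale_derive HI reg2 ix).
(* [sigma1^2 q1 = c^-1 sigma2^2 q2] near [x]; the derivatives [2 mu q] of the two sides give the
   ratio of the drifts. *)
have d2' : is_derive x (1 : R) (fun y => sigma1 y ^+ 2 * q1 y) (c^-1 *: (2 * mu2 x * q2 x)).
  apply: near_eq_is_derive d2; near=> y.
  have Iy : I y by apply: interior_state HI _ _; near: y; exact: interior_near.
  by rewrite sE// q12// -mulrA.
have := @derive_val _ _ _ _ _ _ _ d1; rewrite (@derive_val _ _ _ _ _ _ _ d2').
rewrite -q12// /GRing.scale /= => E.
have q1x : q1 x != 0 by rewrite gt_eqF// q10.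
apply: (mulIf q1x); apply: (@mulfI _ 2); first by rewrite pnatr_eq0.
by rewrite mulrA -E; ring.
Unshelve. all: by end_near. Qed.

End two_diffusions.

(** * Laplace exponents *)

Section tonelli_restriction.
Local Open Scope ereal_scope.
Context {d1 d2 : measure_display} {T1 : measurableType d1} {T2 : measurableType d2} {R : realType}.
Variables (m1 : {sigma_finite_measure set T1 -> \bar R}) (m2 : {measure set T2 -> \bar R}).
Variables (D : set T2) (mD : measurable D).
Hypothesis sf : sigma_finite setT (mrestr m2 mD).

(** A name to which the sigma-finite structure of the restriction can be attached, [m2] itself being
    an arbitrary measure. The Levy measure is constrained on []0, +oo[] only, and this is the
    restriction to which Tonelli is applied. *)
Definition measure_restriction := mrestr m2 mD.
HB.instance Definition _ := Measure.on measure_restriction.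
HB.instance Definition _ := @Measure_isSigmaFinite.Build _ _ _ measure_restriction sf.
Lemma fubini_tonelli_restr (f : T1 * T2 -> \bar R) : measurable_fun [set: T1 * T2] f -> (forall z, 0 <= f z) ->
  (forall z, ~ D z.2 -> f z = 0) ->
  \int[m1]_x \int[m2]_(y in D) f (x, y) = \int[m2]_(y in D) \int[m1]_x f (x, y).
Proof.
move=> mf f0 fD.
have E g : (forall y, ~ D y -> g y = 0) -> \int[mrestr m2 mD]_y g y = \int[m2]_(y in D) g y.
  move=> gD; transitivity (\int[mrestr m2 mD]_(y in D) g y).
    rewrite [RHS]integral_mkcond; congr integral; apply/funext => y.
    by rewrite patchE; case: ifPn => // /negP nD; apply: gD => Dy; apply: nD; apply/mem_set.
  apply: eq_measure_integral => A mA AD; rewrite /= /mrestr; congr (m2 _).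
  by apply/seteqP; split=> [y []//|y Ay]; split=> //; exact: AD.
transitivity (\int[m1]_x \int[measure_restriction]_y f (x, y)).
  by apply: eq_integral => x _; rewrite -E// => y nD; exact: fD.
rewrite (fubini_tonelli (m2 := measure_restriction))// -E// => y nD.
by apply: integral0_eq => x _; exact: fD.
Qed.

End tonelli_restriction.

Section subordinator_law.
Context {R : realType} {d : measure_display} {O : measurableType d}.
Variables (P : probability O R) (T : R -> O -> R) (gamma : R).
Variable nu : {measure set R -> \bar R}.
Hypothesis HT : levy_subordinator P T gamma nu.

Notation phi := (laplace_exponent gamma nu).

Let mT t : 0 <= t -> measurable_fun setT (T t).
Proof. exact: (levy_meas (subordinator_levy HT)). Qed.

Let T0 t w : 0 <= t -> 0 <= T t w.
Proof. exact: (subordinator_ge0 HT). Qed.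

Lemma measurable_expR_subordinator lam t : 0 <= t ->
  measurable_fun setT (fun w => expR (- lam * T t w)).
Proof.
move=> t0; apply: (measurableT_comp (@measurable_expR R)).
by apply: measurable_funM; [exact: measurable_cst|exact: mT].
Qed.

Lemma expR_subordinator_le1 lam t w : 0 <= t -> 0 <= lam ->
  expR (- lam * T t w) <= 1.
Proof.
by move=> t0 l0; rewrite -(@expR0 R) ler_expR mulNr oppr_le0 mulr_ge0// T0.
Qed.

Lemma integrable_expR_subordinator lam t : 0 <= t -> 0 <= lam ->
  P.-integrable setT (EFin \o (fun w => expR (- lam * T t w))).
Proof.
move=> t0 l0; apply: (@bounded_integrable_prob _ _ _ _ _ 1).
  exact: measurable_expR_subordinator.
by move=> w; rewrite ger0_norm ?expR_ge0// expR_subordinator_le1.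
Qed.

Lemma Rintegral_expR_subordinator t lam : 0 <= t -> 0 <= lam ->
  \int[P]_w expR (- lam * T t w) = expR (- phi lam * t).
Proof. by move=> t0 l0; rewrite /Rintegral (subordinator_laplace HT). Qed.

(** Equality would make the nonnegative variable [exp(- a T_t) - exp(- b T_t)] have mean 0 for every
    [t], hence [T_t = 0] almost surely, which [subordinator_nonzero] excludes. *)
Lemma laplace_exponent_increasing a b : 0 <= a -> a < b -> phi a < phi b.
Proof.
move=> a0 ab; have b0 : 0 <= b by rewrite (le_trans a0)// ltW.
have ge t w : 0 <= t -> expR (- b * T t w) <= expR (- a * T t w).
  by move=> t0; rewrite ler_expR !mulNr lerN2 ler_wpM2r ?T0// ltW.
have le : phi a <= phi b.
  have : expR (- phi b * 1) <= expR (- phi a * 1).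
    rewrite -!Rintegral_expR_subordinator//; apply: le_Rintegral => //.
    - exact: integrable_expR_subordinator.
    - exact: integrable_expR_subordinator.
    - by move=> w _; exact: ge.
  by rewrite ler_expR !mulr1 lerN2.
rewrite lt_neqAle le andbT; apply/negP => /eqP E.
apply: (subordinator_nonzero HT) => t t0.
have ib := integrable_expR_subordinator t0 b0.
have ia := integrable_expR_subordinator t0 a0.
pose h w := expR (- a * T t w) - expR (- b * T t w).
have mh : measurable_fun setT h.
  by apply: measurable_funB; exact: measurable_expR_subordinator.
have h0 w : 0 <= h w by rewrite subr_ge0 ge.
have ih : P.-integrable setT (EFin \o h).
  rewrite (_ : EFin \o h = (fun w => (expR (- a * T t w))%:E - (expR (- b * T t w))%:E)%E)//.
  exact: integrableB.
have hE : (\int[P]_w `|(h w)%:E| = 0)%E.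
  under eq_integral do rewrite gee0_abs ?lee_fin//.
  have -> : (\int[P]_w (h w)%:E = (\int[P]_w h w)%:E)%E.
    by rewrite fineK//; exact: integrable_fin_num.
  by rewrite RintegralB// !Rintegral_expR_subordinator// E subrr.
have mhE : measurable_fun setT (EFin \o h) by exact/measurable_EFinP.
have /(_ hE) ae0 := (ae_eq_integral_abs P measurableT mhE).1.
have : {ae P, forall w, T t w = 0}.
  apply: ae_imp ae0 => w /(_ I) /= [] /eqP; rewrite subr_eq0 => /eqP /expR_inj /eqP.
  rewrite !mulNr eqr_opp -subr_eq0 -mulrBl mulf_eq0 subr_eq0 (lt_eqF ab)/=.
  by move/eqP.
have mS : measurable [set w | T t w = 0].
  rewrite (_ : [set _ | _] = T t @^-1` [set 0]); last by [].
  by rewrite -[X in measurable X]setTI; exact: mT.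
move=> [N [mN N0 sub]].
have PC : P (~` [set w | T t w = 0]) = 0%E.
  by apply: (subset_measure0 _ _ sub N0) => //; exact: measurableC.
by have := probability_setC P mS; rewrite PC => /eqP; rewrite eq_sym sube_eq ?fin_num_measure// add0e => /eqP <-.
Qed.

Lemma laplace_exponent0 : phi 0 = 0.
Proof.
rewrite /laplace_exponent mulr0 add0r.
transitivity (\int[nu]_(s in `]0%R, +oo[) (0 : R)); last by rewrite Rintegral_cst// mul0r.
by apply: eq_Rintegral => s _; rewrite oppr0 mul0r expR0 subrr.
Qed.

Lemma laplace_exponent_ge_drift a : 0 <= a -> gamma * a <= phi a.
Proof.
move=> a0; rewrite /laplace_exponent lerDl; apply: Rintegral_ge0 => s /=.
rewrite in_itv/= andbT => s0; rewrite subr_ge0 -(@expR0 R) ler_expR mulNr oppr_le0.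
by rewrite mulr_ge0// ltW.
Qed.

End subordinator_law.

(** The moments of [exp(-T_t)] are its Laplace transform at integers, fixed by [gamma] and [nu]. [P]
    and [Q] will be the laws attached to two starting points. *)
Lemma expectation_bern_subordinator {R : realType} {d : measure_display}
    {O : measurableType d} (P Q : probability O R) (T : R -> O -> R) (gamma : R)
    (nu : {measure set R -> \bar R}) (t : R) N k :
  levy_subordinator P T gamma nu -> levy_subordinator Q T gamma nu -> 0 <= t ->
  \int[P]_w bern N k (expR (- T t w)) = \int[Q]_w bern N k (expR (- T t w)).
Proof.
move=> HP HQ t0; have [p pE] := @bern_poly R N k.
have E (M : probability O R) : levy_subordinator M T gamma nu ->
    \int[M]_w bern N k (expR (- T t w)) =
    \sum_(i < size p) p`_i * expR (- laplace_exponent gamma nu i%:R * t).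
  move=> HM.
  transitivity (\int[M]_w (\sum_(i < size p) p`_i * expR (- i%:R * T t w))).
    apply: eq_Rintegral => w _; rewrite pE horner_coef; apply: eq_bigr => i _.
    by rewrite -expRM_natl mulrN mulNr.
  have ii (i : nat) := integrable_expR_subordinator HM t0 (ler0n R i).
  rewrite Rintegral_sumr//.
    by apply: eq_bigr => i _; rewrite RintegralZl// (Rintegral_expR_subordinator HM).
  by move=> i; apply: (integrableZl measurableT p`_i (ii i)).
by rewrite !E.
Qed.

(** * The Levy measure and the transform of its tail *)

Section levy_measure.
Context {R : realType} (gamma : R) (nu : {measure set R -> \bar R}).
Hypothesis nu_min : (\int[nu]_(s in `]0%R, +oo[) (Num.min s 1)%:E < +oo)%E.

Notation leb := (@lebesgue_measure R).
Let D : set R := `]0, +oo[%classic.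
Let mD : measurable D. Proof. exact: measurable_itv. Qed.

Let mmin : measurable_fun D (fun s : R => Num.min s 1).
Proof.
by apply: measurable_minr; [exact: measurable_id|exact: measurable_cst].
Qed.

Let min0 s : D s -> 0 <= Num.min s 1.
Proof. by rewrite /D/= in_itv/= andbT => /ltW s0; rewrite le_min s0 ler01. Qed.

Lemma levy_min_integrable : nu.-integrable D (EFin \o (fun s : R => Num.min s 1)).
Proof.
apply/integrableP; split; first exact/measurable_EFinP.
have -> : (\int[nu]_(s in D) `|(Num.min s 1)%:E| = \int[nu]_(s in D) (Num.min s 1)%:E)%E.
  by apply: eq_integral => s /set_mem Ds; rewrite gee0_abs// lee_fin min0.
exact: nu_min.
Qed.

(** Markov's inequality for [min(x, 1)], which is at least [min(s, 1)] on the tail. *)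
Lemma levy_tail_lty (s : R) : 0 < s -> (levy_tail nu s < +oo)%E.
Proof.
move=> s0; set m := Num.min s 1; have m0 : 0 < m by rewrite lt_min s0 ltr01.
have mA : measurable (`]s, +oo[%classic : set R) by exact: measurable_itv.
have AD : `]s, +oo[%classic `<=` D.
  by move=> x; rewrite /D/= !in_itv/= !andbT; exact: lt_trans.
have : (m%:E * nu `]s, +oo[%classic < +oo)%E.
  apply: le_lt_trans nu_min.
  rewrite -(integral_cst nu mA m%:E).
  apply: le_trans (_ : \int[nu]_(x in `]s, +oo[%classic) (Num.min x 1)%:E <= _)%E.
    apply: ge0_le_integral => //=.
    - by move=> *; rewrite lee_fin ltW.
    - by apply/measurable_EFinP; apply: measurable_funS mmin.
    - move=> x; rewrite in_itv/= andbT => sx; rewrite lee_fin /m.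
      by rewrite le_min ge_min (ltW sx) /= ge_min lexx orbT.
  apply: ge0_subset_integral => //=.
  exact/measurable_EFinP.
rewrite /levy_tail; case: (nu _) => [x _|+|//]; first exact: ltry.
by rewrite mulry gtr0_sg// mul1e.
Qed.

(** For small [s] from [1 - exp(- a s) <= a s], for large [s] from [1 - exp(- a s) <= 1]; the factor
    [1 + a] covers both. *)
Lemma levy_exp_bound (a s : R) : 0 <= a -> D s ->
  0 <= 1 - expR (- a * s) <= (1 + a) * Num.min s 1.
Proof.
rewrite /D/= in_itv/= andbT => a0 s0.
have e1 : expR (- a * s) <= 1 by rewrite -(@expR0 R) ler_expR mulNr oppr_le0 mulr_ge0// ltW.
rewrite subr_ge0 e1/= /Num.min; have := expR_ge1Dx (- a * s); have := expR_ge0 (- a * s).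
by case: ifPn => [s1|]; [nra|nra].
Qed.

Lemma levy_exp_measurable (a : R) : measurable_fun D (fun s : R => 1 - expR (- a * s)).
Proof.
apply: measurable_funB; first exact: measurable_cst.
apply: (measurableT_comp (@measurable_expR R)).
by apply: measurable_funM; [exact: measurable_cst|exact: measurable_id].
Qed.

Lemma levy_exp_integrable (a : R) : 0 <= a ->
  nu.-integrable D (EFin \o (fun s : R => 1 - expR (- a * s))).
Proof.
move=> a0; have := integrableZl mD (1 + a) levy_min_integrable.
apply: le_integrable => //; first by apply/measurable_EFinP; exact: levy_exp_measurable.
move=> s Ds; have /andP[h0 h1] := levy_exp_bound a0 Ds.
by rewrite /comp -EFinM !abse_EFin lee_fin ger0_norm// (le_trans h1)// ler_norm.
Qed.

Let nuD := mrestr nu mD.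

Let nuD_sigma_finite : sigma_finite setT nuD.
Proof.
(* The restricted measure ignores the closed half-line, and each tail beyond [1/(n+1)] has finite
   mass. *)
exists (fun n => `]-oo, 0] `|` `]n.+1%:R^-1, +oo[).
  apply/seteqP; split=> // x _.
  have [x0|x0] := leP x 0; first by exists 0%N => //; left; rewrite /= in_itv.
  have [n nx] : exists n, n.+1%:R^-1 < x.
    exists (Num.truncn x^-1); rewrite -[ltRHS]invrK ltf_pV2 ?posrE ?invr_gt0//.
    exact: truncnS_gt.
  by exists n => //; right; rewrite /= in_itv/= nx.
move=> n; split; first by apply: measurableU; exact: measurable_itv.
rewrite /nuD /mrestr.
apply: le_lt_trans (@levy_tail_lty n.+1%:R^-1 _); last by rewrite invr_gt0.
have mB : measurable (`]n.+1%:R^-1, +oo[%classic : set R) by exact: measurable_itv.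
apply: le_measure; try exact/mem_set.
  by apply/mem_set; apply: measurableI => //; apply: measurableU; exact: measurable_itv.
by move=> x [[]//= +]; rewrite /D/= !in_itv/= andbT => /le_lt_trans h /h; rewrite ltxx.
Qed.

(** Tonelli on the region [0 < x < s] for [exp(- a x) dx nu(ds)]: integrating [s] first gives the
    tail, integrating [x] first gives [(1 - exp(- a s)) / a]. *)
Lemma levy_tail_transformE (a : R) : 0 < a ->
  levy_tail_transform nu a =
  (a^-1 * \int[nu]_(s in `]0%R, +oo[) (1 - expR (- a * s)))%:E.
Proof.
move=> a0.
pose f (z : R * R) : \bar R := (expR (- a * z.1) * \1_[set z | 0 < z.1 < z.2] z)%:E.
have mS : measurable [set z : R * R | 0 < z.1 < z.2].
  have h1 : measurable_fun setT (fun z : R * R => 0 < z.1).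
    by apply: measurable_fun_ltr; [exact: measurable_cst|exact: measurable_fst].
  have h2 : measurable_fun setT (fun z : R * R => z.1 < z.2).
    by apply: measurable_fun_ltr; [exact: measurable_fst|exact: measurable_snd].
  have := measurable_and h1 h2 measurableT (Y := [set true]) I.
  by rewrite setTI; congr measurable; apply/seteqP; split=> z /=.
have mf : measurable_fun setT f.
  apply/measurable_EFinP; apply: measurable_funM; last exact: measurable_indic.
  apply: (measurableT_comp (@measurable_expR R)).
  by apply: measurable_funM; [exact: measurable_cst|exact: measurable_fst].
have f0 z : (0 <= f z)%E by rewrite lee_fin mulr_ge0 ?expR_ge0.
have fD z : ~ D z.2 -> f z = 0%E.
  move=> nD; rewrite /f indicE memNset ?mulr0// => /andP[z1 z2]; apply: nD.
  by rewrite /D/= in_itv/= (lt_trans z1 z2).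
transitivity (\int[leb]_x \int[nu]_(y in D) f (x, y))%E.
  rewrite /levy_tail_transform integral_mkcond; apply: eq_integral => x _.
  rewrite patchE; case: ifPn => [/set_mem|x0].
    rewrite /= in_itv/= andbT => x0.
    under eq_integral do rewrite /f/= EFinM.
    have -> : (levy_tail nu x = \int[nu]_(y in D) (\1_`]x, +oo[%classic y)%:E)%E.
      have mx : measurable (`]x, +oo[%classic : set R) by exact: measurable_itv.
      rewrite integral_indic//.
      rewrite /levy_tail; congr (nu _).
      apply/seteqP; split=> y /=; rewrite /D /= !in_itv/= !andbT; last by case.
      by move=> xy; split=> //; exact: lt_trans xy.
    rewrite -ge0_integralZl//.
    - apply: eq_integral => y _; congr (_ * _%:E)%E.
      rewrite [LHS]indicE [RHS]indicE.
      have [xy|yx] := ltP x y.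
        by rewrite !mem_set//= ?in_itv/= ?x0 ?xy.
      by rewrite !memNset//= ?in_itv/= ?andbT ?x0/= ltNge yx.
    - apply/measurable_EFinP; apply: measurable_indic; exact: measurable_itv.
  rewrite integral0_eq// => y _; rewrite /f/= indicE memNset ?mulr0//= => /andP[x1 _].
  by move: x0; rewrite notin_setE/= in_itv/= x1.
rewrite (fubini_tonelli_restr leb nuD_sigma_finite mf f0 fD).
have inner y : D y -> (\int[leb]_x f (x, y) = (a^-1 * (1 - expR (- a * y)))%:E)%E.
  rewrite /D/= in_itv/= andbT => y0.
  have mexp (A : set R) : measurable_fun A (fun x : R => (expR (- a * x))%:E).
    apply/measurable_EFinP; apply: measurable_funTS.
    apply: (measurableT_comp (@measurable_expR R)).
    by apply: measurable_funM; [exact: measurable_cst|exact: measurable_id].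
  transitivity (\int[leb]_(x in `]0%R, y[) (expR (- a * x))%:E)%E.
    rewrite [RHS]integral_mkcond; apply: eq_integral => x _; rewrite patchE /f/= indicE.
    case: ifPn => [/set_mem/=|/negP nx].
      by rewrite in_itv/= => xy; rewrite mem_set ?mulr1.
    by rewrite memNset ?mulr0//= => xy; apply: nx; apply/mem_set; rewrite /= in_itv.
  rewrite integral_itv_bndo_bndc// integral_itv_obnd_cbnd//.
  have dexp x : is_derive x (1 : R) (fun x : R => expR (- a * x)) (expR (- a * x) * - a).
    have d1 : is_derive x (1 : R) (fun x : R => - a * x) (- a).
      have := is_deriveZ (- a) (is_derive_id x (1 : R)).
      by rewrite /GRing.scale /= mulr1.
    exact: is_derive1_comp (is_derive_expR (- a * x)) d1.
  have dE x : is_derive x (1 : R) (fun x : R => - a^-1 * expR (- a * x)) (expR (- a * x)).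
    have := is_deriveZ (- a^-1) (dexp x).
    have -> // : - a^-1 *: (expR (- a * x) * - a) = expR (- a * x).
    by rewrite /GRing.scale /= mulrN mulrNN mulrCA mulVf ?mulr1// gt_eqF.
  have cE (g : R -> R) x : (forall x, derivable g x 1) -> g z @[z --> x] --> g x.
    by move=> dg; apply: differentiable_continuous; apply/derivable1_diffP.
  have dF x : derivable (fun x : R => - a^-1 * expR (- a * x)) x 1 by case: (dE x).
  rewrite (@continuous_FTC2 _ _ (fun x => - a^-1 * expR (- a * x)))//.
  - rewrite -EFinB mulr0 expR0 mulr1 mulNr opprK; congr EFin; ring.
  - apply: continuous_subspaceT => x; apply: cE => z; by case: (dexp z).
  - split=> [x _||]; first exact: dF.
    + by apply: cvg_at_right_filter; exact: cE.
    + by apply: cvg_at_left_filter; exact: cE.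
  - by move=> x _; rewrite derive1E; exact: derive_val.
transitivity (\int[nu]_(y in D) ((a^-1)%:E * (1 - expR (- a * y))%:E))%E.
  by apply: eq_integral => y /set_mem Dy; rewrite inner// EFinM.
have ia := levy_exp_integrable (ltW a0).
rewrite integralZl// /Rintegral EFinM fineK//.
exact: integrable_fin_num ia.
Qed.

Lemma laplace_exponent_tail (a : R) : 0 < a ->
  levy_tail_transform nu a \is a fin_num /\
  laplace_exponent gamma nu a = a * (gamma + fine (levy_tail_transform nu a)).
Proof.
move=> a0; rewrite levy_tail_transformE//; split => //=.
by rewrite /laplace_exponent mulrDr mulrA divff ?gt_eqF// mul1r mulrC.
Qed.

(** Dominated convergence: the integrand [(1 - exp(- a_n s)) / a_n] is at most
    [(1/a_n + 1) min(s, 1)], and the lower bound [a0] makes this uniform in [n]. *)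
Lemma levy_tail_transform_cvg0 (a : nat -> R) a0 : 0 < a0 -> (forall n, a0 <= a n) ->
  a n @[n --> \oo] --> +oo ->
  fine (levy_tail_transform nu (a n)) @[n --> \oo] --> 0.
Proof.
move=> a00 aa0 ainf.
have apos n : 0 < a n by exact: lt_le_trans (aa0 n).
have [] := @dominated_Rintegral _ _ _ nu D mD (fun n s => (a n)^-1 * (1 - expR (- a n * s)))
   (cst 0) (fun s => (a0^-1 + 1) * Num.min s 1).
- by move=> n; apply: measurable_funM; [exact: measurable_cst|exact: levy_exp_measurable].
- move=> s Ds; have ia : (a n)^-1 @[n --> \oo] --> 0.
    by apply/gtr0_cvgV0 => //; exact: nearW.
  apply/norm_cvg0P.
  apply: (@squeeze_cvgr _ _ _ _ (cst 0) (fun n => (a n)^-1)) => //; last exact: cvg_cst.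
  apply: nearW => n; have /andP[h0 h1] := levy_exp_bound (ltW (apos n)) Ds.
  have a1 : 0 <= (a n)^-1 by rewrite invr_ge0 ltW.
  rewrite normr_ge0/= ger0_norm ?mulr_ge0//.
  by rewrite ler_piMr// lerBlDr lerDl expR_ge0.
- exact: (integrableZl mD (a0^-1 + 1) levy_min_integrable).
- move=> n s Ds; have /andP[h0 h1] := levy_exp_bound (ltW (apos n)) Ds.
  have a1 : 0 <= (a n)^-1 by rewrite invr_ge0 ltW.
  rewrite ger0_norm ?mulr_ge0//.
  apply: le_trans (ler_wpM2l a1 h1) _; rewrite mulrA ler_wpM2r ?min0//.
  by rewrite mulrDr mulr1 mulVf ?gt_eqF// lerD2r lef_pV2 ?posrE.
move=> _; rewrite Rintegral_cst// mul0r => H.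
have : (fun n => fine (levy_tail_transform nu (a n))) =
    (fun n => \int[nu]_(s in D) ((a n)^-1 * (1 - expR (- a n * s)))).
  apply/funext => n; rewrite levy_tail_transformE//= RintegralZl//.
  by apply: levy_exp_integrable; exact: ltW.
by move=> ->.
Qed.

End levy_measure.

(** * Spectral data of a subordinate diffusion *)

Section bounded_independence.
Context {d : measure_display} {O : measurableType d} {R : realType}.
Variables (P : probability O R) (X T : O -> R).
Hypotheses (mX : measurable_fun setT X) (mT : measurable_fun setT T).
Local Open Scope ereal_scope.
Hypothesis XT : forall A B, measurable A -> measurable B ->
  P (X @^-1` A `&` T @^-1` B) = P (X @^-1` A) * P (T @^-1` B).

(** Adding [M] makes [f] nonnegative; the product formula for [f + M] is then reduced by [M] times
    the mean of [g(T)]. *)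
Lemma independent_bounded_expectation (f g : R -> R) (M K : R) :
  measurable_fun setT f -> measurable_fun setT g ->
  (forall x, `|f x| <= M)%R -> (forall x, 0 <= g x <= K)%R ->
  (\int[P]_w (f (X w) * g (T w)) = \int[P]_w f (X w) * \int[P]_w g (T w))%R.
Proof.
move=> mf mg fM gK.
have mfX : measurable_fun setT (f \o X) by exact: measurableT_comp.
have mgT : measurable_fun setT (g \o T) by exact: measurableT_comp.
have g0 x : (0 <= g x)%R by case/andP: (gK x).
have iX : P.-integrable setT (EFin \o (f \o X)).
  by apply: (@bounded_integrable_prob _ _ _ P (f \o X) M mfX) => w; exact: fM.
have iT : P.-integrable setT (EFin \o (g \o T)).
  by apply: (@bounded_integrable_prob _ _ _ P (g \o T) K mgT) => w; rewrite ger0_norm//=; case/andP: (gK (T w)).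
have iXT : P.-integrable setT (EFin \o (fun w => f (X w) * g (T w))%R).
  apply: (@bounded_integrable_prob _ _ _ P (fun w => f (X w) * g (T w))%R (M * K)%R).
    exact: measurable_funM.
  move=> w; rewrite normrM ler_pM// ger0_norm//; by case/andP: (gK (T w)).
pose c := (\int[P]_w g (T w))%R.
have cE : \int[P]_w (g (T w))%:E = c%:E by rewrite fineK//; exact: integrable_fin_num iT.
have h0 x : 0 <= (f x + M)%:E.
  by rewrite lee_fin -lerBlDr sub0r; have := fM x; rewrite ler_norml => /andP[].
have mh : measurable_fun setT (fun x => (f x + M)%:E).
  by apply/measurable_EFinP; apply: measurable_funD => //; exact: measurable_cst.
have := independent_ge0_expectation mX mT XT mh mg h0 g0 cE.
have iM : P.-integrable setT (EFin \o cst M) by exact: finite_measure_integrable_cst.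
have iXM : P.-integrable setT (EFin \o (fun w => f (X w) + M)%R).
  exact: (integrableD measurableT iX iM).
have iMT : P.-integrable setT (EFin \o (fun w => M * g (T w))%R).
  exact: (integrableZl measurableT M iT).
have E1 : fine (P [set: O]) = 1%R := congr1 fine (probability_setT P).
have -> : \int[P]_w (f (X w) + M)%:E = ((\int[P]_w f (X w))%R + M)%:E.
  rewrite -[LHS]fineK; last exact: integrable_fin_num iXM.
  by congr EFin; rewrite -[LHS]/(\int[P]_w (f (X w) + M))%R RintegralD// Rintegral_cst// E1 mulr1.
have -> : \int[P]_w ((g (T w))%:E * (f (X w) + M)%:E) =
    ((\int[P]_w (f (X w) * g (T w)))%R + M * c)%:E.
  have iS : P.-integrable setT (EFin \o (fun w => f (X w) * g (T w) + M * g (T w))%R).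
    exact: (integrableD measurableT iXT iMT).
  transitivity (\int[P]_w (f (X w) * g (T w) + M * g (T w))%:E).
    by apply: eq_integral => w _; rewrite -EFinM; congr EFin; ring.
  rewrite -[LHS]fineK; last exact: integrable_fin_num iS.
  by congr EFin; rewrite -[LHS]/(\int[P]_w (f (X w) * g (T w) + M * g (T w)))%R RintegralD// RintegralZl.
by move=> [E]; rewrite -/c; lra.
Qed.

End bounded_independence.

Section spectral_data.
Context {R : realType} {d : measure_display} {O : measurableType d}.
Variables (l r : \bar R) (I : set R) (Y : subordinate_data R O).
Variables (lam : nat -> R) (phi : nat -> R -> R).
Hypothesis HI : interval_with_endpoints l r I.
Hypothesis HY : subordinate_diffusion l r I Y.
Hypothesis ES : sd_eigensystem I Y lam phi.
Local Notation leb := (@lebesgue_measure R).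
Local Notation mu := (sd_mu Y).
Local Notation sigma := (sd_sigma Y).
Local Notation q := (sd_q I Y).
Local Notation Px := (sd_prob Y).
Local Notation X := (sd_diffusion Y).
Local Notation T := (sd_subordinator Y).
Local Notation S := (semigroup Px X).
Local Notation dot := (L2dot I q).
Local Notation L2 := (L2 I q).

Let A1 := sd_assumption1 HY.

Lemma sd_markov : markov_process I Px X.
Proof. exact: (sd_is_diffusion HY).1. Qed.

(** The speed mass is nonzero: otherwise division by 0 would make [q] identically 0, against [phi 0]
    having norm 1. *)
Lemma sd_regular : regular_coefficients l r I mu sigma.
Proof.
split; [exact: A1_drift A1|exact: A1_diffusion A1|exact: A1_nondegenerate A1|exact: speed_finite A1|].
apply/eqP => Z0; have := eigen_orthonormal ES 0 0.
rewrite eqxx /L2dot.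
under eq_Rintegral do rewrite /sd_q /stationary_density Z0 invr0 !mulr0.
by rewrite Rintegral_cst ?mul0r; [move/eqP; rewrite eq_sym oner_eq0|exact: measurable_state HI].
Qed.

Let mI := measurable_state HI.
Let mI' : measurable (I : set (measurableTypeR R)) := mI.

Lemma sd_q_gt0 x : I x -> 0 < q x.
Proof. by move=> Ix; rewrite /sd_q; exact: (reg_q_gt0 sd_regular). Qed.

Lemma sd_q_continuous : {within I, continuous q}.
Proof. exact: (reg_q_cont HI sd_regular). Qed.

Lemma sd_q_integrable : leb.-integrable I (EFin \o q).
Proof. exact: (reg_q_integrable HI sd_regular). Qed.

Lemma sd_q_measurable : measurable_fun I q.
Proof. by apply: subspace_continuous_measurable_fun => //; exact: sd_q_continuous. Qed.

Let mq := sd_q_measurable.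
Let q0 := sd_q_gt0.

Lemma sd_invariant (t : R) (A : set R) : 0 <= t -> measurable A -> A `<=` I ->
  (\int[leb]_(x in I) (Px x (X t @^-1` A) * (q x)%:E) =
   \int[leb]_(x in A) (q x)%:E)%E.
Proof. exact: (A1_ergodic A1).1. Qed.

Lemma sd_orthobasis : orthobasis I q phi.
Proof.
by split=> [n||]; [case: (eigenfunctionP ES n)|exact: eigen_orthonormal ES|exact: eigen_basis ES].
Qed.

Lemma eigenfunction_measurable n : measurable_fun I (phi n).
Proof. exact: (ob_L2 sd_orthobasis n).1. Qed.

Lemma eigenvalue_lt0 n : lam n.+1 < 0.
Proof.
elim: n => [|n ih]; first by rewrite -(eigenvalue0 ES) (eigenvalue_decr ES).
exact: lt_trans (eigenvalue_decr ES _) ih.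
Qed.

Lemma eigenvalue_le0 n : lam n <= 0.
Proof. by case: n => [|n]; [rewrite (eigenvalue0 ES)|exact/ltW/eigenvalue_lt0]. Qed.

Lemma sd_semigroup_L2 (t : R) f : 0 <= t -> L2 f -> L2 (S t f).
Proof. exact: semigroup_L2 mI mq q0 sd_markov sd_invariant _ _. Qed.

Lemma sd_semigroup_contraction (t : R) f : 0 <= t -> L2 f -> dot (S t f) (S t f) <= dot f f.
Proof. exact: semigroup_contraction mI mq q0 sd_markov sd_invariant _ _. Qed.

Lemma sd_semigroup_lin (t c : R) f g : 0 <= t -> L2 f -> L2 g ->
  {ae leb, forall x, I x -> S t (fun y => c * f y + g y) x = c * S t f x + S t g x}.
Proof. exact: semigroup_lin mI mq q0 sd_markov sd_invariant _ _ _ _. Qed.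

(** Kept general in [c] and [f] so that it also applies to the eigenfunctions of another diffusion
    with proportional coefficients. *)
Lemma generator_semigroup c f : c <= 0 ->
  L2_generator I q Px X f (fun x => c * f x) -> forall s : R, 0 <= s ->
  {ae leb, forall x, I x -> S s f x = expR (c * s) * f x}.
Proof.
move=> c0 [Lf _ gen].
apply: (generator_eigen_semigroup mI mq q0 sd_semigroup_L2 sd_semigroup_contraction
  sd_semigroup_lin _ _ c0 Lf gen).
- by move=> g Lg; apply: aeW => x Ix; exact: semigroup0 mI sd_markov _ _ Ix Lg.1.
- exact: semigroup_add mI mq q0 sd_markov sd_invariant.
Qed.

Lemma sd_semigroup_eigen n (s : R) : 0 <= s ->
  {ae leb, forall x, I x -> S s (phi n) x = expR (lam n * s) * phi n x}.
Proof. by apply: generator_semigroup; [exact: eigenvalue_le0|exact: eigenfunctionP ES n]. Qed.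

Lemma sd_semigroup_coef n (s : R) f : 0 <= s -> L2 f ->
  dot (S s f) (phi n) = expR (lam n * s) * dot f (phi n).
Proof.
move=> s0 Lf.
exact: (contraction_coef mI mq q0 sd_orthobasis (fun f => sd_semigroup_L2 s0)
  (fun f => sd_semigroup_contraction s0) (fun c f g => sd_semigroup_lin c s0)
  (fun n => sd_semigroup_eigen n s0)).
Qed.

Lemma sd_semigroup_spectral (s : R) f g : 0 <= s -> L2 f -> L2 g ->
  (\sum_(n < N) expR (lam n * s) * (dot f (phi n) * dot g (phi n))) @[N --> \oo] -->
  dot (S s f) g.
Proof.
move=> s0 Lf Lg.
exact: (contraction_spectral mI mq q0 sd_orthobasis (fun f => sd_semigroup_L2 s0)
  (fun f => sd_semigroup_contraction s0) (fun c f g => sd_semigroup_lin c s0)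
  (fun n => sd_semigroup_eigen n s0)).
Qed.

(* A finite limit of the eigenvalues would be a non-isolated point of the spectrum. *)
Lemma eigenvalue_cvg : - lam n @[n --> \oo] --> +oo.
Proof.
have nd : {homo lam : n m / (n <= m)%N >-> m <= n}.
  by apply/nonincreasing_seqP => n; exact/ltW/(eigenvalue_decr ES).
apply/cvgryPge => A; apply: contrapT => nA.
have lb n : - A < lam n.
  rewrite ltNge; apply/negP => nl; apply: nA; exists n => // m /= nm.
  by rewrite lerNr (le_trans (nd _ _ nm)).
have hlb : has_lbound (range lam).
  by exists (- A) => _ [n _ <-]; exact: ltW.
have cL := nonincreasing_cvgn nd hlb; set L := inf _ in cL.
have Llt n : L < lam n.
  apply: le_lt_trans (eigenvalue_decr ES n).
  by apply: ge_inf => //; exists n.+1.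
have G n : L2_generator I q Px X (phi n) (fun x => lam n * phi n x) by exact: eigenfunctionP ES n.
have n1 n : L2norm_sq I q (phi n) = 1%E.
  rewrite (L2norm_sqE mI mq q0); last exact: ob_L2 sd_orthobasis n.
  by rewrite (ob_orthonormal sd_orthobasis) eqxx.
have nZ n a : L2norm_sq I q (fun x => lam n * phi n x - a * phi n x) = ((lam n - a) ^+ 2)%:E.
  have Lp := ob_L2 sd_orthobasis n.
  rewrite (_ : (fun x => _) = (fun x => (lam n - a) * phi n x)); last first.
    by apply/funext => x; rewrite mulrBl.
  rewrite (L2norm_sqE mI mq q0); last exact: L2Z.
  rewrite dotZl//; last exact: L2Z.
  by rewrite dotZr// (ob_orthonormal sd_orthobasis) eqxx mulr1 expr2.
have inspec n : in_spectrum I q (L2_generator I q Px X) (lam n).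
  move=> [[C C0 H] _]; have := H _ _ (G n); rewrite n1 nZ subrr expr0n/= mule0.
  by rewrite lee_fin ler10.
(* The unit vectors [phi n] form a Weyl sequence at [L]: a resolvent bound would give
   [1 <= C (lam n - L)^2], whose right side tends to 0. *)
have inL : in_spectrum I q (L2_generator I q Px X) L.
  move=> [[C C0 H] _].
  have : (C * (lam n - L) ^+ 2) @[n --> \oo] --> C * (L - L) ^+ 2.
    apply: cvgM; first exact: cvg_cst.
    by rewrite expr2; under eq_fun do rewrite expr2; apply: cvgM; apply: cvgB => //; exact: cvg_cst.
  rewrite subrr expr0n/= mulr0 => /cvgrPdist_lt/(_ 1 ltr01)[N _ /(_ N (leqnn N))]/=.
  rewrite sub0r normrN ger0_norm; last by rewrite mulr_ge0 ?sqr_ge0// ltW.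
  have := H _ _ (G N); rewrite n1 nZ -EFinM lee_fin => h1 /(le_lt_trans h1).
  by rewrite ltxx.
have [_ [e e0 iso]] := A1_spectrum A1 inL.
move/cvgrPdist_lt : cL => /(_ e e0)[N _ /(_ N (leqnn N))]/=; rewrite distrC => h.
by have := Llt N; rewrite (iso _ (inspec N) h) ltxx.
Qed.

Lemma independent_times (s t x : R) (A B : set R) : I x -> 0 <= s -> 0 <= t ->
  measurable A -> measurable B ->
  (Px x (X s @^-1` A `&` T t @^-1` B) = Px x (X s @^-1` A) * Px x (T t @^-1` B))%E.
Proof.
move=> Ix s0 t0 mA mB.
have C1 (Z : R -> O -> R) (u : R) (D : set R) : cylinder Z 1 (fun=> u) (fun=> D) = Z u @^-1` D.
  by rewrite /cylinder bigcap_mkord big_ord1.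
have := @sd_independent _ _ _ _ _ _ _ HY x Ix 1%N 1%N (fun=> s) (fun=> t) (fun=> A) (fun=> B).
by rewrite !C1; apply.
Qed.

Variables (f : R -> R) (M : R).
Hypotheses (cf : {within I, continuous f}) (fM : forall x, I x -> `|f x| <= M).

Let mf : measurable_fun I f.
Proof. exact: subspace_continuous_measurable_fun. Qed.

Let Lf : L2 f.
Proof. exact: (bounded_L2 mI mq q0 sd_q_integrable mf fM). Qed.

Let fX (s : R) w := f (X s w).

Let mfX (s : R) : 0 <= s -> measurable_fun setT (fX s).
Proof. by move=> s0; exact: (measurable_path_comp mI sd_markov). Qed.

Let fXM (s : R) w : 0 <= s -> `|fX s w| <= M.
Proof. by move=> s0; apply: fM; exact: (markov_state sd_markov). Qed.

Let cfX w : {within `[0, +oo[, continuous (fX^~ w)}.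
Proof.
apply/subspace_continuousP => s s0.
have XI (u : R) : `[0, +oo[%classic u -> I (X u w).
  by rewrite /= in_itv/= andbT; exact: (markov_state sd_markov).
have cXw := @markov_continuous_paths _ _ _ _ _ _ sd_markov w.
have /subspace_continuousP/(_ _ s0) cX := cXw.
have /subspace_continuousP/(_ _ (XI _ s0)) cfs := cf.
apply: cvg_trans cfs => B nB; rewrite /nbhs/=.
have := cX _ nB; rewrite /nbhs/= /within/= => -[e e0 H]; exists e => // u ue u0.
exact: H ue u0 (XI _ u0).
Qed.

Definition sd_mean (t : R) x := \int[Px x]_w f (sd_process Y t w).

Definition bern_mean (t x : R) N k := \int[Px x]_w bern N k (expR (- T t w)).

Let mT (t x : R) : I x -> 0 <= t -> measurable_fun setT (T t).
Proof. by move=> Ix; exact: (levy_meas (subordinator_levy (sd_is_subordinator HY Ix))). Qed.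

Let T0 (t x : R) w : I x -> 0 <= t -> 0 <= T t w.
Proof. by move=> Ix; exact: (subordinator_ge0 (sd_is_subordinator HY Ix)). Qed.

(** With weights that do not vary with the starting point, a mixture is one fixed linear combination
    of the functions [S s f], so that measurability and L^2 coefficients can be computed term by
    term. *)
Lemma bern_mean_cst (t x y : R) N k : I x -> I y -> 0 <= t ->
  bern_mean t x N k = bern_mean t y N k.
Proof.
move=> Ix Iy t0.
exact: expectation_bern_subordinator (sd_is_subordinator HY Ix) (sd_is_subordinator HY Iy) t0.
Qed.

Let ibern (t x : R) N k : I x -> 0 <= t ->
  (Px x).-integrable setT (EFin \o (fun w => bern N k (expR (- T t w)))).
Proof.
move=> Ix t0; apply: (@bounded_integrable_prob _ _ _ _ _ 1).
  exact: (measurable_bern_time (mT Ix t0)).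
move=> w; have /andP[h0 h1] := bern_time_bound (T := T t) (fun w => T0 w Ix t0) N k w.
by rewrite ger0_norm.
Qed.

Lemma bern_mean_ge0 (t x : R) N k : I x -> 0 <= t -> 0 <= bern_mean t x N k.
Proof.
move=> Ix t0; apply: Rintegral_ge0 => w _.
by have /andP[] := bern_time_bound (T := T t) (fun w => T0 w Ix t0) N k w.
Qed.

Lemma bern_mean_sum1 (t x : R) N : I x -> 0 <= t -> \sum_(k < N.+1) bern_mean t x N k = 1.
Proof.
move=> Ix t0; rewrite -Rintegral_sumr//; last by move=> k; exact: ibern.
under eq_Rintegral do rewrite bern_sum1.
have E1 : fine (Px x [set: O]) = 1 := congr1 fine (probability_setT (Px x)).
by rewrite Rintegral_cst// E1 mulr1.
Qed.

Lemma sd_mean_cvg (t x : R) : I x -> 0 <= t ->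
  bern_mix (fun s => S s f x) (bern_mean t x) N @[N --> \oo] --> sd_mean t x.
Proof.
move=> Ix t0.
have := @expectation_at_random_time _ _ _ (Px x) fX (T t) M (mT Ix t0) (fun w => T0 w Ix t0)
  mfX fXM cfX.
apply=> s N k s0.
(* The absolute value keeps [exp(-|u|)] in [[0, 1]] for every real [u], so that [g] is bounded on
   the whole line; along the subordinator it changes nothing. *)
pose g (u : R) := bern N k (expR (- `|u|)).
have mg : measurable_fun setT g by exact: (measurable_bern_time (@normr_measurable R setT)).
have g01 u : 0 <= g u <= 1 by exact: (bern_time_bound (T := fun u : R => `|u|) (fun u => normr_ge0 u)).
have M0 : 0 <= M by rewrite (le_trans _ (fM Ix)).
have mfI : measurable_fun setT (f \_ I) by apply/(measurable_restrictT _ _).1.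
have fIM y : `|(f \_ I) y| <= M.
  by rewrite patchE; case: ifPn => [/set_mem/fM//|_]; rewrite normr0.
have E w : fX s w = (f \_ I) (X s w).
  by rewrite patchE mem_set//; exact: (markov_state sd_markov).
have gE w : bern N k (expR (- T t w)) = g (T t w) by rewrite /g ger0_norm// (T0 w Ix t0).
under eq_Rintegral do rewrite E gE.
under [in RHS]eq_Rintegral do rewrite E.
under [X in _ = _ * X]eq_Rintegral do rewrite gE.
apply: (independent_bounded_expectation _ _ _ mfI mg fIM g01).
- exact: (markov_meas sd_markov).
- exact: mT Ix t0.
- by move=> A B mA mB; exact: independent_times.
Qed.

Lemma measurable_path_at_subordinator (t x : R) : I x -> 0 <= t ->
  measurable_fun setT (fun w => f (sd_process Y t w)).
Proof.
move=> Ix t0.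
exact: (measurable_at_random_time (mT Ix t0) (fun w => T0 w Ix t0) mfX fXM cfX).
Qed.

Lemma sd_mean_norm_le (t x : R) : I x -> 0 <= t -> `|sd_mean t x| <= M.
Proof.
move=> Ix t0.
have fYM w : `|f (sd_process Y t w)| <= M by apply: fXM; exact: (T0 w Ix t0).
have mfY := measurable_path_at_subordinator Ix t0.
apply: (le_trans (le_normr_Rintegral _ _)) => //.
  exact: (@bounded_integrable_prob _ _ _ (Px x) _ M mfY fYM).
have E1 : fine (Px x [set: O]) = 1 := congr1 fine (probability_setT (Px x)).
rewrite -[M]mulr1 -E1 -Rintegral_cst//; apply: le_Rintegral => //.
- apply: (@bounded_integrable_prob _ _ _ _ _ M); first exact: measurableT_comp.
  by move=> w; rewrite normr_id.
- exact: finite_measure_integrable_cst.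
Qed.

(** The random-time limit for the deterministic process [s |-> exp(lam n * s)]; its value at [T_t]
    has the Laplace transform as mean. *)
Lemma bern_mean_eigenvalue n (t x : R) : I x -> 0 <= t ->
  bern_mix (fun s => expR (lam n * s)) (bern_mean t x) N @[N --> \oo] -->
  expR (- sd_phi Y (- lam n) * t).
Proof.
move=> Ix t0.
have l0 : 0 <= - lam n by rewrite oppr_ge0 eigenvalue_le0.
have := @expectation_at_random_time _ _ _ (Px x) (fun s _ => expR (lam n * s)) (T t) 1
  (mT Ix t0) (fun w => T0 w Ix t0).
have E : \int[Px x]_w expR (lam n * T t w) = expR (- sd_phi Y (- lam n) * t).
  rewrite -(Rintegral_expR_subordinator (sd_is_subordinator HY Ix) t0 l0).
  by apply: eq_Rintegral => w _; rewrite opprK.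
have E1 : fine (Px x [set: O]) = 1 := congr1 fine (probability_setT (Px x)).
rewrite E /= => /(_ _ _ _ _)/=; rewrite (_ : (fun s => \int[Px x]_w _) = (fun s => expR (lam n * s))).
  apply => //.
  - by move=> s w s0; rewrite ger0_norm ?expR_ge0// -(@expR0 R) ler_expR mulr_le0_ge0// eigenvalue_le0.
  - move=> w; apply: continuous_subspaceT => s; apply: continuous_comp; last exact: continuous_expR.
    by apply: cvgM; [exact: cvg_cst|exact: cvg_id].
  - move=> s N k s0; rewrite RintegralZl//; last exact: ibern.
    by rewrite Rintegral_cst// E1 mulr1.
by apply/funext => s; rewrite Rintegral_cst// E1 mulr1.
Qed.

Let cst_fX x (s : R) : I x -> 0 <= s -> `|S s f x| <= M.
Proof.
move=> Ix s0; apply: (le_trans (le_normr_Rintegral _ _)) => //.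
  exact: (@bounded_integrable_prob _ _ _ (Px x) (fX s) M (mfX s0) (fun w => fXM w s0)).
have E1 : fine (Px x [set: O]) = 1 := congr1 fine (probability_setT (Px x)).
rewrite -[M]mulr1 -E1 -Rintegral_cst//; apply: le_Rintegral => //.
- apply: (@bounded_integrable_prob _ _ _ _ _ M); first exact/measurableT_comp/(mfX s0).
  by move=> w; rewrite normr_id; exact: fXM.
- exact: finite_measure_integrable_cst.
- by move=> w _; exact: fXM.
Qed.

Let mean_mix (t x0 : R) N x := bern_mix (fun s => S s f x) (bern_mean t x0) N.

Let mean_mix_measurable (t x0 : R) N : measurable_fun I (mean_mix t x0 N).
Proof.
apply: measurable_sum => k; apply: measurable_funM; last exact: measurable_cst.
case: eqP => _; first exact: measurable_cst.
by apply: (sd_semigroup_L2 _ Lf).1; apply: log_time_ge0; rewrite -ltnS.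
Qed.

Lemma sd_mean_measurable (t : R) : 0 <= t -> measurable_fun I (sd_mean t).
Proof.
move=> t0; have [x0 ix0] := interior_exists HI; have Ix0 := interior_state HI ix0.
apply: (measurable_fun_cvg (D := I) (h := mean_mix t x0)) => // x Ix.
have := sd_mean_cvg Ix t0; rewrite /mean_mix.
rewrite (_ : bern_mix _ (bern_mean t x) = bern_mix (fun s => S s f x) (bern_mean t x0))//.
by apply/funext => N; apply: eq_bigr => k _; rewrite (bern_mean_cst N k Ix Ix0).
Qed.

(** The coefficient of a mixture of the [S s f] is the same mixture of [exp(lam n * s)] times the
    coefficient of [f]. Dominated convergence in [x], by [|M phi_n q|], handles one side and
    [bern_mean_eigenvalue] the other. *)
Lemma sd_mean_coef n (t : R) : 0 <= t ->
  dot (sd_mean t) (phi n) = expR (- sd_phi Y (- lam n) * t) * dot f (phi n).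
Proof.
move=> t0; have [x0 ix0] := interior_exists HI; have Ix0 := interior_state HI ix0.
have Lp := ob_L2 sd_orthobasis n.
have LM : L2 (cst M).
  apply: (bounded_L2 (M := `|M|) mI mq q0 sd_q_integrable) => //; exact: measurable_cst.
have iM := integrable_abse (L2_integrable mI mq q0 LM Lp).
pose F N x := mean_mix t x0 N x * phi n x * q x.
have mF N : measurable_fun I (F N).
  apply: measurable_funM => //; apply: measurable_funM => //.
  exact: eigenfunction_measurable.
have [||||_ H1] := @dominated_Rintegral _ _ _ leb I mI' F
  (fun x => sd_mean t x * phi n x * q x) (fun x => `|M * phi n x * q x|).
- exact: mF.
- move=> x Ix; apply: cvgM; last exact: cvg_cst.
  apply: cvgM; last exact: cvg_cst.
  have := sd_mean_cvg Ix t0.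
  rewrite (_ : bern_mix _ (bern_mean t x) = bern_mix (fun s => S s f x) (bern_mean t x0))//.
  by apply/funext => N; apply: eq_bigr => k _; rewrite (bern_mean_cst N k Ix Ix0).
- by apply: eq_integrable iM.
- move=> N x Ix; rewrite !normrM ler_wpM2r// ler_wpM2r//.
  apply: le_trans (ler_norm _).
  apply: bern_mix_norm_le; [by move=> s; exact: cst_fX|by move=> k; exact: bern_mean_ge0|].
  exact: bern_mean_sum1.
have H2 := bern_mean_eigenvalue (n := n) Ix0 t0.
have H3 : bern_mix (fun s => expR (lam n * s)) (bern_mean t x0) N * dot f (phi n)
    @[N --> \oo] --> expR (- sd_phi Y (- lam n) * t) * dot f (phi n).
  by apply: cvgM H2 _; exact: cvg_cst.
apply: (cvg_unique (@Rhausdorff R) _ H3).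
apply: cvg_trans H1; apply: near_eq_cvg; apply: nearW => N.
pose G (k : 'I_N.+1) x :=
  (if nat_of_ord k == 0%N then 0 else S (log_time N k) f x) * bern_mean t x0 N k.
have LS (k : 'I_N.+1) : L2 (S (log_time N k) f).
  by apply: sd_semigroup_L2 => //; apply: log_time_ge0; rewrite -ltnS.
have L0 := L20 mI mq q0.
have GE k : G k = (fun x => bern_mean t x0 N k *
    (if nat_of_ord k == 0%N then fun=> 0 else S (log_time N k) f) x).
  by apply/funext => x; rewrite /G mulrC; case: eqP.
have LG k : L2 (G k) by rewrite GE; apply: L2Z => //; case: eqP.
rewrite -[LHS]/(dot (fun x => \sum_(k < N.+1) G k x) (phi n)) dot_suml//.
rewrite /bern_mix mulr_suml; apply: eq_bigr => k _.
rewrite GE dotZl//; last by case: eqP.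
rewrite -mulrA mulrCA; congr (_ * _).
case: eqP => _.
  rewrite mul0r /L2dot; under eq_Rintegral do rewrite !mul0r.
  by rewrite Rintegral_cst// mul0r.
by rewrite sd_semigroup_coef//; apply: log_time_ge0; rewrite -ltnS.
Qed.

Lemma sd_mean_L2 (t : R) : 0 <= t -> L2 (sd_mean t).
Proof.
move=> t0; apply: (bounded_L2 mI mq q0 sd_q_integrable (sd_mean_measurable t0)).
by move=> x Ix; exact: sd_mean_norm_le.
Qed.

End spectral_data.

(** * Truncation of unbounded functions *)

Section truncation.
Context {R : realType}.
Implicit Types (a M : R).

Definition truncation M a : R := Num.max (- M) (Num.min a M).

Lemma truncation_le M a : 0 <= M -> `|truncation M a| <= M.
Proof.
move=> M0; rewrite /truncation ler_norml le_max lexx/= ge_max ge_min lexx orbT andbT.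
by rewrite (le_trans _ M0)// oppr_le0.
Qed.

Lemma truncation_id M a : `|a| <= M -> truncation M a = a.
Proof. by rewrite ler_norml => /andP[h1 h2]; rewrite /truncation (min_idPl h2) (max_idPr h1). Qed.

Lemma truncation_dist M a : 0 <= M -> `|a - truncation M a| <= `|a|.
Proof.
move=> M0; rewrite /truncation /Num.max /Num.min.
have [h1|h1] := ltP a M; have [h2|h2] := ltP (- M) _.
- by rewrite subrr normr0.
- by rewrite opprK !ler0_norm; lra.
- by rewrite !ger0_norm; lra.
- by rewrite opprK; have : M <= 0 by [lra]; move=> ?; have -> : M = 0; [lra|rewrite addr0].
Qed.

Lemma truncation_continuous M : continuous (truncation M).
Proof.
move=> x; have c1 : {for x, continuous (cst (- M) : R -> R^o)} by exact: cst_continuous.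
have c2 : {for x, continuous (cst M : R -> R^o)} by exact: cst_continuous.
have c3 : {for x, continuous (id : R -> R^o)} by exact: cvg_id.
exact: (continuous_max c1 (continuous_min c3 c2)).
Qed.

Lemma truncation_within (I : set R) M (f : R -> R) : {within I, continuous f} ->
  {within I, continuous (fun x => truncation M (f x))}.
Proof. by move=> cf x; apply: continuous_comp (cf x) _; exact: truncation_continuous. Qed.

Lemma truncation_cvg a : truncation n%:R a @[n --> \oo] --> a.
Proof.
apply: cvg_near_cst; exists (Num.truncn `|a|).+1 => // n /= nN.
by apply: truncation_id; rewrite ltW// (lt_le_trans (truncnS_gt _))// ler_nat.
Qed.

End truncation.

(** Measurability along the random time is known for bounded continuous functions of [X]; the
    identity is the limit of its truncations. *)
Lemma measurable_sd_process {R : realType} {d : measure_display} {O : measurableType d}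
    (l r : \bar R) (I : set R) (Y : subordinate_data R O) (t x : R) :
  interval_with_endpoints l r I -> subordinate_diffusion l r I Y -> I x -> 0 <= t ->
  measurable_fun setT (sd_process Y t).
Proof.
move=> HI HY Ix t0.
apply: (measurable_fun_cvg (D := setT)
  (h := fun n w => truncation n%:R (sd_process Y t w))) => [n|w _]; last exact: truncation_cvg.
apply: (measurable_path_at_subordinator HI HY (f := truncation n%:R) (M := n%:R) _ _ Ix t0).
- by apply: continuous_subspaceT; exact: truncation_continuous.
- by move=> z _; exact: truncation_le.
Qed.

(** * Equal densities have equivalent triplets *)

Section orthobasis_comparison.
Context {R : realType} (I : set R) (q : R -> R).
Hypotheses (mI : measurable I) (mq : measurable_fun I q).
Hypothesis q0 : forall x, I x -> 0 < q x.
Local Notation dot := (L2dot I q).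
Local Notation L2 := (L2 I q).
Local Notation L2n := (L2n I q).

Lemma coef_dot_le phi f g : orthobasis I q phi -> L2 f -> L2 g ->
  (forall k, `|dot f (phi k)| <= `|dot g (phi k)|) -> dot f f <= dot g g.
Proof.
move=> B Lf Lg H; have := parseval mI mq q0 B Lg Lg; have := parseval mI mq q0 B Lf Lf.
move=> cf cg; apply: (ler_cvg_to cf cg); apply: nearW => N; apply: ler_sum => k _.
by rewrite -!expr2 -(real_normK (num_real (dot f _))) -(real_normK (num_real (dot g _)))
  ler_sqr ?nnegrE.
Qed.

Lemma orthobasis_weight (q' : R -> R) phi : (forall x, I x -> q x = q' x) ->
  orthobasis I q phi -> orthobasis I q' phi.
Proof.
move=> qq' B.
have nE f : L2norm_sq I q f = L2norm_sq I q' f.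
  by apply: eq_integral => x /set_mem Ix; rewrite qq'.
have dE f g : L2dot I q f g = L2dot I q' f g.
  by apply: eq_Rintegral => x /set_mem Ix; rewrite qq'.
have LE f : Defs.L2 I q f <-> Defs.L2 I q' f by rewrite /Defs.L2 nE.
split=> [n|m n|f /LE Lf]; first exact/LE/(ob_L2 B).
  by rewrite -dE (ob_orthonormal B).
apply: cvg_trans (ob_basis B Lf); apply: near_eq_cvg; apply: nearW => N.
rewrite -nE; congr (L2norm_sq _ _ _); apply/funext => x.
by congr (_ - _); apply: eq_bigr => k _; rewrite dE.
Qed.

(** Dominated convergence: the squared error is at most [f^2] and vanishes eventually at each
    point. *)
Lemma truncation_L2 f : L2 f ->
  L2n (fun x => f x - truncation n%:R (f x)) @[n --> \oo] --> 0.
Proof.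
move=> Lf; have mf := Lf.1.
have mt (n : nat) : measurable_fun I (fun x => truncation n%:R (f x)).
  apply: measurableT_comp => //.
  by apply: continuous_measurable_fun; exact: truncation_continuous.
have [||||_ H] := @dominated_Rintegral _ _ _ (@lebesgue_measure R) I mI
  (fun n x => (f x - truncation n%:R (f x)) * (f x - truncation n%:R (f x)) * q x)
  (cst 0) (fun x => f x * f x * q x).
- move=> n; apply: measurable_funM => //.
  have mB := measurable_funB mf (mt n).
  exact: (measurable_funM mB mB).
- move=> x Ix; rewrite -[cst 0 x](mul0r (q x)) -[X in X * q x](mulr0 (f x - f x)).
  apply: cvgM; last exact: cvg_cst.
  rewrite -[X in _ * X](subrr (f x)).
  by apply: cvgM; (apply: cvgB; [exact: cvg_cst|exact: truncation_cvg]).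
- by apply: eq_integrable (L2_integrable mI mq q0 Lf Lf).
- move=> n x Ix; rewrite !normrM (ger0_norm (ltW (q0 Ix))) ler_wpM2r ?(ltW (q0 Ix))//.
  by rewrite -expr2 -[leRHS]expr2 -[leRHS]real_normK ?num_real// ler_sqr ?nnegrE// truncation_dist.
rewrite -[X in _ --> X]sqrtr0.
apply: (@continuous_cvg _ _ _ _ _ _ Num.sqrt); first exact: sqrt_continuous.
by move: H; rewrite Rintegral_cst// mul0r.
Qed.

End orthobasis_comparison.

(** * Comparison of two stationary densities *)

Section two_weights.
Context {R : realType} (l r : \bar R) (I : set R) (q1 q2 : R -> R).
Hypothesis HI : interval_with_endpoints l r I.
Hypotheses (cq1 : {within I, continuous q1}) (cq2 : {within I, continuous q2}).
Hypotheses (q10 : forall x, I x -> 0 < q1 x) (q20 : forall x, I x -> 0 < q2 x).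
Local Notation leb := (@lebesgue_measure R).
Hypotheses (iq1 : leb.-integrable I (EFin \o q1)) (iq2 : leb.-integrable I (EFin \o q2)).

Let mI : measurable I. Proof. exact: measurable_state HI. Qed.
Let mI' : measurable (I : set (measurableTypeR R)). Proof. exact: mI. Qed.
Let mq1 : measurable_fun I q1. Proof. exact: subspace_continuous_measurable_fun. Qed.
Let mq2 : measurable_fun I q2. Proof. exact: subspace_continuous_measurable_fun. Qed.

(** Both convergences hold in the weaker norm of weight [min(q1, q2)], where the limit of the common
    sequence is unique; constants equal almost everywhere are equal. *)
Lemma two_weights_limit (m : nat -> R -> R) (c1 c2 : R) (e1 e2 : nat -> R) :
  (forall n, L2 I q1 (m n)) -> (forall n, L2 I q2 (m n)) ->
  (forall n, L2dot I q1 (fun x => m n x - c1) (fun x => m n x - c1) <= e1 n) ->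
  (forall n, L2dot I q2 (fun x => m n x - c2) (fun x => m n x - c2) <= e2 n) ->
  e1 n @[n --> \oo] --> 0 -> e2 n @[n --> \oo] --> 0 -> c1 = c2.
Proof.
move=> Lm1 Lm2 le1 le2 cv1 cv2.
pose w x := Num.min (q1 x) (q2 x).
have mw : measurable_fun I w by apply: measurable_minr; [exact: mq1|exact: mq2].
have w0 x : I x -> 0 < w x by move=> Ix; rewrite lt_min q10// q20.
have w1 x : w x <= q1 x by rewrite /w ge_min lexx.
have w2 x : w x <= q2 x by rewrite /w ge_min lexx orbT.
have iw : leb.-integrable I (EFin \o w).
  apply: le_integrable iq1; [exact: mI'|exact/measurable_EFinP|].
  move=> x Ix; rewrite /comp !abse_EFin lee_fin (ger0_norm (ltW (w0 _ Ix))).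
  by rewrite (ger0_norm (ltW (q10 Ix))).
have Lc (q : R -> R) (c : R) : measurable_fun I q -> (forall x, I x -> 0 < q x) ->
    leb.-integrable I (EFin \o q) -> L2 I q (fun=> c).
  move=> mq q0 iq; apply: (bounded_L2 (M := `|c|) mI mq q0 iq) => //.
pose g : R -> R := fun=> c1 - c2.
have Lg := Lc _ (c1 - c2) mw w0 iw.
have key n : L2dot I w g g <= 2 * e1 n + 2 * e2 n.
  have L1 := L2B mI mq1 q10 (Lm1 n) (Lc _ c1 mq1 q10 iq1).
  have L3 := L2B mI mq2 q20 (Lm2 n) (Lc _ c2 mq2 q20 iq2).
  apply: (@le_trans _ _ (2 * L2dot I q1 (fun x => m n x - c1) (fun x => m n x - c1) +
     2 * L2dot I q2 (fun x => m n x - c2) (fun x => m n x - c2))).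
    have j1 := integrable_scale mI 2 (L2_integrable mI mq1 q10 L1 L1).
    have j2 := integrable_scale mI 2 (L2_integrable mI mq2 q20 L3 L3).
    have i1 := L2_integrable mI mq1 q10 L1 L1.
    have i3 := L2_integrable mI mq2 q20 L3 L3.
    rewrite /L2dot -RintegralZl// -RintegralZl// -RintegralD//.
    apply: le_Rintegral => //.
    + exact: (L2_integrable mI mw w0 Lg Lg).
    + exact: (integrableD mI' j1 j2).
    + move=> x Ix; rewrite /g.
      set u := m n x - c1; set v := m n x - c2.
      have -> : c1 - c2 = v - u by rewrite /u /v; ring.
      have := w1 x; have := w2 x; have := w0 _ Ix.
      have := sqr_ge0 (u + v); have := sqr_ge0 u; have := sqr_ge0 v; nra.
  by rewrite lerD// ler_pM2l.
have : L2dot I w g g <= 2 * 0 + 2 * 0.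
  have cc : L2dot I w g g @[_ --> \oo] --> L2dot I w g g by exact: cvg_cst.
  have ce : 2 * e1 n + 2 * e2 n @[n --> \oo] --> (2 * 0 + 2 * 0 : R).
    by apply: cvgD; (apply: cvgM; [exact: cvg_cst|]).
  by apply: (ler_cvg_to cc ce); exact: nearW.
rewrite mulr0 addr0 => h.
have g0 : L2dot I w g g = 0 by apply/eqP; rewrite eq_le h; exact: (dot_ge0 w0).
have [x ix] := interior_exists HI.
apply/eqP; rewrite -subr_eq0; apply/eqP.
apply: (within_ae_eq HI (f := g) (g := fun=> 0) _ _ (dot0_ae mI mw w0 Lg g0) (interior_state HI ix)).
- by move=> y; exact: cvg_cst.
- by move=> y; exact: cvg_cst.
Qed.

(** The test function [(q1 - q2) / (q1 + q2)] is continuous and bounded by 1, and its integral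
    against [q1 - q2] is that of its square against [q1 + q2]. *)
Lemma two_weights_eq : (forall (f : R -> R) (M : R), {within I, continuous f} ->
    (forall x, I x -> `|f x| <= M) ->
    \int[leb]_(x in I) (f x * q1 x) = \int[leb]_(x in I) (f x * q2 x)) ->
  forall x, I x -> q1 x = q2 x.
Proof.
move=> H; pose s x := q1 x + q2 x.
pose f x := (q1 x - q2 x) / s x.
have s0 y : I y -> 0 < s y by move=> Iy; rewrite addr_gt0 ?q10 ?q20.
have cf : {within I, continuous f}.
  apply/subspace_continuousP => y Iy.
  have c1 := (subspace_continuousP _ _).1 cq1 y Iy.
  have c2 := (subspace_continuousP _ _).1 cq2 y Iy.
  apply: cvgM; first by apply: cvgB; [exact: c1|exact: c2].
  by apply: cvgV; [rewrite gt_eqF// s0|apply: cvgD; [exact: c1|exact: c2]].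
have f1 y : I y -> `|f y| <= 1.
  move=> Iy; rewrite normrM normfV ler_pdivrMr ?normr_gt0 ?gt_eqF ?s0// mul1r.
  rewrite (ger0_norm (ltW (s0 _ Iy))) ler_norml /s.
  by have := q10 Iy; have := q20 Iy; lra.
have mf : measurable_fun I f by exact: subspace_continuous_measurable_fun.
have ms : measurable_fun I s by apply: measurable_funD; [exact: mq1|exact: mq2].
have is_ : leb.-integrable I (EFin \o s) by exact: (integrableD mI' iq1 iq2).
have Lf : L2 I s f by exact: (bounded_L2 mI ms s0 is_ mf f1).
have L1 : L2 I s (cst 1) by apply: (bounded_L2 (M := 1) mI ms s0 is_) => // x _; rewrite normr1.
have f0 : L2dot I s f f = 0.
  have ifq (q : R -> R) : measurable_fun I q -> (forall x, I x -> 0 < q x) ->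
      leb.-integrable I (EFin \o q) -> leb.-integrable I (EFin \o (fun x => f x * q x)).
    move=> mq q0 iq; apply: le_integrable iq => //.
      by apply/measurable_EFinP; exact: measurable_funM.
    move=> x Ix; rewrite /comp !abse_EFin lee_fin normrM.
    by rewrite ler_piMl// f1.
  transitivity (\int[leb]_(x in I) (f x * q1 x - f x * q2 x)).
    apply: eq_Rintegral => x /set_mem Ix.
    have sx : s x != 0 by rewrite gt_eqF// s0.
    by rewrite -mulrBr -mulrA /f divfK.
  rewrite RintegralB//; [|exact: ifq|exact: ifq].
  by rewrite (H _ _ cf f1) subrr.
have f_ae := dot0_ae mI ms s0 Lf f0.
have ae : {ae leb, forall x, I x -> q1 x = q2 x}.
  apply: ae_imp f_ae => x Hx Ix; have /eqP := Hx Ix.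
  by rewrite /f mulf_eq0 invr_eq0 (gt_eqF (s0 _ Ix)) orbF subr_eq0 => /eqP.
by move=> x Ix; exact: (within_ae_eq HI cq1 cq2 ae Ix).
Qed.

End two_weights.

Section one_process.
Context {R : realType} {d : measure_display} {O : measurableType d}.
Variables (l r : \bar R) (I : set R) (Y : subordinate_data R O).
Variables (lam : nat -> R) (phi : nat -> R -> R).
Hypothesis HI : interval_with_endpoints l r I.
Hypothesis HY : subordinate_diffusion l r I Y.
Hypothesis ES : sd_eigensystem I Y lam phi.
Local Notation q := (sd_q I Y).
Local Notation dot := (L2dot I q).
Local Notation L2 := (L2 I q).
Local Notation L2n := (L2n I q).
Local Notation psi n := (sd_phi Y (- lam n)).

Let mI := measurable_state HI.
Let mq := sd_q_measurable HI HY ES.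
Let q0 := sd_q_gt0 HI HY ES.
Let B := sd_orthobasis ES.

Lemma state_subordinator : exists x, levy_subordinator (sd_prob Y x) (sd_subordinator Y)
  (sd_gamma Y) (sd_nu Y).
Proof.
have [x ix] := interior_exists HI; exists x.
exact: (sd_is_subordinator HY (interior_state HI ix)).
Qed.

Lemma sd_exponent_increasing m n : (m < n)%N -> psi m < psi n.
Proof.
have [x Hx] := state_subordinator => mn; apply: (laplace_exponent_increasing Hx).
  by rewrite oppr_ge0 (eigenvalue_le0 ES).
rewrite ltrN2; have nd k : lam k.+1 < lam k by exact: eigenvalue_decr ES k.
by apply: (homo_ltn (r := fun x y => y < x) _ nd) mn => b a c /[swap]; exact: lt_trans.
Qed.

Lemma sd_exponent0 : psi 0%N = 0.
Proof. by rewrite (eigenvalue0 ES) oppr0; exact: laplace_exponent0. Qed.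

Lemma sd_exponent_ge0 n : 0 <= psi n.
Proof.
rewrite -sd_exponent0; case: n => [//|n]; apply: ltW; exact: sd_exponent_increasing.
Qed.

Section bounded_function.
Variables (f : R -> R) (M : R).
Hypotheses (cf : {within I, continuous f}) (fM : forall x, I x -> `|f x| <= M).

Let Lf : L2 f.
Proof.
apply: (bounded_L2 mI mq q0 (sd_q_integrable HI HY ES) _ fM).
exact: subspace_continuous_measurable_fun.
Qed.

(** The spectral gap: subtracting the stationary mean [c] removes the coefficient along [phi 0 = 1],
    and every other coefficient has shrunk at least by [exp(- psi 1 * t)]. *)
Lemma sd_mean_decay (t : R) (c := dot f (phi 0%N)) : 0 <= t ->
  dot (fun x => sd_mean Y f t x - c) (fun x => sd_mean Y f t x - c) <=
  expR (- psi 1%N * t) ^+ 2 * dot f f.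
Proof.
move=> t0; have Lm := sd_mean_L2 HI HY ES cf fM t0.
have aux (a b u v : R) : 0 <= a -> a <= b -> `|a * u - v * 0| <= `|b * u|.
  move=> a0 ab; rewrite mulr0 subr0 !normrM ler_wpM2r//.
  by rewrite !ger0_norm// (le_trans a0).
have Lp := ob_L2 B; have Lc : L2 (fun x => c * phi 0%N x) by exact: L2Z.
have LD : L2 (fun x => sd_mean Y f t x - c * phi 0%N x) by exact: L2B.
have -> : dot (fun x => sd_mean Y f t x - c) (fun x => sd_mean Y f t x - c) =
    dot (fun x => sd_mean Y f t x - c * phi 0%N x) (fun x => sd_mean Y f t x - c * phi 0%N x).
  by apply: eq_Rintegral => x /set_mem Ix; rewrite (eigenfunction0 ES)// mulr1.
have Le : L2 (fun x => expR (- psi 1%N * t) * f x) by exact: L2Z.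
rewrite expr2 -mulrA -dotZl// (dotC _ _ _ f) -dotZl//.
apply: (coef_dot_le mI mq q0 B LD Le) => k.
rewrite dotBl// !dotZl// (sd_mean_coef HI HY ES cf fM)// (ob_orthonormal B).
case: k => [|k].
  by rewrite mulr1 sd_exponent0 oppr0 mul0r expR0 mul1r subrr normr0.
have -> : (0%N == k.+1)%:R = 0 :> R by [].
apply: aux; first exact: expR_ge0.
rewrite ler_expR !mulNr lerN2 ler_wpM2r//.
by case: k => [//|k]; apply: ltW; exact: sd_exponent_increasing.
Qed.

End bounded_function.

(* The Y-semigroup is only known on bounded continuous functions, so the eigenfunction is
   reached by truncation. *)
Lemma eigenfunction_of_mean n (h : R -> R) (b : R) : L2 h ->
  (forall f M, {within I, continuous f} -> (forall x, I x -> `|f x| <= M) ->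
     dot (sd_mean Y f 1) h = b * dot f h) ->
  (expR (- psi n) - b) * dot (phi n) h = 0.
Proof.
move=> Lh H; have Lp := ob_L2 B n.
have aux (a : nat -> R) i j u : a i * (i == j)%:R - a j * u = a j * ((i == j)%:R - u).
  by case: eqP => [->|_]; rewrite mulrBr ?mulr0.
pose f (k : nat) (x : R) : R := truncation k%:R (phi n x).
have cf k : {within I, continuous (f k)}.
  by apply: truncation_within; exact: eigenfunction_cont ES n.
have fM k x : I x -> `|f k x| <= k%:R by move=> _; exact: truncation_le.
have Lf k : L2 (f k).
  have mfk : measurable_fun I (f k) by exact: (subspace_continuous_measurable_fun mI (cf k)).
  exact: (bounded_L2 mI mq q0 (sd_q_integrable HI HY ES) mfk (fM k)).
have f_phi := truncation_L2 mI mq q0 Lp.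
have Lm k : L2 (sd_mean Y (f k) 1) by exact: (sd_mean_L2 HI HY ES (cf k) (fM k)).
have Le : L2 (fun x => expR (- psi n) * phi n x) by exact: L2Z.
(* The [j]-th coefficient of this difference is [exp(- psi j)] times that of [phi n - f k]; the
   factors are at most 1, so the norm is below the truncation error. *)
have m_phi : L2n (fun x => expR (- psi n) * phi n x - sd_mean Y (f k) 1 x) @[k --> \oo] --> 0.
  apply: (squeeze_cvgr _ (cvg_cst 0) f_phi); apply: nearW => k.
  rewrite L2n_ge0/= ler_wsqrtr//.
  have L1 := L2B mI mq q0 Le (Lm k); have L3 := L2B mI mq q0 Lp (Lf k).
  apply: (coef_dot_le mI mq q0 B L1 L3) => j; have Lj := ob_L2 B j.
  rewrite !dotBl// dotZl// (sd_mean_coef HI HY ES (cf k) (fM k))// mulr1 (ob_orthonormal B).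
  have -> : expR (- psi n) * (n == j)%:R - expR (- psi j) * dot (f k) (phi j) =
      expR (- psi j) * ((n == j)%:R - dot (f k) (phi j)).
    exact: (aux (fun n => expR (- psi n))).
  rewrite normrM ler_piMl// ger0_norm ?expR_ge0// -(@expR0 R) ler_expR oppr_le0.
  exact: sd_exponent_ge0.
have C1 := cvg_dot mI mq q0 Lm Le Lh m_phi.
have C2 : b * dot (f k) h @[k --> \oo] --> b * dot (phi n) h.
  by apply: cvgM; [exact: cvg_cst|exact: cvg_dot].
have : dot (fun x => expR (- psi n) * phi n x) h = b * dot (phi n) h.
  apply: (cvg_unique (@Rhausdorff R) _ C2); apply: cvg_trans C1.
  by apply: near_eq_cvg; apply: nearW => k; rewrite (H _ _ (cf k) (fM k)).
by rewrite dotZl// mulrBl => ->; rewrite subrr.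
Qed.

End one_process.

Section same_transition_densities.
Context {R : realType} {d1 d2 : measure_display}.
Context {O1 : measurableType d1} {O2 : measurableType d2}.
Variables (l r : \bar R) (I : set R).
Variables (Y1 : subordinate_data R O1) (Y2 : subordinate_data R O2).
Variables (lam1 lam2 : nat -> R) (phi1 phi2 : nat -> R -> R).
Variables (p1 p2 : R -> R -> R -> \bar R).
Hypothesis HI : interval_with_endpoints l r I.
Hypotheses (HY1 : subordinate_diffusion l r I Y1) (HY2 : subordinate_diffusion l r I Y2).
Hypotheses (ES1 : sd_eigensystem I Y1 lam1 phi1) (ES2 : sd_eigensystem I Y2 lam2 phi2).
Hypothesis TD1 : transition_density I (sd_prob Y1) (sd_process Y1) p1.
Hypothesis TD2 : transition_density I (sd_prob Y2) (sd_process Y2) p2.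
Hypothesis p12 : identical_densities I p1 p2.
Local Notation leb := (@lebesgue_measure R).
Local Notation q1 := (sd_q I Y1).
Local Notation q2 := (sd_q I Y2).
Local Notation psi1 n := (sd_phi Y1 (- lam1 n)).
Local Notation psi2 n := (sd_phi Y2 (- lam2 n)).

Let mI := measurable_state HI.
Let mI' : measurable (I : set (measurableTypeR R)) := mI.
Let mq1 := sd_q_measurable HI HY1 ES1.
Let mq2 := sd_q_measurable HI HY2 ES2.
Let q10 := sd_q_gt0 HI HY1 ES1.
Let q20 := sd_q_gt0 HI HY2 ES2.
Let iq1 := sd_q_integrable HI HY1 ES1.
Let iq2 := sd_q_integrable HI HY2 ES2.

Lemma sd_process_state d (O : measurableType d) (Y : subordinate_data R O) (t x : R) w :
  subordinate_diffusion l r I Y -> I x -> 0 <= t -> I (sd_process Y t w).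
Proof.
move=> HY Ix t0; apply: (markov_state (sd_markov HY)).
exact: (subordinator_ge0 (sd_is_subordinator HY Ix)).
Qed.

Lemma same_law (t x : R) (A : set R) : 0 < t -> I x -> measurable A ->
  sd_prob Y1 x (sd_process Y1 t @^-1` A) = sd_prob Y2 x (sd_process Y2 t @^-1` A).
Proof.
move=> t0 Ix mA.
have E d (O : measurableType d) (Y : subordinate_data R O) : subordinate_diffusion l r I Y ->
    sd_process Y t @^-1` A = sd_process Y t @^-1` (A `&` I).
  move=> HY; apply/seteqP; split=> w /=; last by case.
  by split=> //; exact: sd_process_state HY Ix (ltW t0).
rewrite (E _ _ _ HY1) (E _ _ _ HY2).
have mAI : measurable (A `&` I) by exact: measurableI.
have [_ _ ->//] := TD1 t0 Ix; have [_ _ ->//] := TD2 t0 Ix.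
by apply: eq_integral => y /set_mem[_ Iy]; rewrite p12.
Qed.

(** Both expectations are integrals of the extension by 0 of [f] against the law of [Y_t], a
    pushforward measure that the two processes share. *)
Lemma same_mean (f : R -> R) (M t x : R) : {within I, continuous f} ->
  (forall x, I x -> `|f x| <= M) -> 0 < t -> I x ->
  sd_mean Y1 f t x = sd_mean Y2 f t x.
Proof.
move=> cf fM t0 Ix.
have mf : measurable_fun I f by exact: subspace_continuous_measurable_fun.
have mfI : measurable_fun setT (f \_ I) by apply/(measurable_restrictT _ _).1.
have M0 : 0 <= M by rewrite (le_trans _ (fM _ Ix)).
have fIM y : `|(f \_ I) y| <= M.
  by rewrite patchE; case: ifPn => [/set_mem/fM//|_]; rewrite normr0.
have E d (O : measurableType d) (Y : subordinate_data R O) : subordinate_diffusion l r I Y ->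
    (\int[sd_prob Y x]_w (f (sd_process Y t w))%:E =
     \int[pushforward (sd_prob Y x) (sd_process Y t)]_y ((f \_ I) y)%:E)%E.
  move=> HY; have mY := measurable_sd_process HI HY Ix (ltW t0).
  rewrite (integral_pushforward mY)//.
  - apply: eq_integral => w _; rewrite /= patchE mem_set//.
    exact: sd_process_state HY Ix (ltW t0).
  - exact/measurable_EFinP.
  - rewrite preimage_setT; apply: (@bounded_integrable_prob _ _ _ (sd_prob Y x)
      (fun w => (f \_ I) (sd_process Y t w)) M); first exact: measurableT_comp.
    by move=> w; exact: fIM.
rewrite /sd_mean /Rintegral (E _ _ _ HY1) (E _ _ _ HY2); congr fine.
have mY1 := measurable_sd_process HI HY1 Ix (ltW t0).
have mY2 := measurable_sd_process HI HY2 Ix (ltW t0).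
apply: (@eq_measure_integral _ _ _ setT
  (measure_function_pushforward__canonical__measure_function_Measure (sd_prob Y2 x) mY2)
  (measure_function_pushforward__canonical__measure_function_Measure (sd_prob Y1 x) mY1)).
by move=> A mA _; exact: same_law.
Qed.

(** For a bounded continuous [f], the common function [E f(Y_t)] tends to the mean of [f] under [q1]
    in L^2(q1), and to its mean under [q2] in L^2(q2); the two limits must agree. *)
Lemma same_stationary_density x : I x -> q1 x = q2 x.
Proof.
have cq1 := sd_q_continuous HI HY1 ES1; have cq2 := sd_q_continuous HI HY2 ES2.
move: x; apply: (two_weights_eq HI cq1 cq2 q10 q20 iq1 iq2) => f M cf fM.
have E (q : R -> R) (phi : nat -> R -> R) : (forall x, I x -> phi 0%N x = 1) ->
    \int[leb]_(x in I) (f x * q x) = L2dot I q f (phi 0%N).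
  by move=> phi0; apply: eq_Rintegral => x /set_mem Ix; rewrite phi0// mulr1.
apply: etrans (E q1 phi1 (eigenfunction0 ES1)) _.
apply: etrans (esym (E q2 phi2 (eigenfunction0 ES2))).
(* Times start at 1, the densities being compared for [t > 0] only. *)
pose t (n : nat) : R := n.+1%:R.
have t0 n : 0 < t n by rewrite ltr0n.
pose e (psi A : R) n := expR (- psi * t n) ^+ 2 * A.
have e_cvg psi A : 0 < psi -> e psi A n @[n --> \oo] --> 0.
  move=> psi0; have ez : expR (- psi * t n) @[n --> \oo] --> 0.
    have -> : (fun n => expR (- psi * t n)) = (fun n => geometric (expR (- psi)) (expR (- psi)) n).
      by apply/funext => n; rewrite /geometric /= -exprS -expRM_natr.
    by apply: cvg_geometric; rewrite ger0_norm ?expR_ge0// expR_lt1 oppr_lt0.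
  rewrite -(mul0r A); apply: cvgM; last exact: cvg_cst.
  by rewrite -(mul0r 0); under eq_fun do rewrite expr2; exact: cvgM.
have psi_gt0 d (O : measurableType d) (Y : subordinate_data R O) lam phi :
    subordinate_diffusion l r I Y -> sd_eigensystem I Y lam phi -> 0 < sd_phi Y (- lam 1%N).
  move=> HY ES; rewrite -(sd_exponent0 ES).
  exact: (sd_exponent_increasing HI HY ES).
have h1 n := sd_mean_decay HI HY1 ES1 cf fM (ltW (t0 n)).
have h2 n := sd_mean_decay HI HY2 ES2 cf fM (ltW (t0 n)).
have L1 n := sd_mean_L2 HI HY1 ES1 cf fM (ltW (t0 n)).
have Lq2 n := sd_mean_L2 HI HY2 ES2 cf fM (ltW (t0 n)).
apply: (two_weights_limit HI cq1 cq2 q10 q20 iq1 iq2 (m := fun n => sd_mean Y1 f (t n)) L1 _ h1 _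
  (e_cvg _ _ (psi_gt0 _ _ _ _ _ HY1 ES1)) (e_cvg _ _ (psi_gt0 _ _ _ _ _ HY2 ES2))).
(* The means of the first process are in L^2(q2) because they coincide with those of the second. *)
- move=> n; have := Lq2 n; rewrite /L2 => -[_ h].
  have mE : L2norm_sq I q2 (sd_mean Y1 f (t n)) = L2norm_sq I q2 (sd_mean Y2 f (t n)).
    by apply: eq_integral => x /set_mem Ix; rewrite (same_mean cf fM (t0 n) Ix).
  by split; [exact: (L1 n).1|rewrite mE].
- move=> n; apply: le_trans (h2 n); rewrite le_eqVlt; apply/orP; left; apply/eqP.
  by apply: eq_Rintegral => x /set_mem Ix; rewrite (same_mean cf fM (t0 n) Ix).
Qed.

(** The operator to which [orthobasis_match] refers is the common subordinate semigroup at time 1,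
    with eigenvalues [exp(- psi n)], strictly decreasing because the Laplace exponent is strictly
    increasing. *)
Lemma same_eigensystem n : psi1 n = psi2 n /\
  exists2 e : R, e ^+ 2 = 1 & forall x, I x -> phi1 n x = e * phi2 n x.
Proof.
have q12 := same_stationary_density.
have B1 := sd_orthobasis ES1.
have B2 : orthobasis I q1 phi2.
  by apply: (orthobasis_weight (q := q2)) (sd_orthobasis ES2) => x Ix; rewrite q12.
have dE f g : L2dot I q1 f g = L2dot I q2 f g.
  by apply: eq_Rintegral => x /set_mem Ix; rewrite q12.
have decr d (O : measurableType d) (Y : subordinate_data R O) lam phi :
    subordinate_diffusion l r I Y -> sd_eigensystem I Y lam phi ->
    forall k, expR (- sd_phi Y (- lam k.+1)) < expR (- sd_phi Y (- lam k)).
  move=> HY ES k; rewrite ltr_expR ltrN2.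
  exact: (sd_exponent_increasing HI HY ES).
have [||k m|/expR_inj/oppr_inj E [e e1 ae]] := orthobasis_match mI mq1 q10
  (a := fun n => expR (- psi1 n)) (b := fun n => expR (- psi2 n)) B1 B2 _ _ _ n.
- exact: decr HY1 ES1.
- exact: decr HY2 ES2.
- apply: (@eigenfunction_of_mean _ _ _ _ _ _ _ _ _ HI HY1 ES1 k (phi2 m)
    (expR (- psi2 m)) (ob_L2 B2 m)) => f M cf fM.
  rewrite dE; apply: etrans (_ : expR (- psi2 m * 1) * L2dot I q2 f (phi2 m) = _); last first.
    exact: (congr2 *%R (congr1 (@expR R) (mulr1 (- psi2 m))) (esym (dE f (phi2 m)))).
  rewrite -(sd_mean_coef HI HY2 ES2 cf fM _ ler01).
  by apply: eq_Rintegral => x /set_mem Ix; rewrite (same_mean cf fM ltr01 Ix).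
split=> //; exists e => //.
apply: (within_ae_eq HI) ae; first exact: eigenfunction_cont ES1 n.
by move=> x; apply: cvgM; [exact: cvg_cst|exact: (eigenfunction_cont ES2 (n := n))].
Qed.

Lemma sd_eigenfunction_ode d (O : measurableType d) (Y : subordinate_data R O) lam phi n :
  subordinate_diffusion l r I Y -> sd_eigensystem I Y lam phi ->
  exists f1 : R -> R,
  [/\ (forall x, interior_pt l r x -> is_derive x (1 : R) (phi n) (f1 x)),
      (forall x, interior_pt l r x -> is_derive x (1 : R) f1
         (2 * (lam n * phi n x - sd_mu Y x * f1 x) / sd_sigma Y x ^+ 2)),
      (forall x, interior_pt l r x ->
         is_derive x (1 : R) (fun y => sd_sigma Y y ^+ 2 * sd_q I Y y * f1 y)
           (2 * lam n * sd_q I Y x * phi n x)) &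
      tends_to_0_left l r (fun x => sd_sigma Y x ^+ 2 * sd_q I Y x * f1 x)].
Proof.
move=> HY ES; have G := eigenfunctionP ES n; have [L1 L3 _] := G.
have [f0 f0E D] := ((sd_is_diffusion HY).2 _ _ L1 L3).1 G.
exact: (eigenfunction_ode HI (sd_regular HI HY ES) (eigenfunction_cont ES (n := n)) f0E D).
Qed.

Lemma same_coefficients : exists2 c : R, 0 < c &
  (forall n, lam2 n.+1 = c * lam1 n.+1) /\
  (forall x, I x -> sd_sigma Y1 x ^+ 2 = c^-1 * sd_sigma Y2 x ^+ 2 /\
                    sd_mu Y1 x = c^-1 * sd_mu Y2 x).
Proof.
have [f1 F1] := choice (fun n => sd_eigenfunction_ode n HY1 ES1).
have [g1 G1] := choice (fun n => sd_eigenfunction_ode n HY2 ES2).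
(* The sign relating the eigenfunctions relates their derivatives too, so the second equation can be
   rewritten for [phi1] and [f1]. *)
have F1g n : exists2 e : R, e ^+ 2 = 1 & (forall x, I x -> phi2 n x = e * phi1 n x) /\
    (forall x, interior_pt l r x -> f1 n x = e * g1 n x).
  have [_ [e e1 H]] := same_eigensystem n; exists e => //; split.
    by move=> x Ix; rewrite H// mulrA -expr2 e1 mul1r.
  move=> x ix; have [dF _ _ _] := F1 n; have [dG _ _ _] := G1 n.
  have D1 := dF _ ix; have D2 := is_deriveZ e (dG _ ix).
  have D2' : is_derive x (1 : R) (phi1 n) (e *: g1 n x).
    apply: near_eq_is_derive D2; near=> y.
    by rewrite /= H//; apply: (interior_state HI); near: y; exact: interior_near.
  have := @derive_val _ _ _ _ _ _ _ D1.
  by rewrite (@derive_val _ _ _ _ _ _ _ D2') => <-.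
apply: (common_eigenfunctions_coefficients HI (sd_regular HI HY1 ES1) (sd_regular HI HY2 ES2)
  same_stationary_density (phi := phi1) (f1 := f1)).
- exact: sd_orthobasis ES1.
- exact: eigenfunction0 ES1.
- exact: eigenfunction_cont ES1.
- exact: eigenvalue_lt0 ES1.
- exact: eigenvalue_lt0 ES2.
- by move=> n; case: (F1 n).
- by move=> n; case: (F1 n).
- by move=> n; case: (F1 n).
- by move=> n; case: (F1 n).
- move=> n x ix; have [_ _ dG _] := G1 n; have [e e1 [H1 H2]] := F1g n.
  have := is_deriveZ e (dG _ ix).
  have -> : e *: (2 * lam2 n * sd_q I Y2 x * phi2 n x) = 2 * lam2 n * sd_q I Y2 x * phi1 n x.
    rewrite /GRing.scale/= (H1 _ (interior_state HI ix)) mulrCA; congr (_ * _).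
    by rewrite mulrA -expr2 e1 mul1r.
  apply: near_eq_is_derive; near=> y.
  rewrite /GRing.scale/= /GRing.scale/= [in RHS]H2 1?mulrCA//.
  by near: y; exact: interior_near.
- move=> n eps eps0; have [_ _ _ t2] := G1 n; have [e e1 [_ H2]] := F1g n.
  have [a ia Ha] := t2 _ eps0; exists a => // x lx xa.
  have ix : interior_pt l r x by split=> //; apply: lt_trans ia.2; rewrite lte_fin.
  rewrite H2// mulrCA normrM; have -> : `|e| = 1.
    by apply/eqP; rewrite -sqrp_eq1// real_normK ?num_real ?e1.
  by rewrite mul1r; exact: Ha.
Unshelve. all: by end_near. Qed.

Lemma equivalent_of_same_densities :
  exists2 c : R, 0 < c & equivalent_triplets I Y1 Y2 lam1 c.
Proof.
have [c c0 [Hlam Hcoef]] := same_coefficients; exists c => //.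
have [x1 S1] := state_subordinator HI HY1; have [x2 S2] := state_subordinator HI HY2.
have m1 := subordinator_levy_measure S1; have m2 := subordinator_levy_measure S2.
(* The shift skips the eigenvalue 0, so that every [a n] is positive. *)
pose a n := - lam1 n.+1.
have a0 n : 0 < a n by rewrite oppr_gt0; exact: eigenvalue_lt0 ES1 n.
have ca0 n : 0 < c * a n by rewrite mulr_gt0.
pose w1 n := fine (sd_omega_hat Y1 (a n)); pose w2 n := fine (sd_omega_hat Y2 (c * a n)).
(* Both sides are the common exponent divided by [a n], the second one being evaluated at [c * a n].
   The limit in [n] will separate the drifts from the tail transforms. *)
have key n : sd_gamma Y1 + w1 n = c * (sd_gamma Y2 + w2 n).
  have [E _] := same_eigensystem n.+1.
  have [_ E1] := laplace_exponent_tail (sd_gamma Y1) m1 (a0 n).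
  have [_ E2] := laplace_exponent_tail (sd_gamma Y2) m2 (ca0 n).
  have an : a n != 0 by rewrite gt_eqF.
  apply: (mulfI an); rewrite -E1 mulrCA mulrA -E2.
  by move: E; rewrite /sd_phi Hlam -mulrN.
have a_inf : a n @[n --> \oo] --> +oo.
  have := eigenvalue_cvg HI HY1 ES1 => H.
  apply: (cvg_comp (fun n => n.+1) (fun n => - lam1 n)) H.
  by apply/cvgnyPge => A; exists A => // n /= An; rewrite (leq_trans An).
have a_nd n : a 0%N <= a n.
  rewrite lerN2; have nd : {homo lam1 : n m / (n <= m)%N >-> m <= n}.
    by apply/nonincreasing_seqP => k; exact/ltW/(eigenvalue_decr ES1).
  exact: nd.
have w1_0 : w1 n @[n --> \oo] --> 0.
  exact: (levy_tail_transform_cvg0 m1 (a0 0%N)).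
have w2_0 : w2 n @[n --> \oo] --> 0.
  apply: (levy_tail_transform_cvg0 m2 (ca0 0%N)) => // [n|].
    by rewrite ler_pM2l.
  apply/cvgryPge => A; move/cvgryPge : a_inf => /(_ (A / c)); apply: filterS => n.
  by rewrite ler_pdivrMr// mulrC.
have gammaE : sd_gamma Y1 = c * sd_gamma Y2.
  have L1 : sd_gamma Y1 + w1 n @[n --> \oo] --> sd_gamma Y1 + 0.
    by apply: cvgD => //; exact: cvg_cst.
  have L2' : c * (sd_gamma Y2 + w2 n) @[n --> \oo] --> c * (sd_gamma Y2 + 0).
    by apply: cvgM; [exact: cvg_cst|apply: cvgD => //; exact: cvg_cst].
  rewrite -[LHS]addr0 -(addr0 (sd_gamma Y2)).
  have E : (fun n => c * (sd_gamma Y2 + w2 n)) = (fun n => sd_gamma Y1 + w1 n).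
    by apply/funext => n; rewrite key.
  by rewrite E in L2'; exact: (cvg_unique (@Rhausdorff R) L1 L2').
split=> //.
  move=> x Ix; have [s m] := Hcoef _ Ix.
  by rewrite /sd_theta s m.
case=> // n _; have [f1 _] := laplace_exponent_tail (sd_gamma Y1) m1 (a0 n).
have [f2 _] := laplace_exponent_tail (sd_gamma Y2) m2 (ca0 n).
have := key n; rewrite gammaE mulrDr => /addrI E.
transitivity (w1 n)%:E; first by rewrite /w1 fineK.
by rewrite E EFinM -mulrN /w2 fineK.
Qed.

End same_transition_densities.

(** * Mercer expansion of the transition density *)

Section averages.
Context {R : realType} (l r : \bar R) (I : set R).
Hypothesis HI : interval_with_endpoints l r I.
Local Notation leb := (@lebesgue_measure R).

Let mI : measurable I. Proof. exact: measurable_state HI. Qed.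
Let mI' : measurable (I : set (measurableTypeR R)). Proof. exact: mI. Qed.

(** Cut down to [I], so that averages also concentrate at an endpoint belonging to [I], from one
    side. The normalized indicator [window_avg] is an approximate identity for Lebesgue measure. *)
Definition window (x : R) (j : nat) : set R :=
  I `&` `[x - j.+1%:R^-1, x + j.+1%:R^-1]%classic.

Definition window_mass x j : R := fine (leb (window x j)).

Definition window_avg x j (z : R) : R := (window_mass x j)^-1 * \1_(window x j) z.

Lemma window_dist x j z : window x j z -> I z /\ `|z - x| <= j.+1%:R^-1.
Proof. by case=> Iz; rewrite /= in_itv/= -ler_distl. Qed.

Lemma measurable_window x j : measurable (window x j).
Proof. by apply: measurableI => //; exact: measurable_itv. Qed.

Let mW x j : measurable (window x j : set (measurableTypeR R)).
Proof. exact: measurable_window. Qed.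

Lemma window_mass_fin x j : leb (window x j) = (window_mass x j)%:E.
Proof.
rewrite /window_mass fineK// ge0_fin_numE//.
have sub : window x j `<=` `[x - j.+1%:R^-1, x + j.+1%:R^-1]%classic by move=> z [].
have mJ : measurable (`[x - j.+1%:R^-1, x + j.+1%:R^-1]%classic : set (measurableTypeR R)).
  exact: measurable_itv.
apply: (le_lt_trans (le_measure leb (mem_set (@mW x j)) (mem_set mJ) sub)).
have E := lebesgue_measure_itv (`[x - j.+1%:R^-1, x + j.+1%:R^-1] : interval R).
by rewrite [X in (X < _)%E]E/=; case: ifP => _; rewrite ?ltry.
Qed.

(** When [x] is an endpoint, an interior point at less than half the radius provides a small
    interval inside the window. *)
Lemma window_mass_gt0 x j : I x -> 0 < window_mass x j.
Proof.
move=> Ix; have j0 : 0 < (j.+1%:R^-1 : R) by rewrite invr_gt0.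
have j2 : 0 < (j.+1%:R^-1 / 2 : R) by rewrite divr_gt0.
rewrite lt_neqAle fine_ge0// andbT; apply/eqP => W0.
have [y iy yx] := interior_approx HI Ix j2.
have [d d0 Hd] := interior_ball iy.
have e0 : 0 < Num.min (j.+1%:R^-1 / 2) d by rewrite lt_min j2.
apply: (not_ae_interior HI (P := fun z => ~ window x j z) iy e0).
  move=> z; rewrite lt_min => /andP[zy zd]; apply; split.
    by apply: (interior_state HI); apply: Hd; exact: ltW.
  rewrite /= in_itv/= -ler_distl.
  by rewrite -(subrK y z) -addrA (le_trans (ler_normD _ _))// [leRHS]splitr lerD// ltW.
exists (window x j); split; first exact: mW.
  by rewrite window_mass_fin -W0.
by move=> z /=; apply: contra_notP => nw Iz.
Qed.

Lemma integrable_window_avg x j : leb.-integrable I (EFin \o window_avg x j).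
Proof.
apply: integrable_scale => //.
have m1 : measurable_fun I (\1_(window x j) : R -> R).
  by apply: measurable_funTS; apply: measurable_indic; exact: measurable_window.
apply/integrableP; split; first exact/measurable_EFinP.
rewrite (_ : (\int[_]_(_ in _) _)%E = leb (window x j)) ?window_mass_fin ?ltry//.
under eq_integral do rewrite /= ger0_norm//.
rewrite integral_indic// -window_mass_fin; congr (leb _).
by apply/seteqP; split=> [z []//|z wz]; split=> //; case: (window_dist wz).
Qed.

Lemma Rintegral_window_avg x j : I x -> \int[leb]_(z in I) window_avg x j z = 1.
Proof.
move=> Ix; have W0 := window_mass_gt0 j Ix.
have i1 : leb.-integrable I (EFin \o (\1_(window x j) : R -> R)).
  have := integrable_scale mI (window_mass x j) (integrable_window_avg x j).
  by apply: eq_integrable => // z _; rewrite /= /window_avg mulrA divff ?mul1r// gt_eqF.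
rewrite /window_avg RintegralZl// /Rintegral integral_indic//.
rewrite (_ : window x j `&` I = window x j) ?window_mass_fin/= ?mulVf ?gt_eqF//.
by apply/seteqP; split=> [z []//|z wz]; split=> //; case: (window_dist wz).
Qed.

Lemma window_avg_ge0 x j z : I x -> 0 <= window_avg x j z.
Proof. by move=> Ix; rewrite mulr_ge0// invr_ge0 ltW// window_mass_gt0. Qed.

Lemma window_avg_measurable x j : measurable_fun I (window_avg x j).
Proof.
apply: measurable_funM; first exact: measurable_cst.
by apply: measurable_funTS; apply: measurable_indic; exact: measurable_window.
Qed.

Lemma window_avg_out x j z : ~ window x j z -> window_avg x j z = 0.
Proof. by move=> nw; rewrite /window_avg indicE memNset ?mulr0. Qed.

Lemma window_avg_bound (h : R -> R) x j v e : I x -> measurable_fun I h ->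
  (forall z, window x j z -> `|h z - v| <= e) ->
  leb.-integrable I (EFin \o (fun z => window_avg x j z * h z)) /\
  `|\int[leb]_(z in I) (window_avg x j z * h z) - v| <= e.
Proof.
move=> Ix mh hv; have iA := integrable_window_avg x j.
have mA := window_avg_measurable x j.
have pw z : `|window_avg x j z * (h z - v)| <= e * window_avg x j z.
  have [wz|nw] := pselect (window x j z); last by rewrite window_avg_out// mul0r mulr0 normr0.
  by rewrite normrM (ger0_norm (window_avg_ge0 j z Ix)) mulrC ler_wpM2r ?window_avg_ge0// hv.
have iE := integrable_scale mI e iA.
have iV := integrable_scale mI v iA.
have iD : leb.-integrable I (EFin \o (fun z => window_avg x j z * (h z - v))).
  apply: le_integrable iE => //.
    by apply/measurable_EFinP; apply: measurable_funM => //; exact: measurable_funB.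
  by move=> z Iz; rewrite /comp !abse_EFin lee_fin (le_trans (pw z))// ler_norm.
have iH : leb.-integrable I (EFin \o (fun z => window_avg x j z * h z)).
  have := integrableD mI' iD iV; apply: eq_integrable => // z _.
  by rewrite /= -EFinD; congr EFin; ring.
split=> //.
have -> : \int[leb]_(z in I) (window_avg x j z * h z) - v =
    \int[leb]_(z in I) (window_avg x j z * (h z - v)).
  rewrite -[X in _ - X]mulr1 -(Rintegral_window_avg j Ix) -RintegralZl// -RintegralB//.
  by apply: eq_Rintegral => z _; ring.
apply: (le_trans (le_normr_Rintegral mI' iD)).
rewrite -[leRHS]mulr1 -(Rintegral_window_avg j Ix) -RintegralZl//.
apply: le_Rintegral => //.
exact: (@integrable_abse _ _ _ _ _ _ iD).
Qed.

(** The function may vary with [j], because the transition density is averaged in both variables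
    over windows that shrink together. *)
Lemma window_avg_cvg (h : nat -> R -> R) x v : I x -> (forall j, measurable_fun I (h j)) ->
  (forall e, 0 < e -> \forall j \near \oo, forall z, window x j z -> `|h j z - v| <= e) ->
  \int[leb]_(z in I) (window_avg x j z * h j z) @[j --> \oo] --> v.
Proof.
move=> Ix mh H; apply/cvgrPdist_le => e e0.
apply: filterS (H e e0) => j Hj; rewrite distrC.
by have [_] := window_avg_bound Ix (mh j) Hj.
Qed.

Lemma window_shrink x d : 0 < d ->
  \forall j \near \oo, forall z, window x j z -> I z /\ `|z - x| < d.
Proof.
move=> d0; exists (Num.truncn d^-1).+1 => // j /= dj z /window_dist[Iz zx]; split=> //.
apply: le_lt_trans zx _; rewrite -[ltRHS]invrK ltf_pV2 ?posrE ?invr_gt0//.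
by rewrite (lt_le_trans (truncnS_gt _))// ler_nat ltnW.
Qed.

Lemma window_avg_cvg_cst (h : R -> R) x : I x -> {within I, continuous h} ->
  \int[leb]_(z in I) (window_avg x j z * h z) @[j --> \oo] --> h x.
Proof.
move=> Ix ch; apply: (window_avg_cvg (h := fun=> h)) => // [j|e e0].
  exact: subspace_continuous_measurable_fun.
have [d d0 Hd] := within_dist ch Ix e0.
apply: filterS (window_shrink x d0) => j Hj z /Hj[Iz zx].
by rewrite ltW// Hd.
Qed.

End averages.

Lemma cvg_sum_ord {R : realType} (F : nat -> nat -> R) (u : nat -> R) N :
  (forall n, F n j @[j --> \oo] --> u n) ->
  \sum_(n < N) F n j @[j --> \oo] --> \sum_(n < N) u n.
Proof.
move=> H; elim: N => [|N ih].
  by rewrite big_ord0; under eq_fun do rewrite big_ord0; exact: cvg_cst.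
by rewrite big_ord_recr/=; under eq_fun do rewrite big_ord_recr/=; exact: cvgD.
Qed.

Lemma expR_eigenvalue_cvg0 {R : realType} (lam : nat -> R) (s : R) :
  - lam n @[n --> \oo] --> +oo -> 0 < s -> expR (lam n * s) @[n --> \oo] --> 0.
Proof.
move=> lc s0; have H : - lam n * s @[n --> \oo] --> +oo.
  apply/cvgryPge => A; move/cvgryPge : lc => /(_ (A / s)); apply: filterS => n.
  by rewrite ler_pdivrMr.
have := cvg_comp _ _ H (@cvgr_expR R); apply: cvg_trans; apply: near_eq_cvg.
by apply: nearW => n; rewrite /= mulNr opprK.
Qed.

(** * Spectral tails and the pointwise expansion of a continuous kernel *)

Section mercer.
Context {R : realType} (l r : \bar R) (I : set R).
Hypothesis HI : interval_with_endpoints l r I.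
Local Notation leb := (@lebesgue_measure R).
Variables (q : R -> R) (lam : nat -> R) (phi : nat -> R -> R).
Variables (S : R -> (R -> R) -> R -> R) (k : R -> R -> R -> R).
Hypotheses (cq : {within I, continuous q}) (q0 : forall x, I x -> 0 < q x).
Hypothesis iq : leb.-integrable I (EFin \o q).
Hypothesis cphi : forall n, {within I, continuous (phi n)}.
Hypothesis nlam : forall m n, (m <= n)%N -> lam n <= lam m.
Hypothesis lam_cvg : - lam n @[n --> \oo] --> +oo.
Local Notation dot := (L2dot I q).
Local Notation L2 := (L2 I q).
Hypothesis SL2 : forall (s : R) f, 0 <= s -> L2 f -> L2 (S s f).
Hypothesis spectral : forall (s : R) f g, 0 <= s -> L2 f -> L2 g ->
  (\sum_(n < N) expR (lam n * s) * (dot f (phi n) * dot g (phi n))) @[N --> \oo] -->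
  dot (S s f) g.
Hypothesis Sk : forall (s : R) y j z, 0 < s -> I y -> I z ->
  S s (window_avg I y j) z = \int[leb]_(w in I) (window_avg I y j w * k s z w).
Hypothesis mk : forall (s : R) z, 0 < s -> I z -> measurable_fun I (k s z).
Hypothesis ck : forall (s : R) x y e, 0 < s -> I x -> I y -> 0 < e ->
  exists2 d, 0 < d & forall z w, I z -> I w -> `|z - x| < d -> `|w - y| < d ->
    `|k s z w - k s x y| < e.

Let mI : measurable I. Proof. exact: measurable_state HI. Qed.
Let mq : measurable_fun I q. Proof. exact: subspace_continuous_measurable_fun. Qed.

Let LA x j : I x -> L2 (window_avg I x j).
Proof.
move=> Ix; apply: (bounded_L2 (M := (window_mass I x j)^-1) mI mq q0 iq).
  exact: window_avg_measurable HI _ _.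
move=> z Iz; rewrite ger0_norm ?(window_avg_ge0 HI)//.
by rewrite ler_piMr// ?invr_ge0 ?(ltW (window_mass_gt0 HI _ Ix))// indicE lern1 leq_b1.
Qed.

(** For [n >= N], [exp(lam n * s)] is at most [exp(lam N * (s/2)) * exp(lam n * (s/2))]; with
    [2 |a b| <= a^2 + b^2] the tail is bounded by spectral series at time [s/2], all of whose terms
    are nonnegative. *)
Lemma spectral_tail (s : R) N f g : 0 < s -> L2 f -> L2 g ->
  `|dot (S s f) g - \sum_(n < N) expR (lam n * s) * (dot f (phi n) * dot g (phi n))| <=
  expR (lam N * (s / 2)) / 2 * (dot (S (s / 2) f) f + dot (S (s / 2) g) g).
Proof.
move=> s0 Lf Lg; have s20 : 0 <= s / 2 by rewrite divr_ge0// ltW.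
pose a n := dot f (phi n); pose b n := dot g (phi n).
have C1 := spectral (ltW s0) Lf Lg.
have C2 := spectral s20 Lf Lf; have C3 := spectral s20 Lg Lg.
set A := \sum_(n < N) _; set c := expR (lam N * (s / 2)) / 2.
have L1 : `|\sum_(n < M) expR (lam n * s) * (a n * b n) - A| @[M --> \oo] -->
    `|dot (S s f) g - A|.
  by apply: cvg_norm; apply: cvgB => //; exact: cvg_cst.
have L2' : c * (\sum_(n < M) expR (lam n * (s / 2)) * (a n * a n) +
    \sum_(n < M) expR (lam n * (s / 2)) * (b n * b n)) @[M --> \oo] -->
    c * (dot (S (s / 2) f) f + dot (S (s / 2) g) g).
  by apply: cvgM; [exact: cvg_cst|exact: cvgD].
apply: (ler_cvg_to L1 L2'); exists N => // M /= NM.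
have c0 : 0 <= c by rewrite divr_ge0// expR_ge0.
rewrite /A -!(big_mkord xpredT (fun n => expR (lam n * s) * (a n * b n))).
rewrite (big_cat_nat (leq0n N) NM)//= addrAC subrr add0r.
rewrite -(big_mkord xpredT (fun n => expR (lam n * (s / 2)) * (a n * a n))).
rewrite -(big_mkord xpredT (fun n => expR (lam n * (s / 2)) * (b n * b n))).
rewrite -big_split/= (big_cat_nat (leq0n N) NM)//= mulrDr.
apply: (le_trans (ler_norm_sum _ _ _)).
apply: (@le_trans _ _ (c * \sum_(N <= n < M)
    (expR (lam n * (s / 2)) * (a n * a n) + expR (lam n * (s / 2)) * (b n * b n)))).
  rewrite mulr_sumr; apply: ler_sum_nat => n /andP[Nn _].
  rewrite -mulrDr [leRHS]mulrA /c.
  have e0 := expR_ge0 (lam n * (s / 2)).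
  have -> : expR (lam n * s) = expR (lam n * (s / 2)) * expR (lam n * (s / 2)).
    by rewrite -expRD -mulrDr -splitr.
  have eN : expR (lam n * (s / 2)) <= expR (lam N * (s / 2)).
    by rewrite ler_expR ler_wpM2r// nlam.
  rewrite normrM (ger0_norm (mulr_ge0 e0 e0)).
  have ab : `|a n * b n| <= (a n * a n + b n * b n) / 2.
    rewrite ler_norml; have := sqr_ge0 (a n - b n); have := sqr_ge0 (a n + b n).
    by move=> h1 h2; apply/andP; split; nra.
  apply: (@le_trans _ _ (expR (lam N * (s / 2)) * expR (lam n * (s / 2)) *
     ((a n * a n + b n * b n) / 2))).
    by rewrite ler_pM ?mulr_ge0// ler_wpM2r.
  by rewrite le_eqVlt; apply/orP; left; apply/eqP; ring.
rewrite lerDr mulr_ge0//; apply: sumr_ge0 => n _.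
by rewrite -mulrDr mulr_ge0 ?expR_ge0// addr_ge0// -expr2 sqr_ge0.
Qed.

Lemma window_coef_cvg x n : I x ->
  dot (window_avg I x j) (phi n) @[j --> \oo] --> phi n x * q x.
Proof.
move=> Ix; have ch : {within I, continuous (fun z => phi n z * q z)}.
  by move=> z; apply: cvgM; [exact: cphi|exact: cq].
apply: cvg_trans (window_avg_cvg_cst HI Ix ch); apply: near_eq_cvg; apply: nearW => j.
by apply: eq_Rintegral => z _; rewrite mulrA.
Qed.

(** The inner average is close to [k s x y] uniformly over the outer window by joint continuity of
    the kernel; the factor [q x] comes from the weight of the scalar product. *)
Lemma window_kernel_cvg (s x y : R) : 0 < s -> I x -> I y ->
  dot (S s (window_avg I y j)) (window_avg I x j) @[j --> \oo] --> k s x y * q x.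
Proof.
move=> s0 Ix Iy; pose h j z := S s (window_avg I y j) z * q z.
have mh j : measurable_fun I (h j).
  by apply: measurable_funM => //; apply: (SL2 (ltW s0) (LA j Iy)).1.
have := window_avg_cvg HI (h := h) (v := k s x y * q x) Ix mh.
have E j : \int[leb]_(z in I) (window_avg I x j z * h j z) =
    dot (S s (window_avg I y j)) (window_avg I x j).
  by apply: eq_Rintegral => z _; rewrite /h mulrCA mulrA.
under eq_fun do rewrite E; apply=> e e0.
(* [e' * M] covers the three terms of the expanded product below: [A * B] using [e' <= 1],
   [A * q x], and [k s x y * B]. *)
pose M := `|k s x y| + q x + 1.
have qx := q0 Ix.
have M0 : 0 < M by rewrite ltr_wpDl// addr_ge0// ltW.
pose e' := Num.min 1 (e / (2 * M)).
have e'0 : 0 < e' by rewrite lt_min ltr01/= divr_gt0// mulr_gt0.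
have [d1 d10 H1] := ck s0 Ix Iy e'0.
have [d2 d20 H2] := within_dist cq Ix e'0.
have n1 := window_shrink I x d10; have n2 := window_shrink I x d20.
have n3 := window_shrink I y d10.
apply: filterS3 n1 n2 n3 => j h1 h2 h3 z wz.
have [Iz z1] := h1 _ wz; have [_ z2] := h2 _ wz.
have kz : `|S s (window_avg I y j) z - k s x y| <= e'.
  rewrite Sk//; have [|_ kz] := window_avg_bound HI (j := j) (v := k s x y) (e := e') Iy (mk s0 Iz);
    last exact: kz.
  by move=> w /h3[Iw wy]; apply/ltW/H1.
have qz : `|q z - q x| <= e' by exact/ltW/H2.
have -> : h j z - k s x y * q x =
    (S s (window_avg I y j) z - k s x y) * (q z - q x) +
    (S s (window_avg I y j) z - k s x y) * q x + k s x y * (q z - q x).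
  by rewrite /h; ring.
set A := S s _ z - _ in kz *; set B := q z - q x in qz *.
have e'1 : e' <= 1 by rewrite /e' ge_min lexx.
have e'e : e' * M <= e.
  apply: (@le_trans _ _ (e / (2 * M) * M)).
    by rewrite ler_wpM2r ?(ltW M0)// ge_min lexx orbT.
  by rewrite invfM mulrA divfK ?gt_eqF// ler_piMr ?(ltW e0)// invf_le1// ler1n.
apply: le_trans e'e; rewrite (le_trans (ler_normD _ _))//.
have t1 : `|A * B| <= e' * 1 by rewrite normrM ler_pM// (le_trans qz).
have t2 : `|A * q x| <= e' * q x by rewrite normrM (ger0_norm (ltW qx)) ler_wpM2r// ltW.
have t3 : `|k s x y * B| <= e' * `|k s x y| by rewrite normrM mulrC ler_wpM2r.
apply: le_trans (lerD (le_trans (ler_normD _ _) (lerD t1 t2)) t3) _.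
by rewrite -!mulrDr /M (addrC 1) addrAC -addrA addrCA addrA.
Qed.

(** [N] stays fixed while the windows shrink: the finite sum converges term by term, and the tail
    bound converges to the kernel on the diagonal at time [s/2]. *)
Lemma mercer_bound (s x y : R) N : 0 < s -> I x -> I y ->
  `|k s x y * q x - \sum_(n < N) expR (lam n * s) * (phi n y * q y * (phi n x * q x))| <=
  expR (lam N * (s / 2)) / 2 * (k (s / 2) y y * q y + k (s / 2) x x * q x).
Proof.
move=> s0 Ix Iy; have s20 : 0 < s / 2 by rewrite divr_gt0.
have L1 : `|dot (S s (window_avg I y j)) (window_avg I x j) - \sum_(n < N) expR (lam n * s) *
    (dot (window_avg I y j) (phi n) * dot (window_avg I x j) (phi n))| @[j --> \oo] -->
    `|k s x y * q x - \sum_(n < N) expR (lam n * s) * (phi n y * q y * (phi n x * q x))|.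
  apply: cvg_norm; apply: cvgB; first exact: window_kernel_cvg.
  apply: (cvg_sum_ord (F := fun n j => expR (lam n * s) *
    (dot (window_avg I y j) (phi n) * dot (window_avg I x j) (phi n)))
    (u := fun n => expR (lam n * s) * (phi n y * q y * (phi n x * q x)))) => n.
  apply: cvgM; first exact: cvg_cst.
  by apply: cvgM; exact: window_coef_cvg.
have L2' : expR (lam N * (s / 2)) / 2 * (dot (S (s / 2) (window_avg I y j)) (window_avg I y j) +
    dot (S (s / 2) (window_avg I x j)) (window_avg I x j)) @[j --> \oo] -->
    expR (lam N * (s / 2)) / 2 * (k (s / 2) y y * q y + k (s / 2) x x * q x).
  by apply: cvgM; [exact: cvg_cst|apply: cvgD; exact: window_kernel_cvg].
apply: (ler_cvg_to L1 L2'); apply: nearW => j.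
by apply: spectral_tail => //; exact: LA.
Qed.

(** Dividing [mercer_bound] by [q x * q y] leaves the density of the kernel with respect to
    [q(y) dy]; the bound vanishes as [lam N] tends to minus infinity. *)
Lemma mercer (s x y : R) : 0 < s -> I x -> I y ->
  \sum_(n < N) expR (lam n * s) * (phi n x * phi n y) @[N --> \oo] --> k s x y / q y.
Proof.
move=> s0 Ix Iy; have qx := q0 Ix; have qy := q0 Iy.
pose K := k (s / 2) y y * q y + k (s / 2) x x * q x.
pose F N := \sum_(n < N) expR (lam n * s) * (phi n x * phi n y).
have bd N : `|k s x y / q y - F N| <= expR (lam N * (s / 2)) / 2 * K / (q x * q y).
  rewrite ler_pdivlMr ?mulr_gt0//; apply: le_trans (mercer_bound N s0 Ix Iy).
  rewrite -(gtr0_norm (mulr_gt0 qx qy)) -normrM.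
  rewrite (_ : (k s x y / q y - F N) * (q x * q y) = k s x y * q x -
    \sum_(n < N) expR (lam n * s) * (phi n y * q y * (phi n x * q x)))// mulrBl.
  congr (_ - _); first by field; rewrite gt_eqF.
  by rewrite /F mulr_suml; apply: eq_bigr => n _; ring.
have e0 : expR (lam N * (s / 2)) / 2 * K / (q x * q y) @[N --> \oo] --> 0.
  have ez := expR_eigenvalue_cvg0 lam_cvg (divr_gt0 s0 (@ltr0n R 2 : 0 < 2)).
  have -> : (fun N => expR (lam N * (s / 2)) / 2 * K / (q x * q y)) =
      (fun N => expR (lam N * (s / 2)) * (2^-1 * K / (q x * q y))).
    by apply/funext => N; ring.
  by rewrite -(mul0r (2^-1 * K / (q x * q y))); apply: cvgM => //; exact: cvg_cst.
apply/cvgrPdist_le => e ep; move/cvgrPdist_le : e0 => /(_ e ep); apply: filterS => N.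
by rewrite sub0r normrN => h; exact: le_trans (bd N) (le_trans (ler_norm _) h).
Qed.

End mercer.

Lemma ge0_integral_combination {d : measure_display} {O : measurableType d} {R : realType}
    (P : {measure set O -> \bar R}) (D : set O) (f g h : O -> R) (a : R) :
  measurable D -> measurable_fun D f -> measurable_fun D g -> measurable_fun D h ->
  (forall w, D w -> 0 <= f w) -> (forall w, D w -> 0 <= g w) ->
  (forall w, D w -> 0 <= h w) -> 0 <= a ->
  (\int[P]_(w in D) (f w)%:E + \int[P]_(w in D) (g w)%:E +
   a%:E * \int[P]_(w in D) (h w)%:E = \int[P]_(w in D) (f w + g w + a * h w)%:E)%E.
Proof.
move=> mD mf mg mh f0 g0 h0 a0.
have mfE : measurable_fun D (fun w => (f w)%:E) by exact/measurable_EFinP.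
have mgE : measurable_fun D (fun w => (g w)%:E) by exact/measurable_EFinP.
have mhE : measurable_fun D (fun w => (h w)%:E) by exact/measurable_EFinP.
rewrite -ge0_integralZl//.
rewrite -ge0_integralD// -ge0_integralD//.
- by move=> w Dw; rewrite adde_ge0 ?lee_fin ?f0 ?g0.
- exact: emeasurable_funD.
- by move=> w Dw; rewrite -EFinM lee_fin mulr_ge0 ?h0.
- exact: measurable_funeM.
Qed.

(** * Series integrated over the event that the random time is positive *)

Section random_time_series.
Context {R : realType} {d : measure_display} {O : measurableType d}.
Variables (P : probability O R) (T : O -> R) (lam : nat -> R).
Hypotheses (mT : measurable_fun setT T) (T0 : forall w, 0 <= T w).
Hypotheses (lam0 : forall n, lam n <= 0) (lam_cvg : - lam n @[n --> \oo] --> +oo).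
Local Notation D := [set w | 0 < T w].

(** The Laplace transform of [T] without its atom at 0. The pointwise density integrates the kernel
    over [T > 0] only, so these, and not the full transforms, are the weights of its expansion. *)
Definition positive_time_mean (n : nat) : R := \int[P]_(w in D) expR (lam n * T w).

Let mD : measurable D.
Proof.
rewrite (_ : D = T @^-1` `]0, +oo[); last first.
  by apply/seteqP; split=> w /=; rewrite in_itv/= andbT.
by rewrite -[X in measurable X]setTI; apply: mT => //; exact: measurable_itv.
Qed.

Let mexp n (A : set O) : measurable_fun A (fun w => expR (lam n * T w)).
Proof.
apply: measurable_funTS; apply: (measurableT_comp (@measurable_expR R)).
by apply: measurable_funM; [exact: measurable_cst|].
Qed.

Let exp_le1 n w : expR (lam n * T w) <= 1.
Proof. by rewrite -(@expR0 R) ler_expR mulr_le0_ge0. Qed.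

Let i1 (A : set O) : measurable A -> P.-integrable A (EFin \o cst 1).
Proof.
move=> mA; have i1 : P.-integrable setT (EFin \o cst 1) by exact: finite_measure_integrable_cst.
exact: integrableS i1.
Qed.

Let iexp n (A : set O) : measurable A -> P.-integrable A (EFin \o (fun w => expR (lam n * T w))).
Proof.
move=> mA; apply: le_integrable (i1 mA) => //; first exact/measurable_EFinP.
by move=> w _; rewrite /comp !abse_EFin lee_fin normr1 ger0_norm ?expR_ge0.
Qed.

Lemma positive_time_split n :
  \int[P]_w expR (lam n * T w) = positive_time_mean n + fine (P (~` D)).
Proof.
rewrite -(setUv D) Rintegral_setU//; last 3 first.
- exact: measurableC.
- by rewrite setUv; exact: iexp.
- by rewrite disj_set2E; apply/eqP; exact: setICr.
congr (_ + _); rewrite -[RHS]mul1r -Rintegral_cst//; last exact: measurableC.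
apply: eq_Rintegral => w /set_mem/= /negP; rewrite -leNgt => Tw.
have -> : T w = 0 by apply/eqP; rewrite eq_le Tw T0.
by rewrite mulr0 expR0.
Qed.

Lemma positive_time_mean_cvg0 : positive_time_mean n @[n --> \oo] --> 0.
Proof.
have [||||_] := @dominated_Rintegral _ _ _ P D mD (fun n w => expR (lam n * T w))
  (cst 0) (cst 1).
- by move=> n; exact: mexp.
- by move=> w Tw; exact: expR_eigenvalue_cvg0.
- exact: i1.
- by move=> n w _; rewrite ger0_norm ?expR_ge0//; exact: exp_le1.
by rewrite Rintegral_cst// mul0r.
Qed.

Lemma positive_time_mean_ge0 n : 0 <= positive_time_mean n.
Proof. by apply: Rintegral_ge0 => w _; exact: expR_ge0. Qed.

Section kernel.
Variables (v : nat -> R) (k : R -> R).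
Hypothesis vk : forall s, 0 < s ->
  \sum_(n < N) expR (lam n * s) * v n @[N --> \oo] --> k s.

Lemma measurable_kernel_time : measurable_fun D (fun w => k (T w)).
Proof.
apply: (measurable_fun_cvg (h := fun N w => \sum_(n < N) expR (lam n * T w) * v n)).
  move=> N; apply: measurable_sum => n; apply: measurable_funM; first exact: mexp.
  exact: measurable_cst.
by move=> w Tw; exact: vk.
Qed.

(** Monotone convergence, hence the nonnegative [v]; either side may be infinite. *)
Lemma kernel_time_series : (forall n, 0 <= v n) ->
  (\int[P]_(w in D) (k (T w))%:E = \sum_(0 <= n <oo) (positive_time_mean n * v n)%:E)%E.
Proof.
move=> v0.
transitivity (\int[P]_(w in D) (\sum_(0 <= n <oo) (expR (lam n * T w) * v n)%:E))%E.
  apply: eq_integral => w /set_mem Tw; apply/esym/cvg_lim => //.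
  rewrite (_ : (fun N => _) =
      (fun N => (\sum_(n < N) expR (lam n * T w) * v n)%:E)); last first.
    by apply/funext => N; rewrite big_mkord sumEFin.
  by apply: cvg_EFin; [exact: nearW|exact: vk].
rewrite integral_nneseries//.
- apply: eq_eseriesr => n _.
  transitivity (\int[P]_(w in D) ((v n)%:E * (expR (lam n * T w))%:E))%E.
    by apply: eq_integral => w _; rewrite -EFinM mulrC.
  rewrite integralZl//; last exact: iexp.
  by rewrite mulrC EFinM fineK//; exact: integrable_fin_num (iexp n mD).
- by move=> n; apply/measurable_EFinP; apply: measurable_funM; [exact: mexp|exact: measurable_cst].
- by move=> n w _; rewrite lee_fin mulr_ge0 ?expR_ge0.
Qed.

End kernel.

End random_time_series.

Section transition_kernel.
Context {R : realType} {d : measure_display} {O : measurableType d}.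
Variables (l r : \bar R) (I : set R) (Y : subordinate_data R O).
Variables (lam : nat -> R) (phi : nat -> R -> R) (pX : R -> R -> R -> R).
Hypothesis HI : interval_with_endpoints l r I.
Hypothesis HY : subordinate_diffusion l r I Y.
Hypothesis ES : sd_eigensystem I Y lam phi.
Hypothesis TDX : transition_density I (sd_prob Y) (sd_diffusion Y)
  (fun t x y => (pX t x y)%:E).
Hypothesis cpX : {within [set z : R * R * R | [/\ 0 < z.1.1, I z.1.2 & I z.2]],
  continuous (fun z : R * R * R => pX z.1.1 z.1.2 z.2)}.
Local Notation leb := (@lebesgue_measure R).
Local Notation q := (sd_q I Y).
Local Notation S := (semigroup (sd_prob Y) (sd_diffusion Y)).

Let mI : measurable I. Proof. exact: measurable_state HI. Qed.
Let mI' : measurable (I : set (measurableTypeR R)). Proof. exact: mI. Qed.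

Let mpX (s z : R) : 0 < s -> I z -> measurable_fun I (pX s z).
Proof. by move=> s0 Iz; have [/measurable_EFinP] := TDX s0 Iz. Qed.

Lemma transition_kernel_ge0 (s x y : R) : 0 < s -> I x -> I y -> 0 <= pX s x y.
Proof. by move=> s0 Ix Iy; have [_ /(_ _ Iy)] := TDX s0 Ix; rewrite lee_fin. Qed.

Let ipX (s z : R) : 0 < s -> I z -> leb.-integrable I (EFin \o pX s z).
Proof.
move=> s0 Iz; have [mp p0 law] := TDX s0 Iz.
apply/integrableP; split; first by [].
rewrite (_ : (\int[_]_(_ in _) _)%E = sd_prob Y z (sd_diffusion Y s @^-1` I)).
  apply: le_lt_trans (ltry 1); apply: probability_le1.
  rewrite -[X in measurable X]setTI.
  by apply: (markov_meas (sd_markov HY) (ltW s0)).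
rewrite law//; apply: eq_integral => y /set_mem Iy.
by rewrite gee0_abs// p0.
Qed.

(** A window average is a multiple of an indicator, for which [transition_density] gives the
    expectation directly. *)
Lemma semigroup_window (s y z : R) j : 0 < s -> I y -> I z ->
  S s (window_avg I y j) z = \int[leb]_(w in I) (window_avg I y j w * pX s z w).
Proof.
move=> s0 Iy Iz; have [mp p0 law] := TDX s0 Iz.
set A := window I y j; set c := (window_mass I y j)^-1.
have mA : measurable A by exact: measurable_window HI _ _.
have AI : A `<=` I by move=> w /window_dist[].
have mX : measurable_fun setT (sd_diffusion Y s) := markov_meas (sd_markov HY) (ltW s0).
transitivity (c * fine (sd_prob Y z (sd_diffusion Y s @^-1` A))).
  rewrite /semigroup /window_avg -(integral_indic_comp _ mX mA) RintegralZl//.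
  apply: (@bounded_integrable_prob _ _ _ (sd_prob Y z) (fun w => \1_A (sd_diffusion Y s w)) 1).
    by apply: measurableT_comp => //; exact: measurable_indic.
  by move=> w; rewrite ger0_norm// indicE lern1 leq_b1.
have iA : leb.-integrable I (EFin \o (fun w => \1_A w * pX s z w)).
  apply: le_integrable (ipX s0 Iz) => //.
    apply/measurable_EFinP; apply: measurable_funM; last exact: mpX.
    by apply: measurable_funTS; apply: measurable_indic.
  move=> w Iw; rewrite /comp !abse_EFin lee_fin normrM ler_piMl//.
  by rewrite ger0_norm// indicE lern1 leq_b1.
rewrite /window_avg; under eq_Rintegral do rewrite -mulrA.
rewrite RintegralZl//; congr (_ * _); rewrite law// /Rintegral; congr fine.
have -> : A = I `&` A by apply/seteqP; split=> [w Aw|w []//]; split=> //; exact: AI.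
rewrite integral_mkcondr; apply: eq_integral => w /set_mem Iw; rewrite patchE indicE.
by rewrite -/A; case: ifP => _; rewrite ?mul1r ?mul0r.
Qed.

Lemma kernel_continuous (s x y e : R) : 0 < s -> I x -> I y -> 0 < e ->
  exists2 d', 0 < d' & forall z w, I z -> I w -> `|z - x| < d' -> `|w - y| < d' ->
    `|pX s z w - pX s x y| < e.
Proof.
move=> s0 Ix Iy e0.
have cs := (subspace_continuousP _ _).1 cpX (s, x, y) (And3 s0 Ix Iy).
move/cvgrPdist_lt : cs => /(_ e e0) /nbhs_ballP[d0 /= d00 H]; exists d0 => // z w Iz Iw zx wy.
rewrite distrC; apply: (H (s, z, w)) => //.
by split; [split; [exact: ballxx|rewrite /ball/= distrC]|rewrite /ball/= distrC].
Qed.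

Lemma eigenvalue_nonincreasing m n : (m <= n)%N -> lam n <= lam m.
Proof.
have nd : {homo lam : m n / (m <= n)%N >-> n <= m}.
  by apply/nonincreasing_seqP => k; exact/ltW/(eigenvalue_decr ES).
exact: nd.
Qed.

Lemma sd_mercer (s x y : R) : 0 < s -> I x -> I y ->
  \sum_(n < N) expR (lam n * s) * (phi n x * phi n y) @[N --> \oo] --> pX s x y / q y.
Proof.
exact: (mercer HI (sd_q_continuous HI HY ES) (sd_q_gt0 HI HY ES) (sd_q_integrable HI HY ES)
  (eigenfunction_cont ES) eigenvalue_nonincreasing (eigenvalue_cvg HI HY ES)
  (fun s f => sd_semigroup_L2 HI HY ES (t := s) (f := f))
  (fun s f g => sd_semigroup_spectral HI HY ES (s := s) (f := f) (g := g))
  (fun s y j z => @semigroup_window s y z j) mpX kernel_continuous).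
Qed.

Section subordinated.
Variables (t x : R).
Hypotheses (t0 : 0 < t) (Ix : I x).
Local Notation P := (sd_prob Y x).
Local Notation T := (sd_subordinator Y t).
Local Notation psi n := (sd_phi Y (- lam n)).
Local Notation c n := (positive_time_mean P T lam n).

Let HT := sd_is_subordinator HY Ix.
Let mT : measurable_fun setT T. Proof. exact: (levy_meas (subordinator_levy HT) (ltW t0)). Qed.
Let T0 w : 0 <= T w. Proof. exact: (subordinator_ge0 HT _ (ltW t0)). Qed.
Let lam0 n : lam n <= 0. Proof. exact: eigenvalue_le0 ES n. Qed.
Let D := [set w | 0 < T w].
Let mD : measurable D.
Proof.
rewrite (_ : D = T @^-1` `]0, +oo[); last first.
  by apply/seteqP; split=> w /=; rewrite /D/= in_itv/= andbT.
by rewrite -[X in measurable X]setTI; apply: mT => //; exact: measurable_itv.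
Qed.
Let q0 := sd_q_gt0 HI HY ES.

Lemma sd_time_split n : expR (- psi n * t) = c n + fine (P (~` [set w | 0 < T w])).
Proof.
have l0 : 0 <= - lam n by rewrite oppr_ge0.
rewrite -(positive_time_split P mT T0 lam0) -(Rintegral_expR_subordinator HT (ltW t0) l0).
by apply: eq_Rintegral => w _; rewrite opprK.
Qed.

Lemma sd_time_mean_le n : c n <= expR (- psi n * t).
Proof. by rewrite sd_time_split lerDl fine_ge0. Qed.

(** When [gamma > 0], the exponent is at least [gamma] times its argument, so the series is
    dominated by the Mercer series of the diffusion on the diagonal at time [gamma * t], which
    converges. When [gamma = 0], the uniform bound on the compact set [{z}] reduces it to the sum of
    [exp(- psi n * t)]. *)
Lemma sd_diagonal_lty z : I z -> summability I Y lam phi ->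
  (\sum_(0 <= n <oo) (c n * (phi n z * phi n z))%:E < +oo)%E.
Proof.
move=> Iz [_ cases].
have c0 n := positive_time_mean_ge0 P T lam n.
have sq n : 0 <= phi n z * phi n z by rewrite -expr2 sqr_ge0.
case: cases => [g0|[_ bd sum]].
  have gt0 : 0 < sd_gamma Y * t by rewrite mulr_gt0.
  apply: (@le_lt_trans _ _ (\sum_(0 <= n <oo)
      (expR (lam n * (sd_gamma Y * t)) * (phi n z * phi n z))%:E)%E).
    apply: lee_nneseries => n *; rewrite lee_fin; first by rewrite mulr_ge0.
    rewrite ler_wpM2r// (le_trans (sd_time_mean_le n))// ler_expR.
    have := @laplace_exponent_ge_drift _ (sd_gamma Y) (sd_nu Y) (- lam n); rewrite oppr_ge0 => /(_ (lam0 n)).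
    move=> h; rewrite mulrA; apply: ler_wpM2r; first exact: ltW.
    by rewrite lerNl -mulNr mulrC.
  rewrite (_ : (\sum_(0 <= n <oo) _)%E = (pX (sd_gamma Y * t) z z / q z)%:E) ?ltry//.
  apply/cvg_lim => //; rewrite (_ : (fun N => _) = (fun N =>
     (\sum_(n < N) expR (lam n * (sd_gamma Y * t)) * (phi n z * phi n z))%:E)); last first.
    by apply/funext => N; rewrite big_mkord sumEFin.
  by apply: cvg_EFin; [exact: nearW|exact: sd_mercer].
have [M HM] := bd [set z] (@compact_set1 _ z) (fun _ E => eq_ind_r I Iz E).
have M0 : 0 <= M by rewrite (le_trans _ (HM 0%N z _)).
apply: (@le_lt_trans _ _ (\sum_(0 <= n <oo) ((M * M)%:E * (expR (- psi n * t))%:E))%E).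
  apply: lee_nneseries => n *; rewrite ?lee_fin; first by rewrite mulr_ge0.
  rewrite mulrC ler_pM ?sd_time_mean_le// -[leLHS]ger0_norm// normrM.
  by rewrite ler_pM// HM.
rewrite nneseriesZl; last by move=> n _; rewrite lee_fin expR_ge0.
by rewrite lte_mul_pinfty ?lee_fin ?mulr_ge0// sum.
Qed.

Let sq_ge0 (a : R) : 0 <= a * a. Proof. by rewrite -expr2 sqr_ge0. Qed.

(* Polarization: the off-diagonal kernel has no sign termwise, but
   [(phi n x + phi n y)^2] does. *)
Lemma sd_kernel_series y : I y ->
  (\sum_(0 <= n <oo) (c n * (phi n x * phi n x))%:E +
   \sum_(0 <= n <oo) (c n * (phi n y * phi n y))%:E +
   2%:E * \int[P]_(w in [set w | (0 < T w)%R]) (pX (T w) x y / q y)%:E =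
   \sum_(0 <= n <oo) (c n * ((phi n x + phi n y) * (phi n x + phi n y)))%:E)%E.
Proof.
move=> Iy.
have Mxx s (s0 : 0 < s) := sd_mercer s0 Ix Ix.
have Myy s (s0 : 0 < s) := sd_mercer s0 Iy Iy.
have Mxy s (s0 : 0 < s) := sd_mercer s0 Ix Iy.
(* The combination of kernels whose Mercer coefficients are the squares [(phi n x + phi n y)^2]. *)
pose k s := pX s x x / q x + pX s y y / q y + 2 * (pX s x y / q y).
have Mk s : 0 < s -> \sum_(n < N) expR (lam n * s) *
    ((phi n x + phi n y) * (phi n x + phi n y)) @[N --> \oo] --> k s.
  move=> s0; rewrite (_ : (fun N => _) = (fun N =>
    \sum_(n < N) expR (lam n * s) * (phi n x * phi n x) +
    \sum_(n < N) expR (lam n * s) * (phi n y * phi n y) +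
    2 * \sum_(n < N) expR (lam n * s) * (phi n x * phi n y))); last first.
    apply/funext => N; rewrite mulr_sumr -!big_split/=; apply: eq_bigr => n _; ring.
  apply: cvgD; first by apply: cvgD; [exact: Mxx|exact: Myy].
  by apply: cvgM; [exact: cvg_cst|exact: Mxy].
rewrite -(kernel_time_series P mT T0 lam0 Mxx) ?sq_ge0//.
rewrite -(kernel_time_series P mT T0 lam0 Myy) ?sq_ge0//.
rewrite -(kernel_time_series P mT T0 lam0 Mk) ?sq_ge0//.
have mxx := measurable_kernel_time (v := fun n => phi n x * phi n x)
  (k := fun s => pX s x x / q x) mT Mxx.
have myy := measurable_kernel_time (v := fun n => phi n y * phi n y)
  (k := fun s => pX s y y / q y) mT Myy.
have mxy := measurable_kernel_time (v := fun n => phi n x * phi n y)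
  (k := fun s => pX s x y / q y) mT Mxy.
have pos a b (Ia : I a) (Ib : I b) w : D w -> 0 <= pX (T w) a b / q b.
  by move=> Tw; rewrite divr_ge0 ?(transition_kernel_ge0 Tw)// ltW// q0.
exact: (ge0_integral_combination P mD mxx myy mxy (pos x x Ix Ix) (pos y y Iy Iy)
  (pos x y Ix Iy) (ler0n R 2)).
Qed.

Lemma sd_kernel_integral y : I y ->
  (\int[P]_(w in [set w | (0 < T w)%R]) (pX (T w) x y)%:E =
   (q y)%:E * \int[P]_(w in [set w | (0 < T w)%R]) (pX (T w) x y / q y)%:E)%E.
Proof.
move=> Iy; have Mxy s (s0 : 0 < s) := sd_mercer s0 Ix Iy.
rewrite -ge0_integralZl//; last 3 first.
- by apply/measurable_EFinP; exact: (measurable_kernel_time (v := fun n => phi n x * phi n y)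
  (k := fun s => pX s x y / q y) mT Mxy).
- by move=> w Tw; rewrite lee_fin divr_ge0 ?(transition_kernel_ge0 Tw)// ltW// q0.
- by rewrite lee_fin ltW// q0.
by apply: eq_integral => w _; rewrite -EFinM mulrCA divff ?mulr1// gt_eqF// q0.
Qed.

End subordinated.

End transition_kernel.

(** * Equivalent triplets have equal densities *)

(** Solves the polarization identity for the off-diagonal integral, which may itself be infinite;
    [a] stands for the two diagonal sums. *)
Lemma ereal_affine_inj {R : realType} (a x y : \bar R) : a \is a fin_num ->
  (a + 2%:E * x = a + 2%:E * y)%E -> x = y.
Proof.
move=> fa; rewrite !(addeC a) => H.
have {}H : (2%:E * x = 2%:E * y)%E by rewrite -(addeK (2%:E * x)%E fa) H addeK.
have E (z : \bar R) : ((2^-1 : R)%:E * (2%:E * z) = z)%E by rewrite muleA -EFinM mulVf ?mul1e.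
by rewrite -(E x) H E.
Qed.

Section equivalent_processes.
Context {R : realType} {d1 d2 : measure_display}.
Context {O1 : measurableType d1} {O2 : measurableType d2}.
Variables (l r : \bar R) (I : set R).
Variables (Y1 : subordinate_data R O1) (Y2 : subordinate_data R O2).
Variables (lam1 lam2 : nat -> R) (phi1 phi2 : nat -> R -> R) (c : R).
Hypothesis HI : interval_with_endpoints l r I.
Hypotheses (HY1 : subordinate_diffusion l r I Y1) (HY2 : subordinate_diffusion l r I Y2).
Hypotheses (ES1 : sd_eigensystem I Y1 lam1 phi1) (ES2 : sd_eigensystem I Y2 lam2 phi2).
Hypotheses (c0 : 0 < c) (EQ : equivalent_triplets I Y1 Y2 lam1 c).
Local Notation leb := (@lebesgue_measure R).
Local Notation q1 := (sd_q I Y1).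
Local Notation q2 := (sd_q I Y2).
Local Notation psi1 n := (sd_phi Y1 (- lam1 n)).
Local Notation psi2 n := (sd_phi Y2 (- lam2 n)).

Let cn : c != 0. Proof. by rewrite gt_eqF. Qed.
Let mI := measurable_state HI.
Let mI' : measurable (I : set (measurableTypeR R)) := mI.

Let thetaE x : I x -> sd_mu Y2 x = c * sd_mu Y1 x /\ sd_sigma Y2 x ^+ 2 = c * sd_sigma Y1 x ^+ 2.
Proof.
move=> Ix; have [/(_ _ Ix) H _ _] := EQ; move: H => [-> ->].
by rewrite /GRing.scale/= !mulrA divff// !mul1r.
Qed.

(** The ratio [2 mu / sigma^2] is unchanged, so the exponentials agree and only the factor
    [sigma^-2] scales. *)
Lemma equivalent_speed_density x : I x ->
  speed_density I (sd_mu Y1) (sd_sigma Y1) x = c * speed_density I (sd_mu Y2) (sd_sigma Y2) x.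
Proof.
move=> Ix; have Ix0 : I (xget 0 I) by exact: xget_state HI.
have hE y : I y -> 2 * sd_mu Y1 y / sd_sigma Y1 y ^+ 2 = 2 * sd_mu Y2 y / sd_sigma Y2 y ^+ 2.
  move=> Iy; have [-> ->] := thetaE Iy.
  have s0 : sd_sigma Y1 y != 0 by rewrite gt_eqF// (reg_pos (sd_regular HI HY1 ES1)).
  by field; rewrite cn s0.
have oE : oriented_integral (fun y => 2 * sd_mu Y1 y / sd_sigma Y1 y ^+ 2) (xget 0 I) x =
    oriented_integral (fun y => 2 * sd_mu Y2 y / sd_sigma Y2 y ^+ 2) (xget 0 I) x.
  have E a b : I a -> I b -> \int[leb]_(y in `[a, b]) (2 * sd_mu Y1 y / sd_sigma Y1 y ^+ 2) =
      \int[leb]_(y in `[a, b]) (2 * sd_mu Y2 y / sd_sigma Y2 y ^+ 2).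
    move=> Ia Ib; apply: eq_Rintegral => y /set_mem; rewrite /= in_itv/= => /andP[ay yb].
    by apply: hE; exact: state_segment HI _ _ _ Ia Ib ay yb.
  by rewrite /oriented_integral; case: ifP => _; rewrite E.
have [_ s2] := thetaE Ix.
rewrite /speed_density oE s2 [RHS]mulrA; congr (_ * _).
by rewrite (invfM c) mulVKf.
Qed.

Lemma equivalent_stationary_density x : I x -> q1 x = q2 x.
Proof.
move=> Ix; have reg2 := sd_regular HI HY2 ES2.
have Z2n := reg_mass reg2.
pose Z2 := \int[leb]_(y in I) speed_density I (sd_mu Y2) (sd_sigma Y2) y.
have i2 : leb.-integrable I (EFin \o speed_density I (sd_mu Y2) (sd_sigma Y2)).
  have := integrable_scale mI Z2 (sd_q_integrable HI HY2 ES2).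
  apply: eq_integrable => // y _ /=; rewrite /sd_q /stationary_density -/Z2.
  by rewrite mulrC divfK.
have ZE : \int[leb]_(y in I) speed_density I (sd_mu Y1) (sd_sigma Y1) y = c * Z2.
  rewrite -RintegralZl//; apply: eq_Rintegral => y /set_mem Iy.
  exact: equivalent_speed_density.
rewrite /sd_q /stationary_density ZE equivalent_speed_density// -/Z2.
by rewrite -mulf_div divff// mul1r.
Qed.

Let q12 := equivalent_stationary_density.

(** The differential expression and the boundary flux [sigma^2 q f'] are both multiplied by [c], so
    the domain is the same and eigenvalues scale by [c]. *)
Lemma equivalent_generator n : L2_generator I q2 (sd_prob Y2) (sd_diffusion Y2) (phi1 n)
  (fun x => c * lam1 n * phi1 n x).
Proof.
have G := eigenfunctionP ES1 n; have [L1 L3 _] := G.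
have [f0 f0E D] := ((sd_is_diffusion HY1).2 _ _ L1 L3).1 G.
have B2 : orthobasis I q2 phi1 := orthobasis_weight q12 (sd_orthobasis ES1).
have Lp := ob_L2 B2 n.
have mq2 := sd_q_measurable HI HY2 ES2; have q20 := sd_q_gt0 HI HY2 ES2.
apply/((sd_is_diffusion HY2).2 _ _ Lp (L2Z mI mq2 q20 (c * lam1 n) Lp)).
exists f0; first exact: f0E.
have [f1 [f2 [df incr ode t0 t1]]] := D.
have sqE x : I x -> sd_sigma Y2 x ^+ 2 * q2 x * f1 x = c * (sd_sigma Y1 x ^+ 2 * q1 x * f1 x).
  by move=> Ix; have [_ ->] := thetaE Ix; rewrite q12// !mulrA.
exists f1, f2; split; [exact: df|exact: incr| | |].
- apply: ae_imp ode => x Hx Ix; have [-> ->] := thetaE Ix.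
  by rewrite -mulrA Hx//; ring.
- move=> e e0; have ec : 0 < e / c by rewrite divr_gt0.
  have [a ia Ha] := t0 _ ec; exists a => // x lx xa.
  have Ix : I x by apply: (interior_state HI); split=> //; apply: lt_trans ia.2; rewrite lte_fin.
  by rewrite sqE// normrM (gtr0_norm c0) mulrC -ltr_pdivlMr// Ha.
- move=> e e0; have ec : 0 < e / c by rewrite divr_gt0.
  have [a ia Ha] := t1 _ ec; exists a => // x ax xr.
  have Ix : I x by apply: (interior_state HI); split=> //; apply: lt_trans ia.1 _; rewrite lte_fin.
  by rewrite sqE// normrM (gtr0_norm c0) mulrC -ltr_pdivlMr// Ha.
Qed.

(** The coefficient along [phi2 m] of the second semigroup applied to [phi1 k] at time 1 is computed
    in two ways, with [exp(c * lam1 k)] and with [exp(lam2 m)]; this is the orthogonality that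
    [orthobasis_match] requires. *)
Lemma equivalent_eigensystem n : c * lam1 n = lam2 n /\
  exists2 e : R, e ^+ 2 = 1 & forall x, I x -> phi1 n x = e * phi2 n x.
Proof.
have B1 : orthobasis I q2 phi1 := orthobasis_weight q12 (sd_orthobasis ES1).
have B2 := sd_orthobasis ES2.
have mq2 := sd_q_measurable HI HY2 ES2; have q20 := sd_q_gt0 HI HY2 ES2.
have [||k m|/expR_inj E [e e1 ae]] := orthobasis_match mI mq2 q20
  (a := fun n => expR (c * lam1 n)) (b := fun n => expR (lam2 n)) B1 B2 _ _ _ n.
- by move=> k; rewrite ltr_expR ltr_pM2l//; exact: eigenvalue_decr ES1 k.
- by move=> k; rewrite ltr_expR; exact: eigenvalue_decr ES2 k.
- have Lk := ob_L2 B1 k; have Lm := ob_L2 B2 m.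
  have le0 : c * lam1 k <= 0 by rewrite pmulr_rle0// (eigenvalue_le0 ES1).
  have ae := generator_semigroup HI HY2 ES2 le0 (equivalent_generator k) ler01.
  have LS := sd_semigroup_L2 HI HY2 ES2 ler01 Lk.
  have H := sd_semigroup_coef HI HY2 ES2 m ler01 Lk.
  have Le := L2Z mI mq2 q20 (expR (c * lam1 k * 1)) Lk.
  have := dot_ae mI mq2 LS.1 Le.1 Lm.1 ae.
  rewrite H (dotZl mI mq2 q20 _ Lk Lm).
  have aux (u v w : R) : expR (v * 1) * w = expR (u * 1) * w -> (expR u - expR v) * w = 0.
    by rewrite !mulr1 => h; rewrite mulrBl h subrr.
  exact: aux.
split=> //; exists e => //.
apply: (within_ae_eq HI) ae; first exact: eigenfunction_cont ES1 n.
by move=> x; apply: cvgM; [exact: cvg_cst|exact: (eigenfunction_cont ES2 (n := n))].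
Qed.

Lemma equivalent_exponent n : psi1 n = psi2 n.
Proof.
case: n => [|n].
  by rewrite (sd_exponent0 (lam := lam1) (phi := phi1) ES1) (sd_exponent0 (lam := lam2) (phi := phi2) ES2).
have [x1 S1] := state_subordinator HI HY1; have [x2 S2] := state_subordinator HI HY2.
have a0 : 0 < - lam1 n.+1 by rewrite oppr_gt0; exact: eigenvalue_lt0 ES1 n.
have ca0 : 0 < c * - lam1 n.+1 by rewrite mulr_gt0.
have [_ E1] := laplace_exponent_tail (sd_gamma Y1) (subordinator_levy_measure S1) a0.
have [_ E2] := laplace_exponent_tail (sd_gamma Y2) (subordinator_levy_measure S2) ca0.
have [f2 _] := laplace_exponent_tail (sd_gamma Y2) (subordinator_levy_measure S2) ca0.
have [lamE _] := equivalent_eigensystem n.+1.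
have [_ gE /(_ n.+1 isT) wE] := EQ.
rewrite /sd_phi -lamE -mulrN E1 E2.
have -> : fine (levy_tail_transform (sd_nu Y1) (- lam1 n.+1)) =
    c * fine (levy_tail_transform (sd_nu Y2) (c * - lam1 n.+1)).
  move: wE; rewrite /sd_omega_hat -mulrN => ->.
  by rewrite fineM.
by rewrite gE; ring.
Qed.

(** Each density is [q y] times the off-diagonal term of its polarization identity; all three series
    in that identity have the same terms for the two processes. *)
Lemma equivalent_pointwise_density (p1 p2 : R -> R -> R -> \bar R) :
  summability I Y1 lam1 phi1 -> summability I Y2 lam2 phi2 ->
  pointwise_density I Y1 p1 -> pointwise_density I Y2 p2 ->
  identical_densities I p1 p2.
Proof.
move=> sum1 sum2 [k1 [TD1 ck1 p1E]] [k2 [TD2 ck2 p2E]] t x y t0 Ix Iy.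
rewrite p1E// p2E//.
rewrite (sd_kernel_integral HI HY1 ES1 TD1 ck1 t0 Ix Iy).
rewrite (sd_kernel_integral HI HY2 ES2 TD2 ck2 t0 Ix Iy) q12//; congr (_ * _)%E.
have S1 := sd_kernel_series HI HY1 ES1 TD1 ck1 t0 Ix Iy.
have S2 := sd_kernel_series HI HY2 ES2 TD2 ck2 t0 Ix Iy.
pose c1 n := positive_time_mean (sd_prob Y1 x) (sd_subordinator Y1 t) lam1 n.
pose c2 n := positive_time_mean (sd_prob Y2 x) (sd_subordinator Y2 t) lam2 n.
have T1 := sd_is_subordinator HY1 Ix; have T2 := sd_is_subordinator HY2 Ix.
have cvg_c d (O : measurableType d) (Y : subordinate_data R O) lam phi :
    subordinate_diffusion l r I Y -> sd_eigensystem I Y lam phi ->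
    positive_time_mean (sd_prob Y x) (sd_subordinator Y t) lam n @[n --> \oo] --> 0.
  move=> HY ES; have HT := sd_is_subordinator HY Ix.
  apply: positive_time_mean_cvg0.
  - exact: (levy_meas (subordinator_levy HT) (ltW t0)).
  - by move=> w; exact: (subordinator_ge0 HT _ (ltW t0)).
  - exact: eigenvalue_le0 ES.
  - exact: eigenvalue_cvg HI HY ES.
have c12 n : c1 n = c2 n.
  have s1 m := sd_time_split HY1 ES1 t0 Ix m; have s2 m := sd_time_split HY2 ES2 t0 Ix m.
  (* By [sd_time_split] the difference is that of the probabilities of [T_t = 0] for the two
     subordinators, the same for every [m]; since both sequences tend to 0, it is 0. *)
  have D0 : (fun m => c1 m - c2 m) = (fun=> c1 n - c2 n).
    have aux (a b u f g : R) : u = a + f -> u = b + g -> a - b = g - f.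
      move=> h1 h2; have -> : a = u - f by rewrite h1 addrK.
      have -> : b = u - g by rewrite h2 addrK.
      by rewrite opprB addrC addrA subrK.
    have cE k : c1 k - c2 k = fine (sd_prob Y2 x (~` [set w | 0 < sd_subordinator Y2 t w])) -
        fine (sd_prob Y1 x (~` [set w | 0 < sd_subordinator Y1 t w])).
      by apply: (aux _ _ (expR (- psi1 k * t)) _ _ (s1 k)); rewrite equivalent_exponent; exact: s2.
    by apply/funext => m; rewrite !cE.
  have : (fun m => c1 m - c2 m) @ \oo --> (0 - 0 : R).
    by apply: cvgB; [exact: cvg_c HY1 ES1|exact: cvg_c HY2 ES2].
  rewrite D0 subr0 => H; apply/eqP; rewrite -subr_eq0; apply/eqP.
  exact: (cvg_unique (@Rhausdorff R) (cvg_cst _) H).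
have phiE : exists e : nat -> R, forall n, e n ^+ 2 = 1 /\
    forall z, I z -> phi1 n z = e n * phi2 n z.
  have ex n : exists e : R, e ^+ 2 = 1 /\ forall z, I z -> phi1 n z = e * phi2 n z.
    by have [_ [e e1 eE]] := equivalent_eigensystem n; exists e.
  have [e He] := choice ex; exists e; exact: He.
have [e He] := phiE; have e1 n := (He n).1; have eE n z := (He n).2 z.
(* The signs occur only in products of two values with the same index, where [e n ^+ 2 = 1] removes
   them; the squared sums of the polarization are of this kind. *)
have prodE n (a b : R) : (e n * a) * (e n * b) = a * b.
  by rewrite mulrACA -expr2 e1 mul1r.
have E z : I z -> (\sum_(0 <= n <oo) (c1 n * (phi1 n z * phi1 n z))%:E =
    \sum_(0 <= n <oo) (c2 n * (phi2 n z * phi2 n z))%:E)%E.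
  by move=> Iz; apply: eq_eseriesr => n _; rewrite c12 eE// prodE.
have E2 : (\sum_(0 <= n <oo) (c1 n * ((phi1 n x + phi1 n y) * (phi1 n x + phi1 n y)))%:E =
    \sum_(0 <= n <oo) (c2 n * ((phi2 n x + phi2 n y) * (phi2 n x + phi2 n y)))%:E)%E.
  by apply: eq_eseriesr => n _; rewrite c12 !eE// -mulrDr prodE.
move: S1; rewrite -/c1 E2 (E _ Ix) (E _ Iy) -{}S2 -/c2 => S.
have fin z : I z -> (\sum_(0 <= n <oo) (c2 n * (phi2 n z * phi2 n z))%:E)%E \is a fin_num.
  move=> Iz; rewrite ge0_fin_numE.
    exact: (sd_diagonal_lty HI HY2 ES2 TD2 ck2 t0 Ix Iz sum2).
  apply: nneseries_ge0 => n _ _; rewrite lee_fin mulr_ge0 ?positive_time_mean_ge0//.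
  by rewrite -expr2 sqr_ge0.
rewrite (q12 Iy) in S; apply: (ereal_affine_inj _ S).
by rewrite fin_numD; apply/andP; split; [exact: fin Ix|exact: fin Iy].
Qed.

End equivalent_processes.

Theorem theorem2p1 (R : realType) (l r : \bar R) (I : set R)
    (d1 d2 : measure_display) (O1 : measurableType d1) (O2 : measurableType d2)
    (Y1 : subordinate_data R O1) (Y2 : subordinate_data R O2)
    (lam1 lam2 : nat -> R) (phi1 phi2 : nat -> R -> R)
    (p1 p2 : R -> R -> R -> \bar R) :
  interval_with_endpoints l r I ->
  subordinate_diffusion l r I Y1 ->
  subordinate_diffusion l r I Y2 ->
  sd_eigensystem I Y1 lam1 phi1 ->
  sd_eigensystem I Y2 lam2 phi2 ->
  transition_density I (sd_prob Y1) (sd_process Y1) p1 ->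
  transition_density I (sd_prob Y2) (sd_process Y2) p2 ->
  (identical_densities I p1 p2 ->
     exists2 c : R, 0 < c & equivalent_triplets I Y1 Y2 lam1 c) /\
  (forall c : R, 0 < c -> equivalent_triplets I Y1 Y2 lam1 c ->
     summability I Y1 lam1 phi1 -> summability I Y2 lam2 phi2 ->
     pointwise_density I Y1 p1 -> pointwise_density I Y2 p2 ->
     identical_densities I p1 p2).
Proof.
move=> HI HY1 HY2 ES1 ES2 TD1 TD2; split=> [p12|c c0 EQ sum1 sum2 pd1 pd2].
  exact: (equivalent_of_same_densities HI HY1 HY2 ES1 ES2 TD1 TD2 p12).
exact: (equivalent_pointwise_density HI HY1 HY2 ES1 ES2 c0 EQ sum1 sum2 pd1 pd2).
Qed.
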